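(* Let $d\ge1$, let $X_1,\dots,X_n\in\mathbb{R}^d$ be fixed, let $\pi^*$ be an unknown permutation of $\{1,\dots,n\}$ and let $Y_i=f^*(X_{\pi^*(i)})+\epsilon_i$, $1\le i\le n$, where $\epsilon_1,\dots,\epsilon_n$ are i.i.d. $N(0,\sigma^2I_d)$ with $\sigma>0$ known. Assume $f^*=\nabla\psi_{f^*}$ for a differentiable $\psi_{f^*}:\mathbb{R}^d\to\mathbb{R}$ satisfying: (A1) $\psi_{f^*}(z)\ge\psi_{f^*}(x)+\langle\nabla\psi_{f^*}(x),z-x\rangle+\frac{\lambda}{2}\|x-z\|_2^2$ for all $x,z$ (some $\lambda>0$); (A2) $\psi_{f^*}(z)\le\psi_{f^*}(x)+\langle\nabla\psi_{f^*}(x),z-x\rangle+\frac{L}{2}\|x-z\|_2^2$ for all $x,z$ (some $L>0$); (A3) $\max_{1\le i\le n}\|f^*(X_i)\|_2\le B$ for some $0<B<\infty$. Let $\widehat f(X_1),\dots,\widehat f(X_n)$ be the output of the denoising procedure described in the context. Then there are constants $C_0,C>0$ depending only on $d,B,\sigma$ such that if $n\ge C_0(\log n)^{d+1}$, then with probability at least $1-5/n$, $$\frac1n\sum_{i=1}^n\|\widehat f(X_i)-f^*(X_i)\|_2^2\le C\,\frac{L}{\lambda}\,\frac{1}{\log n}.$$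
   Context: Let $\varphi_\sigma$ denote the density of $N(0,\sigma^2I_d)$. Denoising procedure: (1) Compute the Kiefer–Wolfowitz nonparametric maximum likelihood estimator (NPMLE), i.e. a minimizer $\widehat{\mathsf f}_n$ of $-\sum_{i=1}^n\log\mathsf f(Y_i)$ over all densities of the form $\mathsf f(y)=\int\varphi_\sigma(y-\theta)\,d\nu(\theta)$ with $\nu$ a probability distribution on $\mathbb{R}^d$; the associated mixing measure is atomic, $\widehat\nu=\sum_{j=1}^p\widehat\alpha_j\delta_{\widehat\theta_j}$ with $\widehat\alpha_j>0$, $\sum_j\widehat\alpha_j=1$. (2) Compute an optimal coupling matrix $\widehat\Gamma\in\mathbb{R}_+^{n\times p}$ minimizing $\sum_{i,j}\Gamma_{ij}\frac12\|X_i-\widehat\theta_j\|_2^2$ subject to $\sum_i\Gamma_{ij}=\widehat\alpha_j$ for all $j$ and $\sum_j\Gamma_{ij}=1/n$ for all $i$. (3) Output the barycentric projection $\widehat f(X_i)=n\sum_{j=1}^p\widehat\Gamma_{ij}\widehat\theta_j$, $1\le i\le n$. *)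

(* Defs.v *)
From HB Require Import structures.
From mathcomp Require Import all_boot all_order all_algebra.
From mathcomp Require Import all_classical all_reals all_analysis.
Set Implicit Arguments. Unset Strict Implicit. Unset Printing Implicit Defensive.
Import Order.TTheory GRing.Theory Num.Theory.
Import numFieldNormedType.Exports.
Local Open Scope classical_set_scope.
Local Open Scope ring_scope.

Section Defs.
Variable R : realType.

Definition sqnorm (d : nat) (v : 'rV[R]_d) : R := \sum_(k < d) v ord0 k ^+ 2.
Definition inner (d : nat) (u v : 'rV[R]_d) : R := \sum_(k < d) u ord0 k * v ord0 k.

Definition phi (d : nat) (sigma : R) (v : 'rV[R]_d) : R :=
  (Num.sqrt (sigma ^+ 2 * pi *+ 2))^-1 ^+ d * expR (- sqnorm v / (sigma ^+ 2 *+ 2)).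

Definition is_gradient (d : nat) (psi : 'rV[R]_d -> R^o) (f : 'rV[R]_d -> 'rV[R]_d) :=
  forall x, differentiable psi x /\ forall h, 'd psi x h = inner (f x) h.

(* eps_{i} = (eps i k)_k, i < n, are i.i.d. N(0, sigma^2 I_d) random vectors:
   equivalently, all coordinates eps i k are mutually independent N(0, sigma^2)
   real random variables. *)
Definition iid_gaussian_noise (dO : measure_display) (Om : measurableType dO)
  (P : probability Om R) (n d : nat) (sigma : R) (eps : 'I_n -> 'I_d -> Om -> R) :=
  (forall i k, measurable_fun setT (eps i k)) /\
  (forall i k (A : set R), measurable A ->
      P (eps i k @^-1` A) = normal_prob 0 sigma A) /\
  (forall A : 'I_n -> 'I_d -> set R, (forall i k, measurable (A i k)) ->
      P (\big[setI/setT]_(ik : 'I_n * 'I_d) (eps ik.1 ik.2 @^-1` A ik.1 ik.2)) =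
      (\prod_(ik : 'I_n * 'I_d) P (eps ik.1 ik.2 @^-1` A ik.1 ik.2))%E).

(* value at y of the Gaussian location mixture with mixing measure the
   pushforward of nu by th (every Borel probability on R^d is of this form) *)
Definition mixture_density (d : nat) (sigma : R) (dT : measure_display)
  (T : measurableType dT) (nu : probability T R) (th : T -> 'rV[R]_d)
  (y : 'rV[R]_d) : R :=
  fine (\int[nu]_t (phi sigma (y - th t))%:E)%E.

(* The atomic mixing measure nu^ = sum_j alpha_j delta_{theta_j} gives a
   Kiefer--Wolfowitz NPMLE for the sample Y: the negative log-likelihood of
   its mixture density is minimal among all Gaussian location mixtures
   with an arbitrary probability mixing measure on R^d. *)
Definition is_NPMLE (n d : nat) (sigma : R) (Y : 'I_n -> 'rV[R]_d)
  (p : nat) (alpha : 'I_p -> R) (theta : 'I_p -> 'rV[R]_d) :=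
  (forall j, 0 < alpha j) /\ \sum_(j < p) alpha j = 1 /\
  forall (dT : measure_display) (T : measurableType dT) (nu : probability T R)
         (th : T -> 'rV[R]_d),
    (forall k, measurable_fun setT (fun t => th t ord0 k)) ->
    - \sum_(i < n) ln (\sum_(j < p) alpha j * phi sigma (Y i - theta j))
      <= - \sum_(i < n) ln (mixture_density sigma nu th (Y i)).

Definition is_coupling (n p : nat) (alpha : 'I_p -> R) (G : 'M[R]_(n, p)) :=
  (forall i j, 0 <= G i j) /\
  (forall j, \sum_(i < n) G i j = alpha j) /\
  (forall i, \sum_(j < p) G i j = n%:R^-1).

Definition coupling_cost (n p d : nat) (X : 'I_n -> 'rV[R]_d)
  (theta : 'I_p -> 'rV[R]_d) (G : 'M[R]_(n, p)) : R :=
  \sum_(i < n) \sum_(j < p) G i j * (2^-1 * sqnorm (X i - theta j)).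

Definition is_opt_coupling (n p d : nat) (X : 'I_n -> 'rV[R]_d)
  (alpha : 'I_p -> R) (theta : 'I_p -> 'rV[R]_d) (G : 'M[R]_(n, p)) :=
  is_coupling alpha G /\
  forall G' : 'M[R]_(n, p), is_coupling alpha G' ->
    coupling_cost X theta G <= coupling_cost X theta G'.

Definition barycentric (n p d : nat) (theta : 'I_p -> 'rV[R]_d)
  (G : 'M[R]_(n, p)) (i : 'I_n) : 'rV[R]_d :=
  n%:R *: \sum_(j < p) G i j *: theta j.

End Defs.

(* Main.v *)
Require Import Defs.
From HB Require Import structures.
From mathcomp Require Import all_boot all_order all_algebra.
From mathcomp Require Import all_classical all_reals all_analysis.
From mathcomp Require Import fingroup perm.
From mathcomp Require Import measurable_realfun lebesgue_integral_under ring lra.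
Import Order.TTheory GRing.Theory Num.Theory.
Import numFieldNormedType.Exports.
Local Open Scope classical_set_scope.
Local Open Scope ring_scope.
Set Implicit Arguments.
Unset Strict Implicit.
Unset Printing Implicit Defensive.

(** The strong convexity and smoothness of [psi] make the optimal coupling of
    the design with the NPMLE mixing measure stable: its squared error is at most
    [L / lambda] times the quadratic cost of any coupling between the true mixing
    measure (uniform on the [f*(X_i)]) and the NPMLE one.  So it suffices to
    couple these two measures at cost O(1 / log n).

    The observations are binned into cells of side n^(-c) (times sqrt(log n)),
    few enough for all cell frequencies to concentrate; on a cell the log-density
    of any mixture with atoms in a box of radius O(sqrt(log n)) is almost constant,
    and maximality of the likelihood then gives Hellinger closeness, up to a
    negative power of n, of the two binned mixtures.  To deconvolve, points are
    randomised by a nonnegative trigonometric kernel of frequencies at most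
    c sqrt(log n), whose spread is O(1 / sqrt(log n)); undoing the Gaussian
    convolution on such a kernel costs only a small power of n, so the two
    randomised mixing measures are close in total variation and can be coupled. *)

(** * Stability of the optimal coupling *)

(** The rate comes from a balance of exponents. After scaling by a radius of order sqrt(log n),
    dividing the Gaussian out of a kernel of degree [M] costs a factor exp(c M^2 / log n). With M =
    kappa log n this is a power n^(c kappa^2), and the error n^(-1/(16 d)) of the binned comparison
    absorbs it only for a small fixed kappa. The spread, radius over [M], is then of order 1 /
    sqrt(log n), and its square is the rate.

    Everything is kept finite: cells, lattice points and couplings are finite, d-dimensional
    quantities are sums of products of one-dimensional Gaussian integrals, and a union bound over
    cells replaces uniform control of a class of mixtures. The kernel has to be nonnegative because
    it acts as a transition probability; the periodic cost 1 - cos replaces the squared distance, so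
    that its moments on a lattice are exact.

    The good event constrains the noise alone. Hence no measurability of the estimator is involved,
    and the bound holds for every NPMLE and every optimal coupling. The moduli [lambda] and [L]
    enter only through the stability of the coupling, so the constants do not depend on them. *)

Section euclidean.
Variables (R : realType) (d : nat).
Implicit Types u v w x y z : 'rV[R]_d.

Lemma innerC u v : inner u v = inner v u.
Proof. by apply: eq_bigr => k _; rewrite mulrC. Qed.

Lemma innerDr u v w : inner u (v + w) = inner u v + inner u w.
Proof. by rewrite -big_split; apply: eq_bigr => k _; rewrite mxE mulrDr. Qed.

Lemma innerZr a u v : inner u (a *: v) = a * inner u v.
Proof. by rewrite big_distrr; apply: eq_bigr => k _; rewrite mxE mulrCA. Qed.

Lemma innerNr u v : inner u (- v) = - inner u v.
Proof. by rewrite -scaleN1r innerZr mulN1r. Qed.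

Lemma innerDl u v w : inner (u + v) w = inner u w + inner v w.
Proof. by rewrite innerC innerDr !(innerC w). Qed.

Lemma innerZl a u v : inner (a *: u) v = a * inner u v.
Proof. by rewrite innerC innerZr innerC. Qed.

Lemma innerNl u v : inner (- u) v = - inner u v.
Proof. by rewrite innerC innerNr innerC. Qed.

Lemma sqnormE u : sqnorm u = inner u u.
Proof. by apply: eq_bigr => k _; rewrite expr2. Qed.

Lemma sqnorm_ge0 u : 0 <= sqnorm u.
Proof. by apply: sumr_ge0 => k _; exact: sqr_ge0. Qed.

Definition innerE := (sqnormE, innerDl, innerDr, innerNl, innerNr, innerZl, innerZr).

End euclidean.

Section conjugate.
Variables (R : realType) (d : nat) (psi : 'rV[R]_d -> R) (f : 'rV[R]_d -> 'rV[R]_d).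
Variables lambda L : R.
Hypotheses (lambda0 : 0 < lambda) (L0 : 0 < L).
Hypothesis psi_convex : forall x z,
  psi x + inner (f x) (z - x) + lambda / 2 * sqnorm (x - z) <= psi z.
Hypothesis psi_smooth : forall x z,
  psi z <= psi x + inner (f x) (z - x) + L / 2 * sqnorm (x - z).

Lemma sqnormBC (u v : 'rV[R]_d) : sqnorm (u - v) = sqnorm (v - u).
Proof. by rewrite -opprB sqnormE innerNl innerNr opprK -sqnormE. Qed.

(** Expanding the square of [v - lambda^-1 *: e]; the weights are such that the first term is
    exactly the quadratic term of strong convexity. *)
Lemma inner_young (v e : 'rV[R]_d) :
  inner v e <= lambda / 2 * sqnorm v + (2 * lambda)^-1 * sqnorm e.
Proof.
have := sqnorm_ge0 (v - lambda^-1 *: e); rewrite !innerE (innerC e v).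
set a := inner v v; set b := inner v e; set c := inner e e => H1.
have : 0 <= lambda / 2 * (a + - (lambda^-1 * b) + (- (lambda^-1 * b) + - - (lambda^-1 * (lambda^-1 * c)))).
  by rewrite mulr_ge0 // divr_ge0 // ltW.
have -> : lambda / 2 * (a + - (lambda^-1 * b) + (- (lambda^-1 * b) + - - (lambda^-1 * (lambda^-1 * c))))
  = lambda / 2 * a - b + (2 * lambda)^-1 * c by field; rewrite gt_eqF.
lra.
Qed.

(** Fenchel conjugate as a real [sup], which is meaningful because strong convexity bounds the set
    above ([conjugate_ubound]). *)
Definition conjugate (t : 'rV[R]_d) : R := sup [set inner z t - psi z | z in setT].

Lemma conjugate_ubound x t :
  ubound [set inner z t - psi z | z in setT]
    (inner x t - psi x + (2 * lambda)^-1 * sqnorm (t - f x)).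
Proof.
move=> _ [z _ <-]; have := psi_convex x z; rewrite sqnormBC.
have -> : inner z t = inner x t + inner (f x) (z - x) + inner (z - x) (t - f x).
  by rewrite !innerE (innerC x (f x)) (innerC z (f x)); ring.
have := inner_young (z - x) (t - f x); lra.
Qed.

Lemma conjugate_le x t :
  conjugate t <= inner x t - psi x + (2 * lambda)^-1 * sqnorm (t - f x).
Proof. by apply: ge_sup; [exists (inner 0 t - psi 0); exists 0 | exact: conjugate_ubound]. Qed.

Lemma conjugate_ge x t :
  inner x t - psi x + (2 * L)^-1 * sqnorm (t - f x) <= conjugate t.
Proof.
(* This [z] maximises the quadratic minorant of [inner z t - psi z] that smoothness provides at
   [x]. *)
pose e := t - f x; pose z := x + L^-1 *: e.
apply: (@le_trans _ _ (inner z t - psi z)); last first.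
  apply: ub_le_sup; last by exists z.
  by exists (inner x t - psi x + (2 * lambda)^-1 * sqnorm (t - f x)); exact: conjugate_ubound.
have zx : z - x = L^-1 *: e by rewrite /z addrC addKr.
have := psi_smooth x z; rewrite sqnormBC zx innerZr.
have -> : inner z t = inner x t + L^-1 * inner (f x) e + L^-1 * inner e e.
  by rewrite /z /e !innerE (innerC t (f x)); ring.
rewrite sqnormE innerZl innerZr sqnormE -/e.
set c := inner e e => H.
have L1 : L / 2 * (L^-1 * (L^-1 * c)) = (2 * L)^-1 * c by field; rewrite gt_eqF.
have L2 : L^-1 * c = (2 * L)^-1 * c *+ 2 by rewrite mulr2n; field; rewrite gt_eqF.
move: H; rewrite L1 L2; lra.
Qed.

End conjugate.

(** The difference of the two sides is the variance of [t] under the weights [w]. *)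
Lemma jensen_sqr (R : realType) (p : nat) (w t : 'I_p -> R) (a : R) :
  (forall j, 0 <= w j) -> \sum_j w j = 1 ->
  (\sum_j w j * t j - a) ^+ 2 <= \sum_j w j * (t j - a) ^+ 2.
Proof.
move=> w0 w1; set mu := \sum_j w j * t j.
have : 0 <= \sum_j w j * (t j - mu) ^+ 2.
  by apply: sumr_ge0 => j _; rewrite mulr_ge0// sqr_ge0.
have E b : \sum_j w j * (t j - b) ^+ 2 = \sum_j w j * t j ^+ 2 - 2 * b * mu + b ^+ 2.
  have -> : b ^+ 2 = \sum_j w j * b ^+ 2 by rewrite -mulr_suml w1 mul1r.
  rewrite /mu mulr_sumr -sumrN -!big_split /=.
  by apply: eq_bigr => j _; ring.
rewrite !E; lra.
Qed.

(** Each row of [n%:R * G] is a probability vector with mean the barycentric projection, so Jensen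
    applies in every coordinate. *)
Lemma barycentric_sqnorm_le (R : realType) (n p d : nat) (alpha : 'I_p -> R)
    (theta : 'I_p -> 'rV[R]_d) (G : 'M[R]_(n, p)) (i : 'I_n) (y : 'rV[R]_d) :
  is_coupling alpha G ->
  n%:R^-1 * sqnorm (barycentric theta G i - y) <= \sum_j G i j * sqnorm (theta j - y).
Proof.
move=> [G0 [_ Gr]]; have n0 : 0 < n%:R :> R by rewrite ltr0n (leq_ltn_trans _ (ltn_ord i)).
rewrite mulrC ler_pdivrMr// mulrC.
have -> : n%:R * (\sum_j G i j * sqnorm (theta j - y)) =
    \sum_k \sum_j (n%:R * G i j) * (theta j ord0 k - y ord0 k) ^+ 2.
  rewrite exchange_big /= mulr_sumr; apply: eq_bigr => j _.
  rewrite mulrA mulr_sumr; apply: eq_bigr => k _.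
  by rewrite !mxE.
apply: ler_sum => k _; rewrite !mxE summxE mulr_sumr.
rewrite (eq_bigr (fun j => n%:R * G i j * theta j ord0 k)); last first.
  by move=> j _; rewrite mxE mulrA.
apply: jensen_sqr => [j|]; first by rewrite mulr_ge0 // ltW.
by rewrite -mulr_sumr Gr mulfV // gt_eqF.
Qed.

Lemma coupling_sum_separable (R : realType) (n p : nat) (alpha : 'I_p -> R)
    (G : 'M[R]_(n, p)) (u : 'I_n -> R) (v : 'I_p -> R) :
  is_coupling alpha G ->
  \sum_i \sum_j G i j * (u i + v j) = \sum_i n%:R^-1 * u i + \sum_j alpha j * v j.
Proof.
move=> [_ [Gc Gr]].
under eq_bigr do under eq_bigr do rewrite mulrDr.
under eq_bigr do rewrite big_split /= -mulr_suml Gr.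
rewrite big_split /=; congr (_ + _).
by rewrite exchange_big /=; apply: eq_bigr => j _; rewrite -mulr_suml Gc.
Qed.

(* Adding the separable potentials [psi - |.|^2/2] and [psi^* - |.|^2/2] to the
   quadratic cost does not change the optimal coupling; the new cost is the
   Fenchel gap, which lies between |theta_j - f(X_i)|^2/(2L) and
   |theta_j - f(X_i)|^2/(2 lambda). *)
Lemma opt_coupling_stable (R : realType) (n p d : nat) (X : 'I_n -> 'rV[R]_d)
    (alpha : 'I_p -> R) (theta : 'I_p -> 'rV[R]_d) (G H : 'M[R]_(n, p))
    (psi : 'rV[R]_d -> R) (f : 'rV[R]_d -> 'rV[R]_d) (lambda L : R) :
  0 < lambda -> 0 < L ->
  (forall x z, psi x + inner (f x) (z - x) + lambda / 2 * sqnorm (x - z) <= psi z) ->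
  (forall x z, psi z <= psi x + inner (f x) (z - x) + L / 2 * sqnorm (x - z)) ->
  is_opt_coupling X alpha theta G -> is_coupling alpha H ->
  n%:R^-1 * \sum_i sqnorm (barycentric theta G i - f (X i)) <=
  L / lambda * \sum_i \sum_j H i j * sqnorm (theta j - f (X i)).
Proof.
move=> la0 L0 cvx smth [cG optG] cH.
pose D i j := conjugate psi (theta j) + psi (X i) - inner (X i) (theta j).
have DE i j : D i j = 2^-1 * sqnorm (X i - theta j) +
    ((psi (X i) - 2^-1 * sqnorm (X i)) + (conjugate psi (theta j) - 2^-1 * sqnorm (theta j))).
  by rewrite /D !innerE (innerC (theta j) (X i)); field.
have sumD M : is_coupling alpha M -> \sum_i \sum_j M i j * D i j =
   coupling_cost X theta M +
   (\sum_i n%:R^-1 * (psi (X i) - 2^-1 * sqnorm (X i)) +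
    \sum_j alpha j * (conjugate psi (theta j) - 2^-1 * sqnorm (theta j))).
  move=> cM; rewrite -(coupling_sum_separable _ _ cM) /coupling_cost -big_split /=.
  apply: eq_bigr => i _; rewrite -big_split /=; apply: eq_bigr => j _.
  by rewrite DE mulrDr.
have leD : \sum_i \sum_j G i j * D i j <= \sum_i \sum_j H i j * D i j.
  by rewrite !sumD// lerD2r; exact: optG.
rewrite mulr_sumr; apply: (@le_trans _ _ (\sum_i \sum_j G i j * sqnorm (theta j - f (X i)))).
  by apply: ler_sum => i _; apply: barycentric_sqnorm_le; exact: cG.
have leG : (2 * L)^-1 * (\sum_i \sum_j G i j * sqnorm (theta j - f (X i))) <=
   \sum_i \sum_j G i j * D i j.
  rewrite mulr_sumr; apply: ler_sum => i _; rewrite mulr_sumr; apply: ler_sum => j _.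
  rewrite mulrCA ler_wpM2l//; first by case: cG.
  by have := conjugate_ge la0 L0 cvx smth (X i) (theta j); rewrite /D; lra.
have geH : \sum_i \sum_j H i j * D i j <=
   (2 * lambda)^-1 * (\sum_i \sum_j H i j * sqnorm (theta j - f (X i))).
  rewrite mulr_sumr; apply: ler_sum => i _; rewrite mulr_sumr; apply: ler_sum => j _.
  rewrite mulrCA ler_wpM2l//; first by case: cH.
  by have := conjugate_le la0 cvx (X i) (theta j); rewrite /D; lra.
have := le_trans leG (le_trans leD geH).
set a := \sum_i _; set b := \sum_i _.
rewrite -(ler_pM2l (mulr_gt0 (ltr0n _ 2) L0)) mulrA mulfV ?mul1r; last by rewrite gt_eqF // mulr_gt0.
suff -> : 2 * L * ((2 * lambda)^-1 * b) = L / lambda * b by [].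
by field; rewrite gt_eqF.
Qed.

(* The common mass [min A B] at [z] is coupled through [z]
   (note [min A B / (A B) = 1 / max A B]), the residual masses by a product. *)
Lemma coupling_of_kernels (R : realType) (n p : nat) (Z : finType) (alpha : 'I_p -> R)
    (a : 'I_n -> Z -> R) (b : 'I_p -> Z -> R) (c : 'I_n -> 'I_p -> R)
    (u : 'I_n -> Z -> R) (v : 'I_p -> Z -> R) (M : R) :
  (0 < n)%N -> \sum_j alpha j = 1 ->
  (forall i z, 0 <= a i z) -> (forall j z, 0 <= b j z) ->
  (forall i, \sum_z a i z = n%:R^-1) -> (forall j, \sum_z b j z = alpha j) ->
  (forall i z, 0 <= u i z) -> (forall j z, 0 <= v j z) ->
  (forall i j z, c i j <= u i z + v j z) -> (forall i j, c i j <= M) -> 0 <= M ->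
  exists2 H : 'M[R]_(n, p), is_coupling alpha H &
    \sum_i \sum_j H i j * c i j <=
      \sum_i \sum_z a i z * u i z + \sum_j \sum_z b j z * v j z +
      M * \sum_z `|\sum_i a i z - \sum_j b j z|.
Proof.
move=> n0 alpha1 a0 b0 sa sb u0 v0 cuv cM M0.
pose A z := \sum_i a i z; pose B z := \sum_j b j z.
have A0 z : 0 <= A z by apply: sumr_ge0.
have B0 z : 0 <= B z by apply: sumr_ge0.
(* Where both masses vanish the convention 0^-1 = 0 makes [W z] zero, which is harmless since
   nothing is transported there. *)
pose W z := (Num.max (A z) (B z))^-1.
have W0 z : 0 <= W z by rewrite invr_ge0 le_max A0.
have AW z : A z * W z <= 1.
  have [m0|m0] := eqVneq (Num.max (A z) (B z)) 0; first by rewrite /W m0 invr0 mulr0.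
  by rewrite ler_pdivrMr ?mul1r ?le_max ?lexx // lt_def m0 le_max A0.
have BW z : B z * W z <= 1.
  have [m0|m0] := eqVneq (Num.max (A z) (B z)) 0; first by rewrite /W m0 invr0 mulr0.
  by rewrite ler_pdivrMr ?mul1r ?le_max ?lexx ?orbT // lt_def m0 le_max A0.
pose r i := \sum_z a i z * (1 - B z * W z).
pose s j := \sum_z b j z * (1 - A z * W z).
have r0 i : 0 <= r i by apply: sumr_ge0 => z _; rewrite mulr_ge0 // subr_ge0.
have s0 j : 0 <= s j by apply: sumr_ge0 => z _; rewrite mulr_ge0 // subr_ge0.
pose H0 i j := \sum_z a i z * b j z * W z.
have H0r i : \sum_j H0 i j = n%:R^-1 - r i.
  rewrite -(sa i) -sumrN -big_split /= exchange_big /=; apply: eq_bigr => z _.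
  by rewrite -mulr_suml -mulr_sumr /=; rewrite -/(B z); ring.
have H0c j : \sum_i H0 i j = alpha j - s j.
  rewrite -(sb j) -sumrN -big_split /= exchange_big /=; apply: eq_bigr => z _.
  by rewrite -mulr_suml -mulr_suml /=; rewrite -/(A z); ring.
have nn : \sum_(i < n) n%:R^-1 = 1 :> R.
  by rewrite sumr_const card_ord -[n%:R^-1]mulr1 -mulrnAr mulVf // pnatr_eq0 -lt0n.
pose rho := \sum_i r i.
have rhoE : \sum_j s j = rho.
  have : \sum_i \sum_j H0 i j = \sum_j \sum_i H0 i j by rewrite exchange_big.
  rewrite (eq_bigr _ (fun i _ => H0r i)) [RHS](eq_bigr _ (fun i _ => H0c i)) !big_split /= !sumrN.
  by rewrite nn alpha1; rewrite -/rho; lra.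
have rho0 : 0 <= rho by apply: sumr_ge0.
(* If the residual mass [rho] is zero, all residuals are zero and the product coupling
   [r i * s j / rho] is zero as well. *)
have rrho i : r i * rho / rho = r i.
  have [z0|z0] := eqVneq rho 0; last by rewrite mulfK.
  rewrite z0 mulr0 mul0r; apply/esym/eqP; rewrite eq_le r0 andbT.
  by rewrite -z0 /rho (bigD1 i) //= lerDl sumr_ge0.
have srho j : s j * rho / rho = s j.
  have [z0|z0] := eqVneq rho 0; last by rewrite mulfK.
  rewrite z0 mulr0 mul0r; apply/esym/eqP; rewrite eq_le s0 andbT.
  by rewrite -z0 -rhoE (bigD1 j) //= lerDl sumr_ge0.
(* The residual mass is the sum of the positive parts of [A z - B z]. *)
have rholt : rho <= \sum_z `|A z - B z|.
  rewrite /rho /r exchange_big /=; apply: ler_sum => z _; rewrite -mulr_suml -/(A z) /W.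
  have [AB|BA] := leP (A z) (B z).
    have [->|Bz] := eqVneq (B z) 0; last by rewrite mulfV // subrr mulr0.
    by rewrite mul0r subr0 mulr1 subr0 ger0_norm.
  rewrite mulrBr mulr1 mulrCA mulfV ?mulr1; last by rewrite gt_eqF // (le_lt_trans _ BA).
  exact: ler_norm.
exists (\matrix_(i, j) (H0 i j + r i * s j / rho)).
  split; [|split].
  - move=> i j; rewrite mxE addr_ge0 //.
      by apply: sumr_ge0 => z _; rewrite !mulr_ge0.
    by rewrite divr_ge0 // mulr_ge0.
  - move=> j; under eq_bigr do rewrite mxE.
    rewrite big_split /= H0c -mulr_suml -mulr_suml -/rho (mulrC rho) srho.
    by rewrite subrK.
  - move=> i; under eq_bigr do rewrite mxE.
    rewrite big_split /= H0r -mulr_suml -mulr_sumr rhoE rrho.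
    by rewrite subrK.
have -> : \sum_i \sum_j (\matrix_(i, j) (H0 i j + r i * s j / rho)) i j * c i j =
    \sum_i \sum_j H0 i j * c i j + \sum_i \sum_j r i * s j / rho * c i j.
  rewrite -big_split /=; apply: eq_bigr => i _; rewrite -big_split /=.
  by apply: eq_bigr => j _; rewrite mxE mulrDl.
apply: lerD.
  apply: (@le_trans _ _ (\sum_i \sum_j \sum_z (a i z * b j z * W z * u i z + a i z * b j z * W z * v j z))).
    apply: ler_sum => i _; apply: ler_sum => j _; rewrite mulr_suml; apply: ler_sum => z _.
    by rewrite -mulrDr ler_wpM2l // !mulr_ge0.
  have -> : \sum_i \sum_j \sum_z (a i z * b j z * W z * u i z + a i z * b j z * W z * v j z) =
      \sum_i \sum_j \sum_z a i z * b j z * W z * u i z +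
      \sum_i \sum_j \sum_z a i z * b j z * W z * v j z.
    rewrite -big_split /=; apply: eq_bigr => i _; rewrite -big_split /=.
    by apply: eq_bigr => j _; rewrite -big_split.
  apply: lerD.
    apply: ler_sum => i _; rewrite exchange_big /=; apply: ler_sum => z _.
    rewrite -!mulr_suml -mulr_sumr -/(B z) ler_wpM2r // -mulrA -[leRHS]mulr1.
    by rewrite ler_wpM2l.
  rewrite exchange_big /=; apply: ler_sum => j _; rewrite exchange_big /=; apply: ler_sum => z _.
  rewrite -!mulr_suml -/(A z) ler_wpM2r // [A z * _]mulrC -mulrA -[leRHS]mulr1.
  by rewrite ler_wpM2l.
apply: (@le_trans _ _ (\sum_i \sum_j r i * s j / rho * M)).
  apply: ler_sum => i _; apply: ler_sum => j _.
  by rewrite ler_wpM2l // divr_ge0 // mulr_ge0.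
under eq_bigr do rewrite -mulr_suml -mulr_suml -mulr_sumr rhoE rrho.
by rewrite -mulr_suml -/rho mulrC ler_wpM2l.
Qed.

(** * Trigonometric kernels *)

Section trigonometry.
Variable R : realType.
Implicit Types a b u v x y : R.

Lemma sin_le_id x : 0 <= x -> sin x <= x.
Proof.
rewrite le_eqVlt => /predU1P[<-|x0]; first by rewrite sin0.
have [c _] := MVT x0 (fun y _ => is_derive_sin y)
  (continuous_subspaceT (@continuous_sin R)).
rewrite sin0 !subr0 => ->; rewrite -[leRHS]mul1r ler_wpM2r ?cos_le1 //.
exact: ltW.
Qed.

Lemma norm_sin_le x : `|sin x| <= `|x|.
Proof.
wlog x0 : x / 0 <= x.
  move=> H; have [/H//|/ltW x0] := leP 0 x.
  by rewrite -normrN -sinN -(normrN x); apply: H; rewrite oppr_ge0.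
rewrite (ger0_norm x0) ler_norml sin_le_id // andbT.
have [x1|x1] := leP x pi.
  by rewrite (@le_trans _ _ 0) ?oppr_le0 // sin_ge0_pi // x0.
by rewrite (@le_trans _ _ (-1)) ?sin_geN1 // lerN2 (le_trans _ (ltW x1)) // (le_trans _ (pi_ge2 _)) // ler1n.
Qed.

Lemma sub1cosE x : 1 - cos x = 2 * sin (x / 2) ^+ 2.
Proof.
have {1}-> : x = (x / 2) *+ 2 by rewrite -mulr_natr divfK.
by rewrite cos_mulr2n cos2sin2; ring.
Qed.

Lemma sub1cos_le x : 1 - cos x <= x ^+ 2 / 2.
Proof.
rewrite sub1cosE -[sin _ ^+ 2]real_normK ?num_real //.
have : `|sin (x / 2)| ^+ 2 <= `|x / 2| ^+ 2 by rewrite lerXn2r ?nnegrE ?norm_sin_le.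
by rewrite [`|x / 2| ^+ 2]real_normK ?num_real // exprMn; lra.
Qed.

(** By the mean value theorem sin(x/2) is x/2 times a cosine taken in (0, 1/2), which exceeds cos 1.
    With it, 1 - cos controls the squared distance for arguments in [-1, 1]. *)
Lemma sub1cos_ge x : `|x| <= 1 -> cos 1 ^+ 2 / 2 * x ^+ 2 <= 1 - cos x.
Proof.
wlog x0 : x / 0 <= x.
  move=> H; have [/H//|/ltW x0] := leP 0 x.
  by rewrite -normrN => /H; rewrite sqrrN cosN; apply; rewrite oppr_ge0.
rewrite (ger0_norm x0) => x1; rewrite sub1cosE.
suff : x / 2 * cos 1 <= sin (x / 2).
  move=> H; have : (x / 2 * cos 1) ^+ 2 <= sin (x / 2) ^+ 2.
    rewrite lerXn2r // nnegrE ?mulr_ge0 ?divr_ge0 //; first exact/ltW/cos1_gt0.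
    by apply: le_trans H; rewrite mulr_ge0 ?divr_ge0 //; exact/ltW/cos1_gt0.
  by rewrite !exprMn; lra.
move: x0; rewrite le_eqVlt => /predU1P[<-|x0]; first by rewrite !mul0r sin0.
have h0 : 0 < x / 2 by rewrite divr_gt0.
have [c] := MVT h0 (fun y _ => is_derive_sin y)
  (continuous_subspaceT (@continuous_sin R)).
rewrite in_itv /= => /andP[c0 cx]; rewrite sin0 !subr0 => ->.
rewrite mulrC ler_wpM2r ?(ltW h0) // ltW // ltr_cos ?in_itv /=.
- by lra.
- have := @pi_ge2 R; lra.
- have := @pi_ge2 R; lra.
Qed.

(** 1 - cos(a - b) is half the squared chord between two points of the circle, so this is the
    periodic form of (a - b)^2 <= 2 a^2 + 2 b^2. It lets a transport cost be split at an
    intermediate lattice point. *)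
Lemma sub1cosB_le a b : 1 - cos (a - b) <= 2 * (1 - cos a) + 2 * (1 - cos b).
Proof.
rewrite !sub1cosE mulrBl sinB.
set s := sin (a / 2); set t := sin (b / 2).
have s1 : s ^+ 2 * cos (b / 2) ^+ 2 <= s ^+ 2.
  by rewrite ler_piMr ?sqr_ge0 // cos2sin2 lerBlDr lerDl sqr_ge0.
have t1 : cos (a / 2) ^+ 2 * t ^+ 2 <= t ^+ 2.
  by rewrite ler_piMl ?sqr_ge0 // cos2sin2 lerBlDr lerDl sqr_ge0.
have := sqr_ge0 (s * cos (b / 2) + cos (a / 2) * t).
by rewrite sqrrD sqrrB !exprMn; lra.
Qed.

Lemma cos_lipschitz a b : `|cos a - cos b| <= `|a - b|.
Proof.
have -> : cos a - cos b = - (2 * (sin ((a + b) / 2) * sin ((a - b) / 2))).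
  have pq p q : cos (p + q) - cos (p - q) = - (2 * (sin p * sin q)).
    by rewrite cosD cosB; ring.
  by rewrite -pq; congr (cos _ - cos _); field.
rewrite normrN normrM (ger0_norm (ler0n _ 2)) normrM.
have := norm_sin_le ((a - b) / 2); rewrite normrM normfV (ger0_norm (ler0n _ 2)).
have : `|sin ((a + b) / 2)| * `|sin ((a - b) / 2)| <= `|sin ((a - b) / 2)|.
  by rewrite ler_piMl // sin_max.
lra.
Qed.

(** Multiplied by 2 sin(b/2), with [b] the step of the argument, the sum telescopes, and the
    argument advances by [h] full periods in total. The condition 0 < h < N keeps sin(b/2)
    nonzero. *)
Lemma sum_cos_lattice (N h : nat) a : (0 < h < N)%N ->
  \sum_(j < N) cos (a + h%:R * (2 * pi * j%:R / N%:R)) = 0.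
Proof.
move=> /andP[h0 hN].
have N0 : (0 < N)%N := leq_ltn_trans (leq0n _) hN.
have Nn0 : N%:R != 0 :> R by rewrite pnatr_eq0 -lt0n.
pose b : R := h%:R * (2 * pi / N%:R).
have sb : 0 < sin (b / 2).
  apply: sin_gt0_pi; have -> : b / 2 = pi * (h%:R / N%:R) by rewrite /b; field.
  rewrite mulr_gt0 ?pi_gt0 ?divr_gt0 ?ltr0n //=.
  by rewrite -[ltRHS]mulr1 ltr_pM2l ?pi_gt0 // ltr_pdivrMr ?ltr0n // mul1r ltr_nat.
have bj j : h%:R * (2 * pi * j%:R / N%:R) = b * j%:R by rewrite /b; field.
pose F j := sin (a + b * j%:R - b / 2).
have s2 : 2 * sin (b / 2) != 0 by rewrite gt_eqF // mulr_gt0.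
apply: (mulfI s2); rewrite mulr0 mulr_sumr.
rewrite (eq_bigr (fun j : 'I_N => F j.+1 - F j)) => [|j _]; last first.
  rewrite bj /F -[j.+1]addn1 natrD mulrDr mulr1.
  have -> : a + (b * j%:R + b) - b / 2 = (a + b * j%:R) + b / 2 by field.
  by rewrite sinD sinB; ring.
rewrite -(big_mkord xpredT (fun j => F j.+1 - F j)) telescope_sumr // /F.
have -> : a + b * N%:R - b / 2 = (a - b / 2) + (pi *+ 2) *+ h.
  by rewrite -(mulr_natr (_ *+ 2)) -(mulr_natr pi 2) /b; field.
by rewrite (periodicn (@sinD2pi R)) mulr0 addr0 subrr.
Qed.

Lemma sum_cos_diff_lattice (N k l : nat) u : (k < N)%N -> (l < N)%N ->
  \sum_(j < N) cos ((k%:R - l%:R) * (u - 2 * pi * j%:R / N%:R)) =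
  N%:R * (k == l)%:R.
Proof.
wlog kl : k l / (l <= k)%N.
  move=> H kN lN; have [/H->//|/ltnW lk] := leqP l k.
  rewrite eq_sym -H //; apply: eq_bigr => j _; rewrite -cosN; congr cos; ring.
move=> kN lN; have [->|nkl] := eqVneq k l.
  under eq_bigr do rewrite subrr mul0r cos0.
  by rewrite sumr_const card_ord mulr1.
rewrite mulr0 -[RHS](@sum_cos_lattice N (k - l) (- ((k - l)%:R * u))).
  by apply: eq_bigr => j _; rewrite -cosN -natrB //; congr cos; ring.
by rewrite subn_gt0 ltn_neqAle eq_sym nkl kl /= (leq_ltn_trans (leq_subr _ _)).
Qed.

End trigonometry.

Section kernel.
Variables (R : realType) (M : nat).
Hypothesis M2 : (1 < M)%N.

(* The weights [c] form the top eigenvector, with eigenvalue [2 cos (pi / M)],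
   of the path on [1, ..., M-1]: they minimise the second moment of a
   nonnegative trigonometric kernel of given degree (Fejer, Korovkin). *)
Definition fejer_weight (k : nat) : R := sin (pi * k%:R / M%:R).
Local Notation c := fejer_weight.

Definition fejer_mass : R := \sum_(k < M) c k ^+ 2.

(* For [rho = 0] this is [|\sum_k c_k exp(i k v)|^2] normalised; for [rho > 0]
   the frequencies are amplified so that Gaussian convolution undoes it. *)
Definition trigker (rho v : R) : R := fejer_mass^-1 *
  \sum_(k < M) \sum_(l < M)
    c k * c l * expR (rho * (k%:R - l%:R) ^+ 2 / 2) * cos ((k%:R - l%:R) * v).

Let M0 : (0 < M)%N. Proof. exact: leq_trans M2. Qed.
Let Mn0 : M%:R != 0 :> R. Proof. by rewrite pnatr_eq0 -lt0n. Qed.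

Lemma fejer_mass_gt0 : 0 < fejer_mass.
Proof.
rewrite /fejer_mass (bigD1 (Ordinal M2)) //= ltr_wpDr //.
  by apply: sumr_ge0 => k _; exact: sqr_ge0.
rewrite exprn_gt0 // sin_gt0_pi // mulr1 divr_gt0 ?pi_gt0 ?ltr0n //=.
rewrite ltr_pdivrMr ?ltr0n // -[ltLHS]mulr1 ltr_pM2l ?pi_gt0 //.
by rewrite ltr1n.
Qed.

Lemma sum_fejer_abs :
  \sum_(k < M) \sum_(l < M) `|c k * c l| <= M%:R * fejer_mass.
Proof.
have le2 (x y : R) : `|x * y| <= x ^+ 2 / 2 + y ^+ 2 / 2.
  have := sqr_ge0 (`|x| - `|y|).
  by rewrite sqrrB !real_normK ?num_real // normrM -mulr_natr; lra.
apply: (@le_trans _ _ (\sum_(k < M) \sum_(l < M) (c k ^+ 2 / 2 + c l ^+ 2 / 2))).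
  by apply: ler_sum => k _; apply: ler_sum => l _.
have -> : \sum_(k < M) \sum_(l < M) (c k ^+ 2 / 2 + c l ^+ 2 / 2) =
    \sum_(k < M) (M%:R / 2 * c k ^+ 2 + fejer_mass / 2).
  apply: eq_bigr => k _; rewrite big_split /= sumr_const card_ord -mulr_suml.
  by rewrite -(mulr_natr (_ / 2)) -/fejer_mass; congr (_ + _); field.
rewrite big_split /= sumr_const card_ord -mulr_sumr -/fejer_mass -(mulr_natr (_ / 2)).
by rewrite le_eqVlt; apply/orP; left; apply/eqP; field.
Qed.

Lemma freq_le k l : (k < M)%N -> (l < M)%N -> `|k%:R - l%:R| <= M%:R :> R.
Proof.
move=> kM lM; have k0 : 0 <= k%:R :> R by []. have l0 : 0 <= l%:R :> R by [].
have kM' : k%:R <= M%:R :> R by rewrite ler_nat ltnW.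
have lM' : l%:R <= M%:R :> R by rewrite ler_nat ltnW.
by rewrite ler_norml; lra.
Qed.

Lemma trigker_coef_le (rho : R) k l : 0 <= rho -> (k < M)%N -> (l < M)%N ->
  expR (rho * (k%:R - l%:R) ^+ 2 / 2) <= expR (rho * M%:R ^+ 2 / 2).
Proof.
move=> rho0 kM lM; rewrite ler_expR ler_pM2r ?invr_gt0 // ler_wpM2l //.
rewrite -[(_ - _) ^+ 2]real_normK ?num_real // lerXn2r ?nnegrE //.
exact: freq_le.
Qed.

(** The oscillating factor is an arbitrary [F] so that one estimate yields both the sup bound and
    the Lipschitz bound. *)
Lemma norm_trigker_sum_le rho (F : nat -> nat -> R) (C : R) : 0 <= rho ->
  (forall k l, (k < M)%N -> (l < M)%N -> `|F k l| <= C) ->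
  `|fejer_mass^-1 * \sum_(k < M) \sum_(l < M)
    c k * c l * expR (rho * (k%:R - l%:R) ^+ 2 / 2) * F k l| <=
  M%:R * expR (rho * M%:R ^+ 2 / 2) * C.
Proof.
move=> rho0 FC.
have C0 : 0 <= C by apply: le_trans (FC _ _ M0 M0).
have S0 := fejer_mass_gt0.
rewrite normrM (gtr0_norm (x := _^-1)) ?invr_gt0 // ler_pdivrMl ?fejer_mass_gt0 //.
apply: (@le_trans _ _ (\sum_(k < M) \sum_(l < M) `|c k * c l| * (expR (rho * M%:R ^+ 2 / 2) * C))).
  apply: (le_trans (ler_norm_sum _ _ _)); apply: ler_sum => k _.
  apply: (le_trans (ler_norm_sum _ _ _)); apply: ler_sum => l _.
  rewrite normrM normrM -mulrA ler_wpM2l // ger0_norm ?expR_ge0 // ler_pM ?expR_ge0 //.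
    exact: trigker_coef_le.
  exact: FC.
under eq_bigr do rewrite -mulr_suml.
have -> : fejer_mass * (M%:R * expR (rho * M%:R ^+ 2 / 2) * C) =
   (M%:R * fejer_mass) * (expR (rho * M%:R ^+ 2 / 2) * C) by ring.
rewrite -mulr_suml.
by rewrite ler_wpM2r ?mulr_ge0 ?expR_ge0 // sum_fejer_abs.
Qed.

Lemma norm_trigker_le rho v : 0 <= rho ->
  `|trigker rho v| <= M%:R * expR (rho * M%:R ^+ 2 / 2).
Proof.
move=> rho0; rewrite -[leRHS]mulr1.
by apply: (norm_trigker_sum_le (F := fun k l => cos ((k%:R - l%:R) * v))) => // k l _ _; exact: cos_max.
Qed.

Lemma trigker_lipschitz rho v w : 0 <= rho ->
  `|trigker rho v - trigker rho w| <=
  M%:R * expR (rho * M%:R ^+ 2 / 2) * (M%:R * `|v - w|).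
Proof.
move=> rho0; rewrite /trigker -mulrBr -sumrB.
under eq_bigr do rewrite -sumrB.
under eq_bigr do under eq_bigr do rewrite -mulrBr.
apply: (norm_trigker_sum_le (F := fun k l => cos ((k%:R - l%:R) * v) - cos ((k%:R - l%:R) * w))) => // k l kM lM.
apply: (le_trans (cos_lipschitz _ _)); rewrite -mulrBr normrM ler_wpM2r //.
exact: freq_le.
Qed.

Lemma trigker0E v : trigker 0 v = fejer_mass^-1 *
  \sum_(k < M) \sum_(l < M) c k * c l * cos ((k%:R - l%:R) * v).
Proof.
congr (_ * _); apply: eq_bigr => k _; apply: eq_bigr => l _.
by rewrite !mul0r expR0 mulr1.
Qed.

Lemma trigker0_ge0 v : 0 <= trigker 0 v.
Proof.
rewrite trigker0E mulr_ge0 ?invr_ge0 ?(ltW fejer_mass_gt0) //.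
rewrite (_ : \sum_(k < M) _ = (\sum_(k < M) c k * cos (k%:R * v)) ^+ 2 +
   (\sum_(k < M) c k * sin (k%:R * v)) ^+ 2); first by rewrite addr_ge0 ?sqr_ge0.
rewrite !expr2 !mulr_suml -big_split /=; apply: eq_bigr => k _.
rewrite !mulr_sumr -big_split /=; apply: eq_bigr => l _.
by rewrite mulrBl cosB; ring.
Qed.

Local Notation z j := (2 * pi * j%:R / M.+1%:R).

(** Discrete orthogonality leaves the diagonal terms only. The lattice has [M.+1] points so that
    index [M], reached after the shift by a cosine in [sum_trigker0_cos], is still free of
    aliasing. *)
Lemma sum_trigker0 u : \sum_(j < M.+1) trigker 0 (u - z j) = M.+1%:R.
Proof.
under eq_bigr do rewrite trigker0E.
rewrite -mulr_sumr exchange_big /=.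
rewrite (eq_bigr (fun k : 'I_M => M.+1%:R * c k ^+ 2)) => [|k _].
  by rewrite -mulr_sumr -/fejer_mass mulrCA mulVf ?mulr1 // gt_eqF // fejer_mass_gt0.
rewrite exchange_big (bigD1 k) //= [X in _ + X]big1 ?addr0 => [|l lk].
  rewrite -mulr_sumr (sum_cos_diff_lattice _ (leqW (ltn_ord k)) (leqW (ltn_ord k))) eqxx.
  by rewrite mulr1 mulrC -expr2.
rewrite -mulr_sumr (sum_cos_diff_lattice _ (leqW (ltn_ord k)) (leqW (ltn_ord l))).
by rewrite eq_sym (negbTE (lk : (l != k :> nat))) !mulr0.
Qed.

Lemma fejer_weightM : c M = 0.
Proof. by rewrite /c mulfK // sinpi. Qed.

(** By the addition formula, [c k * c k.+1] is cos(pi/M) times [c k ^+ 2] plus a multiple of sin(2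
    pi k/M). The latter sums to zero over a full period; it is written as a shifted cosine to apply
    [sum_cos_lattice]. *)
Lemma sum_fejer_shift : \sum_(k < M) c k * c k.+1 = cos (pi / M%:R) * fejer_mass.
Proof.
have E k : c k * c k.+1 = cos (pi / M%:R) * c k ^+ 2 +
    sin (pi / M%:R) / 2 * cos (- (pi / 2) + 1%:R * (2 * pi * k%:R / M%:R)).
  rewrite [1%:R * _]mul1r [- (pi / 2) + _]addrC cosBpihalf.
  have -> : 2 * pi * k%:R / M%:R = (pi * k%:R / M%:R) *+ 2 :> R by rewrite mulr2n; field.
  have -> : c k.+1 = c k * cos (pi / M%:R) + cos (pi * k%:R / M%:R) * sin (pi / M%:R).
    by rewrite /c -sinD -[k.+1]addn1 natrD; congr sin; field.
  by rewrite sin_mulr2n -/(c k) mulr2n; field.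
rewrite (eq_bigr _ (fun (k : 'I_M) _ => E k)) big_split /= -!mulr_sumr.
by rewrite sum_cos_lattice // mulr0 addr0.
Qed.

(** Multiplication by a cosine shifts one index by one, so orthogonality selects neighbouring pairs,
    and these sum to cos(pi/M) times the mass. The kernel thus has periodic second moment of order
    1/M^2, not 1/M. *)
Lemma sum_trigker0_cos u :
  \sum_(j < M.+1) trigker 0 (u - z j) * (1 - cos (u - z j)) =
  M.+1%:R * (1 - cos (pi / M%:R)).
Proof.
under eq_bigr do rewrite mulrBr mulr1.
rewrite sumrB sum_trigker0 mulrBr mulr1; congr (_ - _).
have E v : trigker 0 v * cos v = fejer_mass^-1 * \sum_(k < M) \sum_(l < M) c k * c l / 2 *
   (cos ((k.+1%:R - l%:R) * v) + cos ((k%:R - l.+1%:R) * v)).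
  rewrite trigker0E -mulrA mulr_suml; congr (_ * _); apply: eq_bigr => k _.
  rewrite mulr_suml; apply: eq_bigr => l _.
  have -> : (k.+1%:R - l%:R) * v = (k%:R - l%:R) * v + v.
    by rewrite -[k.+1]addn1 natrD; ring.
  have -> : (k%:R - l.+1%:R) * v = (k%:R - l%:R) * v - v.
    by rewrite -[l.+1]addn1 natrD; ring.
  by rewrite cosD cosB; field.
under eq_bigr do rewrite E.
rewrite -mulr_sumr exchange_big /=.
rewrite (eq_bigr (fun k : 'I_M => M.+1%:R * (\sum_(l < M) c k * c l / 2 * ((k.+1 == l)%:R + (k == l.+1 :> nat)%:R)))); last first.
  move=> k _; rewrite exchange_big mulr_sumr; apply: eq_bigr => l _.
  rewrite -mulr_sumr big_split /=.
  rewrite (sum_cos_diff_lattice _ (ltn_ord k : (k.+1 < M.+1)%N) (leqW (ltn_ord l))).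
  rewrite (sum_cos_diff_lattice _ (leqW (ltn_ord k)) (ltn_ord l : (l.+1 < M.+1)%N)).
  by rewrite -mulrDr mulrCA.
rewrite -mulr_sumr.
have shift k : (k < M)%N -> \sum_(l < M) c k * c l / 2 * (k.+1 == l)%:R = c k * c k.+1 / 2.
  move=> kM; have [k1M|] := ltnP k.+1 M.
    rewrite (bigD1 (Ordinal k1M)) //= eqxx mulr1 [X in _ + X]big1 ?addr0 // => l.
    by rewrite -val_eqE eq_sym /= => /negbTE->; rewrite mulr0.
  (* The shift leaves the index range only at k + 1 = M, where the weight vanishes. *)
  move=> Mk; have -> : k.+1 = M by apply/eqP; rewrite eqn_leq kM Mk.
  rewrite fejer_weightM mulr0 mul0r big1 // => l _.
  by rewrite gtn_eqF ?mulr0.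
rewrite (_ : \sum_(k < M) _ = \sum_(k < M) c k * c k.+1).
  by rewrite sum_fejer_shift mulrCA [_^-1 * _]mulrCA mulVf ?mulr1 // gt_eqF // fejer_mass_gt0.
transitivity (\sum_(k < M) c k * c k.+1 / 2 + \sum_(k < M) c k * c k.+1 / 2); last first.
  by rewrite -big_split /=; apply: eq_bigr => k _; field.
under eq_bigr do under eq_bigr do rewrite mulrDr.
under eq_bigr do rewrite big_split /=.
rewrite big_split /=; congr (_ + _).
  by apply: eq_bigr => k _; exact: shift.
rewrite exchange_big /=; apply: eq_bigr => k _; rewrite -shift //.
by apply: eq_bigr => l _; rewrite eq_sym (mulrC (c l)).
Qed.

End kernel.

(** * Gaussian integrals and cells *)

Section integral_of_derivative.
Variable R : realType.
Local Notation mu := (@lebesgue_measure R).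

(** Fundamental theorem of calculus on the intervals [-(n+1), n+1], then dominated convergence with
    |h'| as dominating function. *)
Lemma integral_derive_eq0 (h h' : R -> R) :
  (forall x : R, is_derive x 1 h (h' x)) -> continuous h' ->
  mu.-integrable setT (EFin \o h') ->
  h n.+1%:R - h (- n.+1%:R) @[n --> \oo] --> 0 ->
  \int[mu]_x h' x = 0.
Proof.
move=> dh ch ih h0.
pose D (n : nat) : set R := [set` `[(- n.+1%:R), n.+1%:R]].
pose f_ (n : nat) : R -> \bar R := (EFin \o h') \_ (D n).
have mh : measurable_fun setT h' by exact: continuous_measurable_fun.
have : (\int[mu]_x f_ n x)%E @[n --> \oo] --> (\int[mu]_x (h' x)%:E)%E.
  apply: (@dominated_cvg _ _ _ mu setT measurableT f_ _ (fun x => `|h' x|%:E)) => //.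
  - move=> n; have mD : measurable (D n) by rewrite /D; exact: measurable_itv.
    apply: (measurable_restrictT (EFin \o h') mD).1.
    by apply/measurable_EFinP; exact: measurable_funTS.
  - move=> x _; apply: cvg_near_cst.
    near=> n; rewrite /f_ patchE mem_set // /D /= in_itv /=.
    rewrite -ler_norml; near: n.
    exists (Num.truncn `|x|) => // n /= xn.
    by rewrite ltW // (lt_le_trans (truncnS_gt _)) // ler_nat ltnS.
  - exact: (integrable_abse ih).
  - move=> n x _; rewrite /f_ patchE; case: ifP => _ /=; first exact: lexx.
    by rewrite lee_fin normr0.
have E n : (\int[mu]_x f_ n x)%E = (h n.+1%:R - h (- n.+1%:R))%:E.
  rewrite /f_ -integral_mkcond (@continuous_FTC2 _ h' h) ?EFinB //.
  - by rewrite gtrN.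
  - exact: continuous_subspaceT.
  - have ch0 x : {for x, continuous h}.
      by apply: differentiable_continuous; apply/derivable1_diffP; case: (dh x).
    split; first by move=> x _; case: (dh x).
    + by apply: cvg_at_right_filter; exact: ch0.
    + by apply: cvg_at_left_filter; exact: ch0.
  - by move=> x _; rewrite derive1E; apply: derive_val.
under eq_fun do rewrite E.
move=> Hc; rewrite /Rintegral.
suff -> : (\int[mu]_x (h' x)%:E)%E = 0%E by [].
apply: (cvg_unique _ Hc); first exact: ereal_hausdorff.
by apply: cvg_EFin; [exact: nearW | exact: h0].
Unshelve. all: by end_near. Qed.

End integral_of_derivative.

Section gaussian.
Variables (R : realType) (sigma : R).
Hypothesis sigma0 : 0 < sigma.
Local Notation mu := (@lebesgue_measure R).
Local Notation g := (normal_pdf 0 sigma).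

Let sigman0 : sigma != 0. Proof. by rewrite gt_eqF. Qed.
Let sqr2 (s : R) : s ^+ 2 *+ 2 = 2 * s ^+ 2. Proof. by rewrite mulr_natl. Qed.

Lemma normal_pdf0E x : g x = normal_peak sigma * expR (- x ^+ 2 / (sigma ^+ 2 *+ 2)).
Proof. by rewrite normal_pdfE // /normal_fun subr0. Qed.

Lemma is_derive_normal_pdf (x : R) : is_derive x 1 g (- x / sigma ^+ 2 * g x).
Proof.
rewrite (_ : normal_pdf 0 sigma = (fun x => normal_peak sigma * expR (- x ^+ 2 / (sigma ^+ 2 *+ 2)))); last first.
  by apply/funext => y; exact: normal_pdf0E.
apply: is_derive_eq; rewrite /= /GRing.scale /=.
by rewrite !sqr2; field.
Qed.

Lemma continuous_normal_pdf0 : continuous (g : R -> R).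
Proof. exact: continuous_normal_pdf. Qed.

(** Comparison with the density of twice the scale, using 1/2 - 1/8 = 3/8. The spare exponential
    factor yields integrability of |x| [g] and the Gaussian tails, the wider density having integral
    one. *)
Lemma normal_pdf_wider x :
  g x = 2 * expR (- (3 * x ^+ 2 / (8 * sigma ^+ 2))) * normal_pdf 0 (2 * sigma) x.
Proof.
rewrite normal_pdf0E normal_pdfE ?mulf_neq0 // /normal_fun subr0 mulrCA.
have -> : normal_peak (2 * sigma) = normal_peak sigma / 2.
  rewrite /normal_peak exprMn -mulrA -mulrnAr sqrtrM ?exprn_ge0 // sqrtr_sqr.
  by rewrite (ger0_norm (ler0n _ 2)) invfM mulrC.
have -> : - x ^+ 2 / (sigma ^+ 2 *+ 2) = - (3 * x ^+ 2 / (8 * sigma ^+ 2)) +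
    - x ^+ 2 / ((2 * sigma) ^+ 2 *+ 2).
  by rewrite !sqr2; field.
by rewrite expRD; field.
Qed.

Lemma integrable_mul_normal_pdf (f : R -> R) (C : R) :
  measurable_fun setT f -> (forall x, `|f x| <= C) ->
  mu.-integrable setT (EFin \o (fun x => f x * g x)).
Proof.
move=> mf fC; have C0 : 0 <= C by apply: le_trans (fC 0).
apply: (@le_integrable _ _ _ mu setT measurableT _ (EFin \o (fun x => C * g x))).
- by apply/measurable_EFinP; apply: measurable_funM => //; exact: measurable_normal_pdf.
- move=> x _ /=; rewrite lee_fin !normrM ler_wpM2r // (ger0_norm C0).
  exact: fC.
- rewrite (_ : EFin \o _ = (fun x => C%:E * (g x)%:E)%E); last by apply/funext.
  by apply: integrableZl => //; exact: integrable_normal_pdf.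
Qed.

Lemma norm_mul_normal_pdf_le x :
  `|x| * g x <= 4 * sigma * normal_pdf 0 (2 * sigma) x.
Proof.
set e := 3 * x ^+ 2 / (8 * sigma ^+ 2).
suff H : `|x| * expR (- e) <= 2 * sigma.
  rewrite normal_pdf_wider -/e.
  have -> : `|x| * (2 * expR (- e) * normal_pdf 0 (2 * sigma) x) =
    (`|x| * expR (- e)) * (2 * normal_pdf 0 (2 * sigma) x) by ring.
  have -> : 4 * sigma * normal_pdf 0 (2 * sigma) x =
    2 * sigma * (2 * normal_pdf 0 (2 * sigma) x) by ring.
  by rewrite ler_wpM2r // mulr_ge0 ?normal_pdf_ge0.
rewrite expRN ler_pdivrMr ?expR_gt0 //.
have s2 : 0 < sigma ^+ 2 by rewrite exprn_gt0.
apply: (@le_trans _ _ (2 * sigma * (1 + e))); last first.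
  by rewrite ler_wpM2l ?expR_ge1Dx // mulr_ge0 // ltW.
rewrite /e; have -> : 2 * sigma * (1 + 3 * x ^+ 2 / (8 * sigma ^+ 2)) = (2 * sigma ^+ 2 + 3 / 4 * x ^+ 2) / sigma.
  by field.
rewrite ler_pdivlMr // -[x ^+ 2]real_normK ?num_real //.
have := sqr_ge0 (`|x| - sigma); have := sqr_ge0 (`|x|); rewrite sqrrB; nra.
Qed.

Lemma integrable_norm_normal_pdf : mu.-integrable setT (EFin \o (fun x => `|x| * g x)).
Proof.
apply: (@le_integrable _ _ _ mu setT measurableT _ (EFin \o (fun x => 4 * sigma * normal_pdf 0 (2 * sigma) x))).
- by apply/measurable_EFinP; apply: measurable_funM => //; exact: measurable_normal_pdf.
- move=> x _ /=; rewrite lee_fin ger0_norm ?mulr_ge0 ?normal_pdf_ge0 //.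
  by rewrite (le_trans (norm_mul_normal_pdf_le x)) // ler_norm.
- rewrite (_ : EFin \o _ = (fun x => (4 * sigma)%:E * (normal_pdf 0 (2 * sigma) x)%:E)%E); last by apply/funext.
  by apply: integrableZl => //; exact: integrable_normal_pdf.
Qed.

Lemma normal_pdf_nat_cvg0 (f : R -> R) : (forall x, `|f x| <= 1) ->
  f n.+1%:R * g n.+1%:R - f (- n.+1%:R) * g (- n.+1%:R) @[n --> \oo] --> 0.
Proof.
move=> f1.
pose C := 8 * sigma * normal_peak (2 * sigma).
have gC n : g n.+1%:R <= C / 2 * n.+1%:R^-1.
  have n0 : 0 < n.+1%:R :> R by [].
  rewrite ler_pdivlMr // mulrC -[X in X * _](gtr0_norm n0).
  apply: (le_trans (norm_mul_normal_pdf_le _)).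
  rewrite /C; have -> : 8 * sigma * normal_peak (2 * sigma) / 2 = 4 * sigma * normal_peak (2 * sigma) by field.
  rewrite ler_wpM2l ?normal_pdf_ub ?mulf_neq0 //.
  by rewrite mulr_ge0 // ltW.
have gN x : g (- x) = g x by rewrite !normal_pdf0E sqrrN.
have B n : `|f n.+1%:R * g n.+1%:R - f (- n.+1%:R) * g (- n.+1%:R)| <= C * n.+1%:R^-1.
  rewrite gN -mulrBl normrM (ger0_norm (normal_pdf_ge0 _ _ _)).
  have -> : C / n.+1%:R = 2 * (C / 2 * n.+1%:R^-1) by field.
  rewrite ler_pM ?normal_pdf_ge0 //.
  apply: (le_trans (ler_normB _ _)).
  by have := f1 n.+1%:R; have := f1 (- n.+1%:R); lra.
apply: (@squeeze_cvgr _ _ _ _ (fun n => - (C * n.+1%:R^-1)) (fun n => C * n.+1%:R^-1)).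
- by apply: nearW => n; rewrite -ler_norml.
- rewrite -oppr0; apply: cvgN; rewrite -(mulr0 C); apply: cvgM; first exact: cvg_cst.
  exact: cvg_harmonic.
- rewrite -(mulr0 C); apply: cvgM; first exact: cvg_cst.
  exact: cvg_harmonic.
Qed.

Let F (a xi : R) := \int[mu]_x (cos (xi * x + a) * g x).

Let measurable_cos_affine (xi a : R) : measurable_fun setT (fun x : R => cos (xi * x + a)).
Proof.
apply: (measurableT_comp (f := @cos R)).
  by apply: continuous_measurable_fun; exact: continuous_cos.
by apply: measurable_funD => //; exact: measurable_funM.
Qed.

Let measurable_sin_affine (xi a : R) : measurable_fun setT (fun x : R => sin (xi * x + a)).
Proof.
apply: (measurableT_comp (f := @sin R)).
  by apply: continuous_measurable_fun; exact: continuous_sin.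
by apply: measurable_funD => //; exact: measurable_funM.
Qed.

Let is_derive_integrand (a x xi : R) :
  is_derive xi (1 : R) (fun xi : R => cos (xi * x + a) * g x) (- sin (xi * x + a) * x * g x).
Proof.
apply: is_derive_eq; rewrite /= /GRing.scale /=; ring.
Qed.

Let integrable_sin (a xi : R) :
  mu.-integrable setT (EFin \o (fun x => - sin (xi * x + a) * x * g x)).
Proof.
apply: (@le_integrable _ _ _ mu setT measurableT _ (EFin \o (fun x => `|x| * g x))).
- apply/measurable_EFinP; apply: measurable_funM; last exact: measurable_normal_pdf.
  apply: measurable_funM => //; apply: measurableT_comp => //.
  exact: measurable_sin_affine.
- move=> x _ /=; rewrite lee_fin !normrM normr_id ler_wpM2r // normrN ler_piMl // sin_max //.
- exact: integrable_norm_normal_pdf.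
Qed.

Let is_derive_F (a xi : R) : is_derive xi (1 : R) (F a) (\int[mu]_x (- sin (xi * x + a) * x * g x)).
Proof.
pose f (xi x : R) := cos (xi * x + a) * g x.
have d1E x y : partial1of2 f x y = - sin (x * y + a) * y * g y.
  by rewrite partial1of2E; case: (is_derive_integrand a y x).
have Ixi : `](xi - 1), (xi + 1)[%classic xi by rewrite /= in_itv /= ltrBlDr ltrDl ltr01.
have If x : `](xi - 1), (xi + 1)[%classic x -> mu.-integrable setT (EFin \o f x).
  move=> _; apply: (@integrable_mul_normal_pdf (fun y => cos (x * y + a)) 1); first exact: measurable_cos_affine.
  by move=> y; exact: cos_max.
have df x y : `](xi - 1), (xi + 1)[%classic x -> setT y -> derivable (f^~ y) x 1.
  by move=> _ _; case: (is_derive_integrand a y x).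
have ub x y : `](xi - 1), (xi + 1)[%classic x -> setT y -> `|partial1of2 f x y| <= `|y| * g y.
  move=> _ _; rewrite d1E !normrM (ger0_norm (normal_pdf_ge0 _ _ _)) ler_wpM2r ?normal_pdf_ge0 //.
  by rewrite normrN ler_piMl // sin_max.
have G0 y : 0 <= `|y| * g y by rewrite mulr_ge0 ?normal_pdf_ge0.
have D1 := derivable_under_integral measurableT Ixi If df G0 integrable_norm_normal_pdf ub.
have D2 := differentiation_under_integral measurableT Ixi If df G0 integrable_norm_normal_pdf ub.
apply: DeriveDef; first exact: D1.
rewrite -derive1E D2; apply: eq_Rintegral => x _.
by rewrite d1E.
Qed.

(** Stein's identity: the derivative of sin(xi x + a) [g] integrates to zero. *)
Let stein (a xi : R) :
  \int[mu]_x (- sin (xi * x + a) * x * g x) = - (sigma ^+ 2 * xi) * F a xi.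
Proof.
pose h (x : R) := sin (xi * x + a) * g x.
pose h' (x : R) := xi * (cos (xi * x + a) * g x) + (sigma ^+ 2)^-1 * (- sin (xi * x + a) * x * g x).
have Ic : mu.-integrable setT (EFin \o (fun x => cos (xi * x + a) * g x)).
  apply: (@integrable_mul_normal_pdf (fun y => cos (xi * y + a)) 1); first exact: measurable_cos_affine.
  by move=> y; exact: cos_max.
have Ic' : mu.-integrable setT (EFin \o (fun x => xi * (cos (xi * x + a) * g x))).
  by have := integrableZl measurableT xi Ic.
have Is' : mu.-integrable setT (EFin \o (fun x => (sigma ^+ 2)^-1 * (- sin (xi * x + a) * x * g x))).
  by have := integrableZl measurableT (sigma ^+ 2)^-1 (integrable_sin a xi).
have : \int[mu]_x h' x = 0.
  apply: (integral_derive_eq0 (h := h)).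
  - move=> x; have := is_derive_normal_pdf x => dg.
    by apply: is_derive_eq; rewrite /= /GRing.scale /= /h'; ring.
  - move=> x; have cg := continuous_normal_pdf0.
    have caff : {for x, continuous (fun x : R => xi * x + a)}.
      by apply: cvgD; [apply: cvgM; [exact: cvg_cst|exact: cvg_id]|exact: cvg_cst].
    apply: cvgD; apply: cvgM; [exact: cvg_cst| |exact: cvg_cst|].
      apply: cvgM; last exact: cg.
      by apply: (continuous_comp caff); exact: continuous_cos.
    apply: cvgM; last exact: cg.
    apply: cvgM; last exact: cvg_id.
    by apply: cvgN; apply: (continuous_comp caff); exact: continuous_sin.
  - by have := integrableD measurableT Ic' Is'.
  - by apply: (@normal_pdf_nat_cvg0 (fun x => sin (xi * x + a))) => x; exact: sin_max.
rewrite (RintegralD measurableT Ic' Is') (RintegralZl _ measurableT Ic).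
rewrite (RintegralZl _ measurableT (integrable_sin a xi)).
rewrite -/(F a xi) => H.
have s2 : sigma ^+ 2 != 0 by rewrite expf_neq0.
have : sigma ^+ 2 * (xi * F a xi + (sigma ^+ 2)^-1 * \int[mu]_x (- sin (xi * x + a) * x * g x)) = 0.
  by rewrite H mulr0.
by rewrite mulrDr mulrA mulrA mulfV // mul1r => /eqP; rewrite addrC addr_eq0 mulNr => /eqP.
Qed.

(** The real form of the Gaussian characteristic function. Differentiating under the integral and
    applying [stein], the integral [F] satisfies F' = - sigma^2 xi F, so [K] below is constant and
    equals its value at xi = 0. *)
Lemma gaussian_cos (a xi : R) :
  \int[mu]_x (cos (xi * x + a) * g x) = expR (- (sigma ^+ 2 * xi ^+ 2 / 2)) * cos a.
Proof.
have dF xi' := is_derive_F a xi'.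
pose K (xi : R) := expR (sigma ^+ 2 * xi ^+ 2 / 2) * F a xi.
have dK (x : R) : is_derive x (1 : R) K 0.
  have := dF x => dFx.
  apply: is_derive_eq; rewrite /= /GRing.scale /= stein !mulr1 !mulr0 add0r.
  by set u := F a x; set v := expR _; field.
have := is_derive_0_is_cst xi 0 dK; rewrite {1}/K => H.
rewrite -/(F a xi) expRN.
have e0 := expR_gt0 (sigma ^+ 2 * xi ^+ 2 / 2).
apply: (mulfI (lt0r_neq0 e0)); rewrite H mulrA mulfV ?mul1r ?lt0r_neq0 //.
rewrite /K expr0n /= mulr0 mul0r expR0 mul1r /F.
rewrite (_ : (fun x => _) = (fun x => cos a * g x)); last first.
  by apply/funext => x; rewrite mul0r add0r.
rewrite RintegralZl //; last exact: integrable_normal_pdf.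
by rewrite /Rintegral integral_normal_pdf /= mulr1.
Qed.

End gaussian.

Lemma Rintegral_sum d (T : measurableType d) (R : realType)
    (mu : {measure set T -> \bar R}) (I : Type) (s : seq I) (h : I -> T -> R) :
  (forall i, mu.-integrable setT (EFin \o h i)) ->
  \int[mu]_x (\sum_(i <- s) h i x) = \sum_(i <- s) \int[mu]_x h i x.
Proof.
move=> ih; elim: s => [|a s IH].
  by rewrite big_nil (_ : (fun x => _) = cst 0) ?Rintegral_cst ?mul0r //; apply/funext => x; rewrite big_nil.
rewrite big_cons -IH -RintegralD //; first by apply: eq_Rintegral => x _; rewrite big_cons.
rewrite (_ : EFin \o _ = (fun x => \sum_(i <- s) (EFin \o h i) x)%E).
  exact: integrable_sum.
by apply/funext => x /=; rewrite sumEFin.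
Qed.

Section gaussian_cells.
Variables (R : realType) (sigma : R).
Hypothesis sigma0 : 0 < sigma.
Local Notation mu := (@lebesgue_measure R).
Local Notation g := (normal_pdf 0 sigma).

Let sigman0 : sigma != 0. Proof. by rewrite gt_eqF. Qed.

Lemma integrable_mul_indic_pdf (A : set R) : measurable A ->
  mu.-integrable setT (EFin \o (fun x => \1_A x * g x)).
Proof.
move=> mA; apply: (@integrable_mul_normal_pdf R sigma (\1_A) 1); first exact: measurable_indic.
by move=> x; rewrite indicE; case: (_ \in _); rewrite ?normr1 ?normr0.
Qed.

Lemma normal_probE (A : set R) : measurable A ->
  normal_prob 0 sigma A = (\int[mu]_x (\1_A x * g x))%:E.
Proof.
move=> mA; rewrite /Rintegral fineK; last first.
  apply: integrable_fin_num => //; first exact: (integrable_mul_indic_pdf mA).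
rewrite /normal_prob [LHS]integral_mkcond; apply: eq_integral => x _.
by rewrite patchE indicE; case: (_ \in _); rewrite ?mul1r ?mul0r.
Qed.

(** Stated for a function with values in [0, 1] rather than a set, so that it also applies to one
    minus the sum of the cell indicators. *)
Lemma gaussian_tail (f : R -> R) (t : R) : 0 <= t -> measurable_fun setT f ->
  (forall x, 0 <= f x <= 1) -> (forall x, f x != 0 -> t <= `|x|) ->
  \int[mu]_x (f x * g x) <= 2 * expR (- (3 * t ^+ 2 / (8 * sigma ^+ 2))).
Proof.
move=> t0 mf f01 ft.
set e := 2 * _; pose G x := e * normal_pdf 0 (2 * sigma) x.
have IG : mu.-integrable setT (EFin \o normal_pdf 0 (2 * sigma)) by exact: integrable_normal_pdf.
have <- : \int[mu]_x G x = e.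
  by rewrite RintegralZl // /Rintegral integral_normal_pdf mulr1.
apply: le_Rintegral => //.
- apply: (@integrable_mul_normal_pdf _ _ _ 1) => // x.
  by case/andP: (f01 x) => f0 f1; rewrite ger0_norm.
- by have := integrableZl measurableT e IG.
move=> x _; have [->|/ft tx] := eqVneq (f x) 0.
  by rewrite mul0r mulr_ge0 ?normal_pdf_ge0 ?mulr_ge0 ?expR_ge0.
apply: (@le_trans _ _ (g x)).
  by case/andP: (f01 x) => f0 f1; rewrite ler_piMl // normal_pdf_ge0.
rewrite (normal_pdf_wider sigma0) /G ler_wpM2r ?normal_pdf_ge0 // ler_wpM2l //.
rewrite ler_expR lerN2 ler_wpM2r ?invr_ge0 ?mulr_ge0 ?exprn_ge0 ?(ltW sigma0) //.
rewrite ler_wpM2l // -[x ^+ 2]real_normK ?num_real //.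
by rewrite lerXn2r ?nnegrE.
Qed.

Variables (T : R) (K : nat).
Hypotheses (T0 : 0 < T) (K0 : (0 < K)%N).

(** The [K] cells tile (-2T, 2T], twice the box that holds the atoms: the mass that an atom sends
    outside is then a Gaussian tail beyond [T]. *)
Definition cell_width : R := 4 * T / K%:R.
Local Notation eta := cell_width.
Definition cell_bound (l : nat) : R := - (2 * T) + l%:R * eta.
(** The set of noise values [x] for which theta + x lies in cell [l]; translating the cell keeps
    every integral against the centred density. *)
Definition shifted_cell (theta : R) (l : nat) : set R :=
  [set` `](cell_bound l - theta), (cell_bound l.+1 - theta)]].
Definition cell_prob (theta : R) (l : nat) : R :=
  fine (normal_prob 0 sigma (shifted_cell theta l)).

Lemma cell_width_gt0 : 0 < eta.
Proof. by rewrite divr_gt0 ?mulr_gt0 ?ltr0n. Qed.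

Lemma cell_boundS l : cell_bound l.+1 = cell_bound l + eta.
Proof. by rewrite /cell_bound -[l.+1]addn1 natrD; ring. Qed.

Lemma cell_bound0 : cell_bound 0 = - (2 * T).
Proof. by rewrite /cell_bound mul0r addr0. Qed.

Lemma cell_boundK : cell_bound K = 2 * T.
Proof. by rewrite /cell_bound /eta; field; rewrite pnatr_eq0 -lt0n. Qed.

Lemma cell_bound_le m n : (m <= n)%N -> cell_bound m <= cell_bound n.
Proof.
by move=> mn; rewrite lerD2l ler_wpM2r ?(ltW cell_width_gt0) // ler_nat.
Qed.

Lemma cell_bound_itv l : (l <= K)%N -> - (2 * T) <= cell_bound l <= 2 * T.
Proof.
by move=> lK; rewrite -{1}cell_bound0 -cell_boundK !cell_bound_le.
Qed.

Lemma measurable_shifted_cell theta l : measurable (shifted_cell theta l).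
Proof. exact: measurable_itv. Qed.
Local Hint Resolve measurable_shifted_cell : core.

Lemma mem_shifted_cell theta l x :
  (x \in shifted_cell theta l) = (cell_bound l < theta + x <= cell_bound l.+1).
Proof.
apply/idP/idP; first by move/set_mem; rewrite /shifted_cell /= in_itv /=; lra.
by move=> H; apply/mem_set; rewrite /shifted_cell /= in_itv /=; lra.
Qed.

Lemma sum_indic_cell theta x :
  \sum_(l < K) \1_(shifted_cell theta l) x = (- (2 * T) < theta + x <= 2 * T)%R%:R :> R.
Proof.
rewrite -cell_bound0 -cell_boundK.
suff H n : \sum_(l < n) \1_(shifted_cell theta l) x =
    (cell_bound 0 < theta + x <= cell_bound n)%R%:R :> R by exact: H.
elim: n => [|n IH].
  by rewrite big_ord0; case: ltP => //= H; rewrite leNgt H.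
rewrite big_ord_recr /= IH indicE mem_shifted_cell.
have b0 : cell_bound 0 <= cell_bound n.
  exact: cell_bound_le.
have bS : cell_bound n < cell_bound n.+1 by rewrite cell_boundS ltrDl cell_width_gt0.
rewrite [theta + x <= cell_bound n]leNgt.
have [yn|yn] := ltP (cell_bound n) (theta + x).
  by rewrite andbF add0r (le_lt_trans b0 yn).
by rewrite andbT andFb addr0 (le_trans yn (ltW bS)) andbT.
Qed.

Lemma integrable_cell theta l :
  mu.-integrable setT (EFin \o (fun x => \1_(shifted_cell theta l) x * g x)).
Proof. exact: integrable_mul_indic_pdf. Qed.

Lemma cell_probE theta l :
  cell_prob theta l = \int[mu]_x (\1_(shifted_cell theta l) x * g x).
Proof. by rewrite /cell_prob normal_probE. Qed.

Lemma cell_prob_ge0 theta l : 0 <= cell_prob theta l.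
Proof. by rewrite /cell_prob fine_ge0. Qed.

Lemma normal_probT : \int[mu]_x (g x) = 1.
Proof. by rewrite /Rintegral integral_normal_pdf. Qed.

Lemma sum_cell_prob theta : \sum_(l < K) cell_prob theta l =
  \int[mu]_x ((\sum_(l < K) \1_(shifted_cell theta l) x) * g x).
Proof.
under eq_bigr do rewrite cell_probE.
rewrite -Rintegral_sum; last by move=> l; exact: integrable_cell.
by apply: eq_Rintegral => x _; rewrite mulr_suml.
Qed.

Let integrable_sum_cell theta : mu.-integrable setT
  (EFin \o (fun x => (\sum_(l < K) \1_(shifted_cell theta l) x) * g x)).
Proof.
apply: (@integrable_mul_normal_pdf _ _ _ 1) => [|x].
  by apply: measurable_sum => l; exact: measurable_indic.
by rewrite sum_indic_cell; case: (_ && _); rewrite ?normr1 ?normr0.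
Qed.

Lemma sum_cell_prob_le1 theta : \sum_(l < K) cell_prob theta l <= 1.
Proof.
rewrite sum_cell_prob -normal_probT; apply: le_Rintegral => //.
  exact: integrable_normal_pdf.
move=> x _; rewrite sum_indic_cell; case: (_ && _); rewrite ?mul1r ?mul0r //.
exact: normal_pdf_ge0.
Qed.

Lemma sum_cell_prob_ge theta : `|theta| <= T ->
  1 - 2 * expR (- (3 * T ^+ 2 / (8 * sigma ^+ 2))) <= \sum_(l < K) cell_prob theta l.
Proof.
move=> thT; rewrite lerBlDr addrC -lerBlDr sum_cell_prob -{1}normal_probT.
rewrite -RintegralB //; last exact: integrable_normal_pdf.
rewrite (_ : (fun x => _) =
    (fun x => (1 - \sum_(l < K) \1_(shifted_cell theta l) x) * g x)); last first.
  by apply/funext => x; rewrite mulrBl mul1r.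
apply: gaussian_tail; first exact: ltW.
- by apply: measurable_funB => //; apply: measurable_sum => l; exact: measurable_indic.
- by move=> x; rewrite sum_indic_cell; case: (_ < _ <= _) => /=; rewrite ?subr0 ?subrr ?lexx ?ler01.
- move=> x; rewrite sum_indic_cell; case: (boolP (_ && _)); rewrite ?subrr ?eqxx // => H _.
  rewrite leNgt; apply: contra H; move: thT; rewrite ler_norml ltr_norml; lra.
Qed.

(** A Riemann sum at right end points: the Lipschitz constant pays for the cell width and the sup
    norm for the mass outside the cells. The sum sees [theta] only through its cell probabilities,
    so averages over a mixture become linear functionals of the binned mixture. *)
Lemma gaussian_quadrature (F : R -> R) (theta C Lam : R) :
  measurable_fun setT F -> (forall x, `|F x| <= C) ->
  (forall x y, `|F x - F y| <= Lam * `|x - y|) -> 0 <= Lam ->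
  `|\int[mu]_x (F (theta + x) * g x) - \sum_(l < K) F (cell_bound l.+1) * cell_prob theta l| <=
  Lam * eta + C * (1 - \sum_(l < K) cell_prob theta l).
Proof.
move=> mF FC FL Lam0.
pose I l x : R := \1_(shifted_cell theta l) x.
pose D x := F (theta + x) - \sum_(l < K) F (cell_bound l.+1) * I l x.
have mF' : measurable_fun setT (fun x => F (theta + x)).
  by apply: (measurableT_comp mF); exact: measurable_funD.
have iF : mu.-integrable setT (EFin \o (fun x => F (theta + x) * g x)).
  exact: (@integrable_mul_normal_pdf _ _ _ C).
have iI l : mu.-integrable setT (EFin \o (fun x => F (cell_bound l.+1) * (I l x * g x))).
  by have := integrableZl measurableT (F (cell_bound l.+1)) (integrable_cell theta l).
have iS : mu.-integrable setT (EFin \o (fun x => \sum_(l < K) F (cell_bound l.+1) * (I l x * g x))).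
  rewrite (_ : EFin \o _ = (fun x => (\sum_(l < K) (F (cell_bound l.+1) * (I l x * g x))%R%:E)%E)).
    by apply: integrable_sum => // l _; exact: iI.
  by apply/funext => x /=; rewrite sumEFin.
have DE x : D x * g x = F (theta + x) * g x - \sum_(l < K) F (cell_bound l.+1) * (I l x * g x).
  by rewrite /D mulrBl mulr_suml; congr (_ - _); apply: eq_bigr => l _; rewrite mulrA.
have -> : \int[mu]_x (F (theta + x) * g x) - \sum_(l < K) F (cell_bound l.+1) * cell_prob theta l =
    \int[mu]_x (D x * g x).
  rewrite (_ : (fun x => D x * g x) = (fun x => F (theta + x) * g x -
      \sum_(l < K) F (cell_bound l.+1) * (I l x * g x))); last by apply/funext => x; rewrite DE.
  rewrite RintegralB // Rintegral_sum //; congr (_ - _); apply: eq_bigr => l _.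
  by rewrite RintegralZl ?cell_probE //; exact: integrable_cell.
have iD : mu.-integrable setT (EFin \o (fun x => D x * g x)).
  have := integrableB measurableT iF iS; congr (integrable _ _ _).
  by apply/funext => x /=; rewrite DE.
apply: (le_trans (le_normr_Rintegral measurableT iD)).
have DB x : `|D x| <= Lam * eta + C * (1 - \sum_(l < K) I l x).
  have -> : D x = \sum_(l < K) (F (theta + x) - F (cell_bound l.+1)) * I l x + F (theta + x) * (1 - \sum_(l < K) I l x).
    under eq_bigr do rewrite mulrBl.
    by rewrite sumrB /D -mulr_sumr; ring.
  apply: (le_trans (ler_normD _ _)); apply: lerD.
    apply: (@le_trans _ _ (\sum_(l < K) Lam * eta * I l x)).
      apply: (le_trans (ler_norm_sum _ _ _)); apply: ler_sum => l _.
      rewrite normrM /I indicE mem_shifted_cell; case: (boolP (_ && _)) => H; last by rewrite normr0 !mulr0.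
      rewrite normr1 !mulr1 (le_trans (FL _ _)) // ler_wpM2l //.
      by move: H; rewrite cell_boundS ler_norml; have := cell_width_gt0; lra.
    rewrite -mulr_sumr sum_indic_cell; case: (_ && _); rewrite ?mulr1 ?mulr0 //.
    by rewrite mulr_ge0 // ltW // cell_width_gt0.
  have S1 : 0 <= 1 - \sum_(l < K) I l x :> R.
    by rewrite sum_indic_cell; case: (_ && _); rewrite ?subr0 ?subrr.
  by rewrite normrM (ger0_norm S1) ler_wpM2r.
have i1 : mu.-integrable setT (EFin \o (fun x => (1 - \sum_(l < K) I l x) * g x)).
  apply: (@integrable_mul_normal_pdf _ _ _ 1) => [|x].
    by apply: measurable_funB => //; apply: measurable_sum => l; exact: measurable_indic.
  by rewrite sum_indic_cell; case: (_ && _); rewrite ?subr0 ?subrr ?normr1 ?normr0.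
have ig : mu.-integrable setT (EFin \o g) by exact: integrable_normal_pdf.
have ig1 : mu.-integrable setT (EFin \o (fun x => Lam * eta * g x)).
  by have := integrableZl measurableT (Lam * eta) ig.
have ig2 : mu.-integrable setT (EFin \o (fun x => C * ((1 - \sum_(l < K) I l x) * g x))).
  by have := integrableZl measurableT C i1.
have -> : Lam * eta + C * (1 - \sum_(l < K) cell_prob theta l) =
    \int[mu]_x (Lam * eta * g x + C * ((1 - \sum_(l < K) I l x) * g x)).
  rewrite RintegralD // !RintegralZl // normal_probT mulr1; congr (_ + _ * _).
  rewrite sum_cell_prob -{1}normal_probT -RintegralB //.
  by apply: eq_Rintegral => x _; rewrite mulrBl mul1r.
apply: le_Rintegral => //.
- exact: (integrable_abse iD).
- by have := integrableD measurableT ig1 ig2.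
- move=> x _; rewrite normrM (ger0_norm (normal_pdf_ge0 _ _ _)).
  rewrite [C * (_ * _)]mulrA -(mulrDl (Lam * eta)).
  by rewrite ler_wpM2r ?normal_pdf_ge0.
Qed.

(** Oscillation of ln [g] over a cell: its slope at distance at most 3T from the atom is at most 3T
    / sigma^2. *)
Definition cell_osc : R := 3 * T * eta / sigma ^+ 2.

Lemma normal_pdf_osc theta l x y : (l < K)%N -> `|theta| <= T ->
  cell_bound l <= x <= cell_bound l.+1 -> cell_bound l <= y <= cell_bound l.+1 ->
  g (x - theta) <= expR cell_osc * g (y - theta).
Proof.
move=> lK thT Hx Hy.
rewrite !(normal_pdf0E sigma0) mulrCA ler_wpM2l ?normal_peak_ge0 // -expRD ler_expR.
have s2 : 0 < sigma ^+ 2 by rewrite exprn_gt0.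
have := cell_bound_itv (ltnW lK); have := cell_bound_itv lK.
move: Hx Hy thT; rewrite cell_boundS ler_norml => Hx Hy thT B1 B2.
suff : (y - theta) ^+ 2 - (x - theta) ^+ 2 <= 6 * T * eta.
  move=> H; rewrite /cell_osc -[sigma ^+ 2 *+ 2]mulr_natl -subr_ge0.
  have -> : 3 * T * eta / sigma ^+ 2 + - (y - theta) ^+ 2 / (2 * sigma ^+ 2) -
     - (x - theta) ^+ 2 / (2 * sigma ^+ 2) = (6 * T * eta - ((y - theta) ^+ 2 - (x - theta) ^+ 2)) / (2 * sigma ^+ 2).
    by field.
  by rewrite divr_ge0 ?subr_ge0 // mulr_ge0 // ltW.
have -> : (y - theta) ^+ 2 - (x - theta) ^+ 2 = (y - x) * (x + y - 2 * theta) by ring.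
apply: (le_trans (ler_norm _)); rewrite normrM mulrC.
apply: ler_pM; rewrite ?normr_ge0 // ler_norml; lra.
Qed.

Lemma cell_prob_bounds theta l y : (l < K)%N -> `|theta| <= T ->
  cell_bound l <= y <= cell_bound l.+1 ->
  eta * (expR (- cell_osc) * g (y - theta)) <= cell_prob theta l <=
  eta * (expR cell_osc * g (y - theta)).
Proof.
move=> lK thT yl.
have ew : fine (mu (shifted_cell theta l)) = eta.
  rewrite /shifted_cell lebesgue_measure_itv /= lte_fin ltrD2r cell_boundS ltrDl cell_width_gt0.
  by rewrite -EFinB /=; ring.
have Ic c : \int[mu]_(x in shifted_cell theta l) c = eta * c.
  rewrite Rintegral_cst; last exact: measurable_shifted_cell.
  by rewrite ew mulrC.
have E : cell_prob theta l = \int[mu]_(x in shifted_cell theta l) g x.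
  by rewrite /cell_prob /normal_prob.
have ig : mu.-integrable (shifted_cell theta l) (EFin \o g).
  by apply: integrableS (integrable_normal_pdf 0 sigma); [exact: measurableT|exact: measurable_shifted_cell|exact: subsetT].
have ic c : mu.-integrable (shifted_cell theta l) (EFin \o cst c).
  apply/integrableP; split; first by apply/measurable_EFinP; exact: measurable_cst.
  rewrite /= integral_cst; last exact: measurable_shifted_cell.
  rewrite [X in (_ * X < _)%E](_ : _ = eta%:E) ?ltry //.
  rewrite /= /shifted_cell lebesgue_measure_itv /= lte_fin ltrD2r cell_boundS ltrDl cell_width_gt0.
  by rewrite -EFinB; congr _%:E; ring.
have xc x : shifted_cell theta l x -> cell_bound l <= theta + x <= cell_bound l.+1.
  by move=> /mem_set; rewrite mem_shifted_cell => /andP[/ltW-> ->].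
have mc := measurable_shifted_cell theta l.
rewrite E -!Ic; apply/andP; split; apply: le_Rintegral => //; try exact: ic.
- move=> x /xc xl; rewrite expRN mulrC ler_pdivrMr ?expR_gt0 // mulrC.
  have -> : x = (theta + x) - theta by rewrite addrC addKr.
  exact: (normal_pdf_osc lK).
- move=> x /xc xl; have -> : x = (theta + x) - theta by rewrite addrC addKr.
  exact: (normal_pdf_osc lK).
Qed.

End gaussian_cells.

(** * The NPMLE *)

Section atomic_measure.
Variables (R : realType) (p : nat) (beta : 'I_p -> R).

(** Atoms sit on [nat], with weight 0 beyond [p]. The absolute value makes the weights nonnegative
    unconditionally, so the measure structure can be declared before [beta0] is assumed. *)
Definition atomic_measure : set nat -> \bar R :=
  msum (fun n => mscale (NngNum (normr_ge0 (if insub n is Some j then beta j else 0)))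
    (dirac n : {measure set nat -> \bar R})) p.

HB.instance Definition _ := Measure.on atomic_measure.

Hypothesis beta0 : forall j, 0 <= beta j.

Lemma integral_atomic_measure (f : nat -> R) : (forall n, 0 <= f n) ->
  (\int[atomic_measure]_n (f n)%:E = (\sum_(j < p) beta j * f j)%:E)%E.
Proof.
move=> f0.
rewrite ge0_integral_measure_sum //; last by move=> x _; rewrite lee_fin.
rewrite -sumEFin; apply: eq_bigr => j _.
rewrite ge0_integral_mscale //; last by move=> x _; rewrite lee_fin.
rewrite integral_dirac // diracT mul1e -EFinM.
by rewrite insubT //= => jp; rewrite ger0_norm //; congr ((beta _ * _)%:E); apply: val_inj.
Qed.

Lemma atomic_measureT : \sum_j beta j = 1 -> atomic_measure setT = 1%E.
Proof.
move=> b1; have := integral_atomic_measure (f := fun=> 1) (fun=> ler01).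
rewrite integral_cst //= mul1e => ->.
by under eq_bigr do rewrite mulr1; rewrite b1.
Qed.

Lemma atomic_mixture_density (sigma : R) (d : nat) (theta : 'I_p -> 'rV[R]_d) :
  \sum_j beta j = 1 ->
  exists (nu : probability nat R) (th : nat -> 'rV[R]_d),
    (forall k, measurable_fun setT (fun t => th t ord0 k)) /\
    forall y, mixture_density sigma nu th y = \sum_j beta j * phi sigma (y - theta j).
Proof.
move=> b1.
pose nu : probability nat R := HB.pack atomic_measure
  (Measure_isProbability.Build _ _ _ atomic_measure (atomic_measureT b1)).
pose th n := if insub n is Some j then theta j else 0.
exists nu, th; split=> // y.
rewrite /mixture_density integral_atomic_measure /=; last first.
  by move=> n; rewrite mulr_ge0 ?expR_ge0 ?exprn_ge0 ?invr_ge0 ?sqrtr_ge0.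
apply: eq_bigr => j _; rewrite /th insubT //= => jp.
by congr (_ * phi _ (_ - theta _)); apply: val_inj.
Qed.

End atomic_measure.

Section NPMLE.
Variables (R : realType) (n d p : nat) (sigma : R).
Hypothesis sigma0 : 0 < sigma.
Variables (Y : 'I_n -> 'rV[R]_d) (alpha : 'I_p -> R) (theta : 'I_p -> 'rV[R]_d).
Hypothesis mle : is_NPMLE sigma Y alpha theta.

Lemma phi_gt0 (v : 'rV[R]_d) : 0 < phi sigma v.
Proof.
rewrite mulr_gt0 ?expR_gt0 // exprn_gt0 // invr_gt0 sqrtr_gt0 mulrn_wgt0 //.
by rewrite mulr_gt0 ?pi_gt0 // exprn_gt0.
Qed.

Lemma NPMLE_ge_atomic (q : nat) (beta : 'I_q -> R) (theta' : 'I_q -> 'rV[R]_d) :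
  (forall j, 0 <= beta j) -> \sum_j beta j = 1 ->
  \sum_i ln (\sum_j beta j * phi sigma (Y i - theta' j)) <=
  \sum_i ln (\sum_j alpha j * phi sigma (Y i - theta j)).
Proof.
move=> b0 b1; have [_ [_ opt]] := mle.
have [nu [th [mth E]]] := atomic_mixture_density b0 sigma theta' b1.
have := opt _ _ nu th mth; rewrite lerN2.
by under [X in X <= _ -> _]eq_bigr do rewrite E.
Qed.

(* Otherwise projecting an atom onto the box would bring it strictly closer to
   every observation, increasing the likelihood. *)
Lemma NPMLE_atoms_in_box (T : R) : (0 < n)%N -> (forall i k, `|Y i ord0 k| <= T) ->
  forall j k, `|theta j ord0 k| <= T.
Proof.
move=> n0 YT j0 k0; rewrite leNgt; apply/negP => Tth.
have T0 : 0 <= T by apply: le_trans (YT (Ordinal n0) k0).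
pose clip (t : R) := Num.max (- T) (Num.min t T).
have clip_le (y t : R) : `|y| <= T -> (y - clip t) ^+ 2 <= (y - t) ^+ 2.
  rewrite ler_norml => /andP[y1 y2]; rewrite /clip.
  have [tT|tT] := leP t T; last first.
    rewrite max_r; last by lra.
    rewrite -subr_ge0 (_ : (y - t) ^+ 2 - (y - T) ^+ 2 = (t - T) * (t + T - 2 * y)); last by ring.
    by apply: mulr_ge0; lra.
  have [tT'|tT'] := leP (- T) t; first by [].
  rewrite -subr_ge0 (_ : (y - t) ^+ 2 - (y - - T) ^+ 2 = (- T - t) * (2 * y + T - t)); last by ring.
    by apply: mulr_ge0; lra.
have clip_lt (y t : R) : `|y| <= T -> T < `|t| -> (y - clip t) ^+ 2 < (y - t) ^+ 2.
  rewrite ler_norml lter_normr => /andP[y1 y2] /orP[tT|tT]; rewrite /clip.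
    rewrite min_r ?max_r; [|lra|lra].
    rewrite -subr_gt0 (_ : (y - t) ^+ 2 - (y - T) ^+ 2 = (t - T) * (t + T - 2 * y)); last by ring.
    by apply: mulr_gt0; lra.
  rewrite min_l ?max_l; [|lra|lra].
  rewrite -subr_gt0 (_ : (y - t) ^+ 2 - (y - - T) ^+ 2 = (- T - t) * (2 * y + T - t)); last by ring.
    by apply: mulr_gt0; lra.
pose theta' j : 'rV[R]_d := \row_k clip (theta j ord0 k).
have [a0 [a1 _]] := mle.
have peak0 : 0 < (Num.sqrt (sigma ^+ 2 * pi *+ 2))^-1 ^+ d.
  by have := phi_gt0 0; rewrite pmulr_lgt0 // expR_gt0.
have phiE (u v : 'rV[R]_d) : (phi sigma u <= phi sigma v) = (sqnorm v <= sqnorm u).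
  rewrite ler_pM2l // ler_expR ler_pM2r ?lerN2 // invr_gt0 mulrn_wgt0 // exprn_gt0 //.
have sq i j : sqnorm (Y i - theta' j) <= sqnorm (Y i - theta j).
  by apply: ler_sum => k _; rewrite !mxE clip_le.
have sq0 i : sqnorm (Y i - theta' j0) < sqnorm (Y i - theta j0).
  rewrite /sqnorm (bigD1 k0) //= [ltRHS](bigD1 k0) //= !mxE ltr_leD ?clip_lt //.
  by apply: ler_sum => k _; rewrite !mxE clip_le.
have lt i : \sum_j alpha j * phi sigma (Y i - theta j) <
    \sum_j alpha j * phi sigma (Y i - theta' j).
  rewrite (bigD1 j0) //= [ltRHS](bigD1 j0) //= ltr_leD //.
    by rewrite ltr_pM2l // ltNge phiE -ltNge.
  by apply: ler_sum => j _; rewrite ler_wpM2l ?(ltW (a0 j)) // phiE.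
have pos i (t : 'I_p -> 'rV[R]_d) : 0 < \sum_j alpha j * phi sigma (Y i - t j).
  rewrite (bigD1 j0) //= ltr_pwDl //; first by rewrite mulr_gt0 ?phi_gt0.
  by apply: sumr_ge0 => j _; rewrite mulr_ge0 ?ltW ?phi_gt0.
have := NPMLE_ge_atomic theta' (fun j => ltW (a0 j)) a1; apply/negP; rewrite -ltNge.
rewrite (bigD1 (Ordinal n0)) //= [ltRHS](bigD1 (Ordinal n0)) //= ltr_leD //.
  by rewrite ltr_ln // posrE.
by apply: ler_sum => i _; rewrite ler_ln ?posrE // ltW.
Qed.

End NPMLE.

(** * Concentration of the cell frequencies *)

(** From exp(-s) >= 1 - s one gets exp(s) <= 1/(1 - s), and the quadratic dominates this as long as
    s <= 1/2. *)
Lemma expR_le_quadratic (R : realType) (s : R) : `|s| <= 1 / 2 -> expR s <= 1 + s + 2 * s ^+ 2.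
Proof.
rewrite ler_norml => /andP[s1 s2].
have h : 0 < 1 - s by lra.
have : 1 - s <= expR (- s) by exact: expR_ge1Dx.
rewrite expRN -[leLHS]invrK lef_pV2 ?posrE ?invr_gt0 ?expR_gt0 // => /le_trans; apply.
rewrite -[_^-1]mul1r ler_pdivrMr // -subr_ge0.
rewrite (_ : _ - 1 = s ^+ 2 * (1 - 2 * s)); last by ring.
by rewrite mulr_ge0 ?sqr_ge0 //; lra.
Qed.

Section chernoff.
Context {R : realType} {dO : measure_display} {Om : measurableType dO}.
Variables (P : probability Om R) (n : nat) (A : 'I_n -> set Om).
Hypothesis mA : forall i, measurable (A i).
Hypothesis indepA : forall S : {set 'I_n},
  P (\big[setI/setT]_(i in S) A i) = (\prod_(i in S) P (A i))%E.

Let p i : R := fine (P (A i)).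
Let X w : R := \sum_i \1_(A i) w.

Let pE i : P (A i) = (p i)%:E.
Proof. by rewrite /p fineK // fin_num_measure. Qed.

Let p01 i : 0 <= p i <= 1.
Proof. by rewrite -!lee_fin -pE measure_ge0 probability_le1. Qed.

Let mcap (S : {set 'I_n}) : measurable (\big[setI/setT]_(i in S) A i).
Proof. by apply: bigsetI_measurable => i _. Qed.

Let indic_cap (S : {set 'I_n}) w :
  \1_(\big[setI/setT]_(i in S) A i) w = \prod_(i in S) \1_(A i) w :> R.
Proof.
apply: (big_ind2 (fun (B : set Om) (x : R) => \1_B w = x)) => //.
- by rewrite indicT.
- by move=> B x C y <- <-; rewrite indicI.
Qed.

Let prod_expand (a : R) w : \prod_i (1 + a * \1_(A i) w) =
  \sum_(S : {set 'I_n}) a ^+ #|S| * \1_(\big[setI/setT]_(i in S) A i) w.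
Proof.
under eq_bigr do rewrite addrC.
rewrite bigA_distr; apply: eq_bigr => S _.
rewrite indic_cap -big_mkcond /= big_split /= prodr_const.
by [].
Qed.

Lemma integrable_bounded (f : Om -> R) (C : R) : measurable_fun setT f ->
  (forall w, `|f w| <= C) -> P.-integrable setT (EFin \o f).
Proof.
move=> mf fC; apply: (@le_integrable _ _ _ P setT measurableT _ (EFin \o cst C)).
- exact/measurable_EFinP.
- by move=> w _ /=; rewrite lee_fin (le_trans (fC w)) // ler_norm.
- exact: finite_measure_integrable_cst.
Qed.

Lemma integrable_indicator (B : set Om) : measurable B ->
  P.-integrable setT (EFin \o (\1_B : Om -> R)).
Proof.
move=> mB; apply: (@integrable_bounded _ 1); first exact: measurable_indic.
by move=> w; rewrite indicE; case: (_ \in _); rewrite ?normr1 ?normr0.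
Qed.

Lemma Rintegral_indicator (B : set Om) : measurable B -> \int[P]_w \1_B w = fine (P B).
Proof. by move=> mB; rewrite /Rintegral integral_indic // setIT. Qed.

Let integrable_indic_cap (c : R) (B : set Om) : measurable B ->
  P.-integrable setT (EFin \o (fun w => c * \1_B w)).
Proof.
by move=> mB; have := integrableZl measurableT c (integrable_indicator mB).
Qed.

(** With a = exp(s) - 1 the integrand is the exponential of [s] times the count. Expanding over
    subsets reduces its mean to probabilities of intersections of the [A i], which is all that
    [indepA] provides. *)
Lemma integral_prod_indic (a : R) :
  \int[P]_w (\prod_i (1 + a * \1_(A i) w)) = \prod_i (1 + a * p i).
Proof.
under eq_Rintegral do rewrite prod_expand.
rewrite Rintegral_sum; last by move=> S; exact: integrable_indic_cap.
under [RHS]eq_bigr do rewrite addrC.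
rewrite bigA_distr; apply: eq_bigr => S _.
rewrite RintegralZl //; last exact: integrable_indicator.
rewrite Rintegral_indicator // indepA -big_mkcond /= big_split /= prodr_const.
congr (_ * _); rewrite (eq_bigr (fun i => (p i)%:E)) => [|i _]; last exact: pE.
by rewrite prodEFin.
Qed.

Let measurable_X : measurable_fun setT X.
Proof. by apply: measurable_sum => i; exact: measurable_indic. Qed.

Let expX (s : R) w : expR (s * X w) = \prod_i (1 + (expR s - 1) * \1_(A i) w).
Proof.
rewrite /X mulr_sumr expR_sum; apply: eq_bigr => i _.
rewrite indicE; case: (_ \in _); first by rewrite !mulr1 addrCA subrr addr0.
by rewrite !mulr0 expR0 addr0.
Qed.

(** The sign of [s] selects the tail, so one statement covers both deviations. The quadratic term
    uses that the probabilities sum to at most [n]. *)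
Lemma chernoff (s t : R) : `|s| <= 1 / 2 -> 0 <= t ->
  (P [set w | s * (\sum_i p i) + `|s| * (n%:R * t) < s * X w]%R <=
  (expR (- (`|s| * (n%:R * t)) + 2 * s ^+ 2 * n%:R))%:E)%E.
Proof.
move=> s12 t0; set c := _ + `|s| * _; set B := [set w | _].
have mB : measurable B.
  rewrite (_ : B = setT `&` (fun w => s * X w) @^-1` `]c, +oo[); last first.
    by rewrite setTI; apply/seteqP; split => w; rewrite /B /= in_itv /= andbT.
  by apply: (measurable_funM _ measurable_X).
rewrite -[P B]fineK ?fin_num_measure // lee_fin -Rintegral_indicator //.
have nE : n%:R = \sum_(i < n) 1 :> R by rewrite sumr_const card_ord.
have X0n w : 0 <= X w <= n%:R.
  rewrite sumr_ge0 //= nE.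
  by apply: ler_sum => i _; rewrite indicE; case: (_ \in _).
have Xb w : `|expR (s * X w)| <= expR (`|s| * n%:R).
  rewrite ger0_norm ?expR_ge0 // ler_expR (le_trans (ler_norm _)) // normrM.
  by rewrite ler_wpM2l //; case/andP: (X0n w) => X0 X1; rewrite ger0_norm.
have mE : measurable_fun setT (fun w => expR (s * X w)).
  by apply: (measurableT_comp (@measurable_expR R)); exact: measurable_funM.
have iE := integrable_bounded mE Xb.
apply: (@le_trans _ _ (\int[P]_w (expR (- c) * expR (s * X w)))).
  apply: le_Rintegral => //; first exact: integrable_indicator.
    by have := integrableZl measurableT (expR (- c)) iE.
  move=> w _; rewrite -expRD indicE; case: (boolP (w \in B)) => wB; last by rewrite expR_ge0.
  rewrite -[1%:R]expR0 ler_expR addrC subr_ge0 ltW //.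
  by move/set_mem : wB.
rewrite RintegralZl //; under eq_Rintegral do rewrite expX.
rewrite integral_prod_indic.
have ps : \prod_i (1 + (expR s - 1) * p i) <= expR ((s + 2 * s ^+ 2) * \sum_i p i).
  rewrite mulr_sumr expR_sum; apply: ler_prod => i _.
  have [p0 p1] := andP (p01 i).
  apply/andP; split.
    have : 0 <= (1 - p i) + expR s * p i by rewrite addr_ge0 ?subr_ge0 ?mulr_ge0 ?expR_ge0.
    by rewrite mulrBl mul1r; lra.
  apply: (le_trans (expR_ge1Dx _)); rewrite ler_expR ler_wpM2r //.
  by have := expR_le_quadratic s12; lra.
apply: (@le_trans _ _ (expR (- c) * expR ((s + 2 * s ^+ 2) * \sum_i p i))).
  by rewrite ler_wpM2l ?expR_ge0.
rewrite -expRD ler_expR /c.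
have : \sum_i p i <= n%:R.
  rewrite nE.
  by apply: ler_sum => i _; case/andP: (p01 i).
have := sqr_ge0 s => s2 pn.
have : s ^+ 2 * \sum_i p i <= s ^+ 2 * n%:R by rewrite ler_wpM2l.
set u := `|s| * _; lra.
Qed.

Lemma chernoff_abs (t : R) : 0 < t <= 2 ->
  exists B : set Om, measurable B /\
    (P B <= (2 * expR (- (n%:R * t ^+ 2 / 8)))%:E)%E /\
    forall w, ~ B w -> `|X w - \sum_i p i| <= n%:R * t.
Proof.
move=> /andP[t0 t2].
(* Minimiser of - s n t + 2 s^2 n, with minimum - n t^2 / 8; the bound t <= 2 gives s <= 1/2. *)
pose s := t / 4.
have s1 : 0 < s by rewrite divr_gt0.
have s0 := ltW s1.
have s12 : `|s| <= 1 / 2 by rewrite ger0_norm // /s; lra.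
have s12' : `|- s| <= 1 / 2 by rewrite normrN.
pose B (s : R) := [set w | s * (\sum_i p i) + `|s| * (n%:R * t) < s * X w].
have mB r : measurable (B r).
  rewrite (_ : B r = setT `&` (fun w => r * X w) @^-1` `](r * (\sum_i p i) + `|r| * (n%:R * t)), +oo[); last first.
    by rewrite setTI; apply/seteqP; split => w; rewrite /B /= in_itv /= andbT.
  by apply: (measurable_funM _ measurable_X).
have PB r : `|r| <= 1 / 2 -> `|r| = s -> (P (B r) <= (expR (- (n%:R * t ^+ 2 / 8)))%:E)%E.
  move=> r12 rs; apply: (le_trans (chernoff r12 (ltW t0))).
  rewrite lee_fin ler_expR -[r ^+ 2]real_normK ?num_real // rs /s.
  by rewrite le_eqVlt; apply/orP; left; apply/eqP; field.
exists (B s `|` B (- s)); split; first exact: measurableU.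
split.
  apply: (le_trans (measureU2 _ _ _)) => //.
  rewrite mulr_natl mulr2n EFinD leeD //; apply: PB => //; first exact: ger0_norm.
  by rewrite normrN ger0_norm.
move=> w /not_orP[H1 H2].
move: H1 H2; rewrite /B /= normrN (ger0_norm s0) !mulNr => /negP + /negP.
rewrite -!leNgt -mulrDr ler_pM2l // -mulrN -[- (s * _)]mulrN -mulrDr ler_pM2l // ler_norml.
lra.
Qed.

End chernoff.

Lemma measure_bigsetU_le d (T : measurableType d) (R : realType)
    (P : probability T R) (I : finType) (F : I -> set T) (c : R) :
  (forall i, measurable (F i)) -> (forall i, (P (F i) <= c%:E)%E) ->
  measurable (\big[setU/set0]_i F i) /\
  (P (\big[setU/set0]_i F i) <= (#|I|%:R * c)%:E)%E.
Proof.
move=> mF Fc; split; first by apply: bigsetU_measurable.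
have -> : #|I|%:R * c = \sum_(i : I) c by rewrite sumr_const mulr_natl.
rewrite -sumEFin.
suff : measurable (\big[setU/set0]_i F i) /\ (P (\big[setU/set0]_i F i) <= \sum_(i : I) c%:E)%E by move=> [_ ->].
apply: (big_ind2 (fun (A : set T) (x : \bar R) => measurable A /\ (P A <= x)%E)).
- by rewrite measure0.
- move=> A x B y [mA Ax] [mB By]; split; first exact: measurableU.
  by rewrite (le_trans (measureU2 _ mA mB)) // leeD.
- by move=> i _; split.
Qed.

Lemma bigsetI_finP (T : Type) (I : finType) (F : I -> set T) w :
  (\big[setI/setT]_i F i) w <-> forall i, F i w.
Proof.
rewrite -bigcap_seq; split => [H i|H i _]; last exact: H.
by apply: H; rewrite /= mem_index_enum.
Qed.

Lemma bigsetU_finP (T : Type) (I : finType) (F : I -> set T) w :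
  (\big[setU/set0]_i F i) w <-> exists i, F i w.
Proof.
rewrite -bigcup_seq; split => [[i _ Fi]|[i Fi]]; first by exists i.
by exists i; rewrite //= mem_index_enum.
Qed.

Section noise.
Context {R : realType} {dO : measure_display} {Om : measurableType dO}.
Variables (P : probability Om R) (n d : nat) (sigma : R).
Variable eps : 'I_n -> 'I_d -> Om -> R.
Hypothesis sigma0 : 0 < sigma.
Hypothesis noise : iid_gaussian_noise P sigma eps.

Let meas_eps i k : measurable_fun setT (eps i k).
Proof. by case: noise. Qed.

Lemma measurable_eps_preimage i k (B : set R) : measurable B -> measurable (eps i k @^-1` B).
Proof. by move=> mB; have := meas_eps i k measurableT mB; rewrite setTI. Qed.

Definition noise_box (B : 'I_n -> 'I_d -> set R) (i : 'I_n) : set Om :=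
  \big[setI/setT]_k (eps i k @^-1` B i k).

Lemma measurable_noise_box B i : (forall i k, measurable (B i k)) ->
  measurable (noise_box B i).
Proof. by move=> mB; apply: bigsetI_measurable => k _; exact: measurable_eps_preimage. Qed.

Lemma noise_boxP B i w : noise_box B i w <-> forall k, B i k (eps i k w).
Proof. exact: bigsetI_finP. Qed.

Lemma noise_box_indep (B : 'I_n -> 'I_d -> set R) (S : {set 'I_n}) :
  (forall i k, measurable (B i k)) ->
  P (\big[setI/setT]_(i in S) noise_box B i) =
  (\prod_(i in S) \prod_k normal_prob 0 sigma (B i k))%E.
Proof.
move=> mB; have [_ [gau ind]] := noise.
(* Indices outside [S] receive the whole line, which contributes factors equal to one. *)
pose B' i k := if i \in S then B i k else setT.
have mB' i k : measurable (B' i k) by rewrite /B'; case: ifP.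
have := ind B' mB'.
rewrite -(pair_bigA _ (fun i k => eps i k @^-1` B' i k)).
rewrite -(pair_bigA _ (fun i k => P (eps i k @^-1` B' i k))) /=.
rewrite [X in P X](_ : _ = \big[setI/setT]_(i in S) noise_box B i); last first.
  rewrite [RHS]big_mkcond /=; apply: eq_bigr => i _.
  rewrite /noise_box /B'; case: ifP => // _.
  by apply: big1 => k _; rewrite preimage_setT.
move=> ->; rewrite [RHS]big_mkcond /=; apply: eq_bigr => i _.
rewrite /B'; case: ifP => _; first by apply: eq_bigr => k _; rewrite gau.
by apply: big1 => k _; rewrite preimage_setT probability_setT.
Qed.

Lemma noise_box_prob (B : 'I_n -> 'I_d -> set R) i :
  (forall i k, measurable (B i k)) ->
  P (noise_box B i) = (\prod_k normal_prob 0 sigma (B i k))%E.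
Proof. by move=> mB; have := noise_box_indep [set i] mB; rewrite !big_set1. Qed.

Lemma noise_max_bound (U : R) : 0 <= U ->
  exists E : set Om, measurable E /\
    (P E <= ((n * d)%:R * (2 * expR (- (3 * U ^+ 2 / (8 * sigma ^+ 2)))))%:E)%E /\
    forall w, ~ E w -> forall i k, `|eps i k w| <= U.
Proof.
move=> U0; have [_ [gau _]] := noise.
pose B : set R := [set x | U < `|x|].
have mB : measurable B.
  rewrite (_ : B = setT `&` (fun x : R => `|x|) @^-1` `]U, +oo[); last first.
    by rewrite setTI; apply/seteqP; split => x; rewrite /B /= in_itv /= andbT.
  exact: normr_measurable.
pose F (ik : 'I_n * 'I_d) := eps ik.1 ik.2 @^-1` B.
have [] := @measure_bigsetU_le _ _ _ P _ F (2 * expR (- (3 * U ^+ 2 / (8 * sigma ^+ 2)))).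
- by move=> ik; exact: measurable_eps_preimage.
- move=> ik; rewrite /F gau // normal_probE // lee_fin; apply: gaussian_tail => //.
    by move=> x; rewrite indicE; case: (_ \in _); rewrite lexx ler01.
  by move=> x; rewrite indicE; case: (boolP (x \in B)) => [/set_mem xB _|]; [exact: ltW|rewrite eqxx].
rewrite card_prod !card_ord => mF PF.
exists (\big[setU/set0]_i F i); split=> //; split=> // w H i k.
rewrite leNgt; apply/negP => Bw; apply: H; apply/bigsetU_finP.
by exists (i, k).
Qed.

Variables (T : R) (K : nat).
Hypotheses (T0 : 0 < T) (K0 : (0 < K)%N).
Variable c : 'I_n -> 'rV[R]_d.

Definition cell_event (l : {ffun 'I_d -> 'I_K}) : 'I_n -> set Om :=
  noise_box (fun i k => shifted_cell T K (c i ord0 k) (l k)).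

(** A union bound over the [K ^ d] cells. The counts are sums of independent but not identically
    distributed indicators, since the centre [c i] varies with [i]. *)
Lemma cell_frequencies (t : R) : 0 < t <= 2 ->
  exists E : set Om, measurable E /\
    (P E <= ((K ^ d)%:R * (2 * expR (- (n%:R * t ^+ 2 / 8))))%:E)%E /\
    forall w, ~ E w -> forall l : {ffun 'I_d -> 'I_K},
    `|\sum_i \1_(cell_event l i) w - \sum_i \prod_k cell_prob sigma T K (c i ord0 k) (l k)|
      <= n%:R * t.
Proof.
move=> t02.
have mB (l : {ffun 'I_d -> 'I_K}) i k : measurable (shifted_cell T K (c i ord0 k) (l k)) by exact: measurable_shifted_cell.
have H (l : {ffun 'I_d -> 'I_K}) : exists B : set Om, measurable B /\
    (P B <= (2 * expR (- (n%:R * t ^+ 2 / 8)))%:E)%E /\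
    forall w, ~ B w -> `|\sum_i \1_(cell_event l i) w -
      \sum_i \prod_k cell_prob sigma T K (c i ord0 k) (l k)| <= n%:R * t.
  have [|S|B [mBB [PB Bw]]] := @chernoff_abs _ _ _ P n (cell_event l) _ _ t t02.
  - by move=> i; apply: measurable_noise_box => i' k; exact: (mB l i' k).
  - rewrite [cell_event l]/cell_event noise_box_indep; last exact: mB.
    by apply: eq_bigr => i _; rewrite noise_box_prob //; exact: mB.
  exists B; split=> //; split=> // w /Bw.
  congr (`|_ - _| <= _); apply: eq_bigr => i _.
  rewrite /cell_event noise_box_prob; last exact: mB.
  rewrite (eq_bigr (fun k => (cell_prob sigma T K (c i ord0 k) (l k))%:E)).
    by rewrite prodEFin.
  by move=> k _; rewrite fineK // fin_num_measure //; exact: measurable_shifted_cell.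
have [B HB] := choice H.
have [] := @measure_bigsetU_le _ _ _ P _ B (2 * expR (- (n%:R * t ^+ 2 / 8))).
- by move=> l; case: (HB l).
- by move=> l; case: (HB l) => _ [].
rewrite card_ffun !card_ord => mF PF.
exists (\big[setU/set0]_l B l); split=> //; split=> // w Hw l.
case: (HB l) => _ [_]; apply => Bl; apply: Hw; apply/bigsetU_finP.
by exists l.
Qed.

End noise.

(** * Comparison of the binned mixtures *)

Section information.
Variables (R : realType) (C : finType) (q qh pn : C -> R).
Variables A Lam delta tau s : R.
Hypotheses (q0 : forall c, 0 < q c) (qh0 : forall c, 0 < qh c).
Hypotheses (q1 : \sum_c q c <= 1) (qh1 : \sum_c qh c <= 1).
Hypothesis qtau : 1 - tau <= \sum_c q c.
Hypothesis loglik : - A <= \sum_c pn c * (ln (qh c) - ln (q c)).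
Hypothesis ratio : forall c, `|ln (qh c) - ln (q c)| <= Lam.
Hypothesis Lam0 : 0 <= Lam.
Hypothesis freq : \sum_c `|pn c - q c| <= delta.

Let a c := Num.sqrt (q c).
Let b c := Num.sqrt (qh c).
Let a0 c : 0 < a c. Proof. by rewrite sqrtr_gt0. Qed.
Let b0 c : 0 < b c. Proof. by rewrite sqrtr_gt0. Qed.
Let a2 c : a c ^+ 2 = q c. Proof. by rewrite sqr_sqrtr // ltW. Qed.
Let b2 c : b c ^+ 2 = qh c. Proof. by rewrite sqr_sqrtr // ltW. Qed.

(** Applying ln u <= u - 1 to the ratio b/a of square roots bounds q ln(qh/q) by qh - q - (a - b)^2.
    Replacing the empirical frequencies by [q] costs [Lam * delta], and the mass that [q] lacks
    costs [tau]. *)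
Lemma hellinger_le : \sum_c (a c - b c) ^+ 2 <= A + Lam * delta + tau.
Proof.
have H c : q c * (ln (qh c) - ln (q c)) <= qh c - q c - (a c - b c) ^+ 2.
  rewrite -a2 -b2 !lnXn // -mulrnBl -ln_div ?posrE //.
  have := @le_ln1Dx _ (b c / a c - 1); rewrite addrCA subrr addr0.
  have -> : -1 < b c / a c - 1 by have := divr_gt0 (b0 c) (a0 c); lra.
  move=> /(_ isT) le1.
  have : a c ^+ 2 * (ln (b c / a c) *+ 2) <= a c ^+ 2 * ((b c / a c - 1) *+ 2).
    by rewrite ler_wpM2l ?sqr_ge0 // lerMn2r le1.
  move/le_trans; apply; rewrite le_eqVlt; apply/orP; left; apply/eqP.
  by rewrite mulr2n; field; rewrite gt_eqF.
have S : \sum_c q c * (ln (qh c) - ln (q c)) <=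
    \sum_c qh c - \sum_c q c - \sum_c (a c - b c) ^+ 2.
  by rewrite -!sumrB; apply: ler_sum => c _.
have D : \sum_c pn c * (ln (qh c) - ln (q c)) - \sum_c q c * (ln (qh c) - ln (q c)) <= Lam * delta.
  rewrite -sumrB; apply: (@le_trans _ _ (\sum_c Lam * `|pn c - q c|)).
    apply: ler_sum => c _; rewrite -mulrBl (le_trans (ler_norm _)) // normrM mulrC.
    by rewrite ler_wpM2r.
  rewrite -mulr_sumr.
  by rewrite ler_wpM2l.
by move: S D loglik qtau qh1; lra.
Qed.

(** |q - qh| = |a - b|(a + b), split by Young's inequality with weight [s] and followed by (a + b)^2
    <= 2(q + qh); each half contributes [s]. *)
Lemma total_variation_le : 0 < s -> A + Lam * delta + tau <= s ^+ 2 ->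
  \sum_c `|q c - qh c| <= 2 * s.
Proof.
move=> s0 hs; have := le_trans hellinger_le hs => H.
apply: (@le_trans _ _ (\sum_c (s^-1 * (a c - b c) ^+ 2 + s / 2 * (q c + qh c)))).
  apply: ler_sum => c _; rewrite -a2 -b2 subr_sqr normrM (ger0_norm (_ : 0 <= a c + b c)) ?addr_ge0 ?(ltW (a0 _)) ?(ltW (b0 _)) //.
  rewrite -[(a c - b c) ^+ 2]real_normK ?num_real //.
  set x := `|_|; set y := a c + b c.
  have y2 : y ^+ 2 <= 2 * (a c ^+ 2 + b c ^+ 2).
    by rewrite /y; have := sqr_ge0 (a c - b c); rewrite sqrrB sqrrD; lra.
  have : s / 4 * y ^+ 2 <= s / 4 * (2 * (a c ^+ 2 + b c ^+ 2)).
    by rewrite ler_wpM2l // divr_ge0 // ltW.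
  have : 0 <= s^-1 * (x - s / 2 * y) ^+ 2 by rewrite mulr_ge0 ?sqr_ge0 // invr_ge0 ltW.
  have -> : s^-1 * (x - s / 2 * y) ^+ 2 = s^-1 * x ^+ 2 - x * y + s / 4 * y ^+ 2.
    by field; rewrite gt_eqF.
  lra.
rewrite big_split /= -!mulr_sumr big_split /=.
have h1 : s^-1 * \sum_c (a c - b c) ^+ 2 <= s.
  by rewrite ler_pdivrMl // -expr2.
have h2 : s / 2 * (\sum_c q c + \sum_c qh c) <= s / 2 * 2.
  by rewrite ler_wpM2l ?divr_ge0 ?(ltW s0) //; move: q1 qh1; lra.
lra.
Qed.

End information.

Section mixture_cells.
Variables (R : realType) (d : nat) (sigma T : R) (K : nat).
Hypotheses (sigma0 : 0 < sigma) (T0 : 0 < T) (K0 : (0 < K)%N).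
Local Notation w := (cell_prob sigma T K).
Local Notation eta := (cell_width T K).
Local Notation osc := (cell_osc sigma T K).
Local Notation g := (normal_pdf 0 sigma).

Definition mixture_cell_prob (p : nat) (beta : 'I_p -> R) (theta : 'I_p -> 'rV[R]_d)
  (l : {ffun 'I_d -> 'I_K}) : R := \sum_j beta j * \prod_k w (theta j ord0 k) (l k).

Lemma phi_prod (v : 'rV[R]_d) : phi sigma v = \prod_k g (v ord0 k).
Proof.
rewrite /phi; under eq_bigr do rewrite (normal_pdf0E sigma0).
rewrite big_split /= prodr_const card_ord; congr (_ * _).
by rewrite -expR_sum -mulr_suml -sumrN.
Qed.

Let expr_ord (c : R) : c ^+ d = \prod_(k < d) c.
Proof. by rewrite prodr_const card_ord. Qed.

Variables (p : nat) (beta : 'I_p -> R) (theta : 'I_p -> 'rV[R]_d).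
Hypotheses (beta0 : forall j, 0 <= beta j) (beta1 : \sum_j beta j = 1).
Hypothesis thetaT : forall j k, `|theta j ord0 k| <= T.
Local Notation m := (mixture_cell_prob beta theta).
Local Notation f y := (\sum_j beta j * phi sigma (y - theta j)).

Definition in_cell (y : 'rV[R]_d) (l : {ffun 'I_d -> 'I_K}) :=
  forall k, cell_bound T K (l k) <= y ord0 k <= cell_bound T K (l k).+1.

Lemma mixture_cell_prob_bounds (y : 'rV[R]_d) (l : {ffun 'I_d -> 'I_K}) : in_cell y l ->
  eta ^+ d * expR (- (d%:R * osc)) * f y <= m l <= eta ^+ d * expR (d%:R * osc) * f y.
Proof.
move=> yl; rewrite -mulrN !expRM_natl !mulr_sumr.
have eta0 := cell_width_gt0 T0 K0.
have H j : eta ^+ d * expR (- osc) ^+ d * phi sigma (y - theta j) <=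
    \prod_k w (theta j ord0 k) (l k) <=
    eta ^+ d * expR osc ^+ d * phi sigma (y - theta j).
  rewrite phi_prod -!exprMn !expr_ord -!big_split /=.
  apply/andP; split; apply: ler_prod => k _.
    have /andP[H1 H2] := cell_prob_bounds sigma0 T0 K0 (ltn_ord (l k)) (thetaT j k) (yl k).
    by rewrite !mxE -mulrA H1 andbT !mulr_ge0 ?normal_pdf_ge0 ?expR_ge0 // ltW.
  have /andP[H1 H2] := cell_prob_bounds sigma0 T0 K0 (ltn_ord (l k)) (thetaT j k) (yl k).
  by rewrite !mxE -mulrA H2 andbT cell_prob_ge0.
apply/andP; split; apply: ler_sum => j _; rewrite mulrCA ler_wpM2l //.
  by case/andP: (H j).
by case/andP: (H j).
Qed.

Let peak := (normal_peak sigma) ^+ d.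
Let decay := expR (- (d%:R * (9 * T ^+ 2 / (2 * sigma ^+ 2)))).

(** A point of the 2T box is within 3T of every atom in each coordinate. The resulting range of the
    log-density, of order T^2, becomes the bound [Lam] on the log-ratios. *)
Lemma mixture_density_bounds (y : 'rV[R]_d) : (forall k, `|y ord0 k| <= 2 * T) ->
  peak * decay <= f y <= peak.
Proof.
move=> yT.
have pk : 0 < normal_peak sigma by rewrite normal_peak_gt0 // gt_eqF.
have s2 : 0 < 2 * sigma ^+ 2 by rewrite mulr_gt0 // exprn_gt0.
have H j : peak * decay <= phi sigma (y - theta j) <= peak.
  rewrite phi_prod /peak /decay -mulrN expRM_natl -exprMn !expr_ord.
  apply/andP; split; apply: ler_prod => k _; last first.
    by rewrite normal_pdf_ge0 normal_pdf_ub // gt_eqF.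
  rewrite mulr_ge0 ?expR_ge0 ?(ltW pk) // normal_pdf0E // ler_pM2l // ler_expR.
  rewrite -[sigma ^+ 2 *+ 2]mulr_natl mulNr lerN2 ler_pM2r ?invr_gt0 // !mxE.
  rewrite -[X in X <= _]real_normK ?num_real //.
  have -> : 9 * T ^+ 2 = (3 * T) ^+ 2 by ring.
  rewrite lerXn2r ?nnegrE ?mulr_ge0 ?(ltW T0) //.
  apply: (le_trans (ler_normB _ _)); have := yT k; have := thetaT j k; lra.
have E c : c = \sum_j beta j * c by rewrite -mulr_suml beta1 mul1r.
apply/andP; split; [rewrite [leLHS]E|rewrite [leRHS]E]; apply: ler_sum => j _.
  by rewrite ler_wpM2l //; case/andP: (H j).
by rewrite ler_wpM2l //; case/andP: (H j).
Qed.

Lemma mixture_density_gt0 (y : 'rV[R]_d) : (forall k, `|y ord0 k| <= 2 * T) -> 0 < f y.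
Proof.
move=> /mixture_density_bounds /andP[H _]; apply: lt_le_trans H.
by rewrite mulr_gt0 ?expR_gt0 // exprn_gt0 // normal_peak_gt0 // gt_eqF.
Qed.

(** Every cell contains this point, so bounds on the density at a point of a cell turn into bounds
    on the cell probability itself. *)
Let corner (l : {ffun 'I_d -> 'I_K}) : 'rV[R]_d := \row_k cell_bound T K (l k).

Let corner_in l : in_cell (corner l) l.
Proof. by move=> k; rewrite mxE lexx cell_bound_le. Qed.

Lemma in_cell_le (y : 'rV[R]_d) l : in_cell y l -> forall k, `|y ord0 k| <= 2 * T.
Proof.
move=> yl k; rewrite ler_norml; have := yl k.
have := cell_bound_itv T0 K0 (ltn_ord (l k)); have := cell_bound_itv T0 K0 (ltnW (ltn_ord (l k))).
lra.
Qed.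

Lemma mixture_cell_prob_gt0 l : 0 < m l.
Proof.
have /andP[H _] := mixture_cell_prob_bounds (corner_in l); apply: lt_le_trans H.
rewrite !mulr_gt0 ?expR_gt0 ?exprn_gt0 ?cell_width_gt0 //.
exact/mixture_density_gt0/(in_cell_le (corner_in l)).
Qed.

Lemma ln_mixture_cell_prob (y : 'rV[R]_d) l : in_cell y l ->
  `|ln (m l) - (d%:R * ln eta + ln (f y))| <= d%:R * osc.
Proof.
move=> yl; have fy := mixture_density_gt0 (in_cell_le yl).
have eta0 := cell_width_gt0 T0 K0.
have lnE c : ln (eta ^+ d * expR c * f y) = d%:R * ln eta + c + ln (f y).
  have {}fy : 0 < f y := fy; move: (f y) fy eta0; generalize (eta) => e x x0 e0.
  by rewrite !lnM ?posrE ?mulr_gt0 ?expR_gt0 ?exprn_gt0 // lnXn // expRK mulr_natl.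
have /andP[H1 H2] := mixture_cell_prob_bounds yl.
have {}H1 : ln (eta ^+ d * expR (- (d%:R * osc)) * f y) <= ln (m l).
  by rewrite ler_ln ?posrE ?mixture_cell_prob_gt0 // !mulr_gt0 ?expR_gt0 ?exprn_gt0.
have {}H2 : ln (m l) <= ln (eta ^+ d * expR (d%:R * osc) * f y).
  by rewrite ler_ln ?posrE ?mixture_cell_prob_gt0 // !mulr_gt0 ?expR_gt0 ?exprn_gt0.
by move: H1 H2; rewrite !lnE ler_norml; lra.
Qed.

Lemma ln_mixture_cell_prob_range l :
  d%:R * ln eta + ln peak - d%:R * (9 * T ^+ 2 / (2 * sigma ^+ 2)) - d%:R * osc <= ln (m l) <=
  d%:R * ln eta + ln peak + d%:R * osc.
Proof.
have := ln_mixture_cell_prob (corner_in l).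
have yT := in_cell_le (corner_in l).
have fy := mixture_density_gt0 yT.
have /andP[H1 H2] := mixture_density_bounds yT.
have pk : 0 < peak by rewrite exprn_gt0 // normal_peak_gt0 // gt_eqF.
have {}H1 : ln (peak * decay) <= ln (f (corner l)) by rewrite ler_ln ?posrE ?mulr_gt0 ?expR_gt0.
have {}H2 : ln (f (corner l)) <= ln peak by rewrite ler_ln ?posrE.
by move: H1 H2; rewrite lnM ?posrE ?expR_gt0 // expRK ler_norml; lra.
Qed.

Lemma sum_mixture_cell_probE :
  \sum_l m l = \sum_j beta j * \prod_k \sum_(l < K) w (theta j ord0 k) l.
Proof.
rewrite exchange_big /=; apply: eq_bigr => j _; rewrite -mulr_sumr; congr (_ * _).
by rewrite bigA_distr_bigA.
Qed.

Lemma sum_mixture_cell_prob_le1 : \sum_l m l <= 1.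
Proof.
rewrite sum_mixture_cell_probE -{2}beta1; apply: ler_sum => j _.
rewrite -[leRHS]mulr1 ler_wpM2l // prodr_ile1 // => k.
rewrite sum_cell_prob_le1 // andbT sumr_ge0 // => l _; exact: cell_prob_ge0.
Qed.

Lemma sum_mixture_cell_prob_ge :
  1 - d%:R * (2 * expR (- (3 * T ^+ 2 / (8 * sigma ^+ 2)))) <= \sum_l m l.
Proof.
set tau := 2 * _.
rewrite sum_mixture_cell_probE.
(* A Bernoulli inequality; the induction also carries that the partial products stay in [0, 1]. *)
have prodge (F : 'I_d -> R) : (forall k, 1 - tau <= F k <= 1) -> (forall k, 0 <= F k) ->
    1 - d%:R * tau <= \prod_k F k.
  move=> HF F0.
  suff : 1 - d%:R * tau <= \prod_k F k <= 1 by case/andP.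
  have -> : d%:R * tau = \sum_(k < d) tau by rewrite sumr_const card_ord mulr_natl.
  apply/andP; split; last by apply: prodr_ile1 => k; rewrite F0; case/andP: (HF k).
  suff : 1 - \sum_(k < d) tau <= \prod_k F k /\ 0 <= \prod_k F k <= 1 by case.
  apply: (big_ind2 (fun x y => 1 - x <= y /\ 0 <= y <= 1)).
  - by rewrite subr0 lexx ler01.
  - move=> x y x' y' [h1 /andP[h2 h3]] [h4 /andP[h5 h6]]; split; last first.
      by rewrite mulr_ge0 // mulr_ile1.
    by nra.
  - by move=> k _; case/andP: (HF k) => h1 h2; rewrite F0 h1 h2.
have E c : c = \sum_j beta j * c by rewrite -mulr_suml beta1 mul1r.
rewrite [leLHS]E; apply: ler_sum => j _; rewrite ler_wpM2l //.
apply: prodge => k.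
  by rewrite sum_cell_prob_ge // sum_cell_prob_le1.
by apply: sumr_ge0 => l _; exact: cell_prob_ge0.
Qed.

End mixture_cells.

Section two_mixtures.
Variables (R : realType) (d : nat) (sigma T : R) (K : nat).
Hypotheses (sigma0 : 0 < sigma) (T0 : 0 < T) (K0 : (0 < K)%N).
Local Notation eta := (cell_width T K).
Local Notation osc := (cell_osc sigma T K).
Variables (p1 p2 : nat) (beta1 : 'I_p1 -> R) (beta2 : 'I_p2 -> R).
Variables (theta1 : 'I_p1 -> 'rV[R]_d) (theta2 : 'I_p2 -> 'rV[R]_d).
Hypotheses (beta1_ge0 : forall j, 0 <= beta1 j) (sum_beta1 : \sum_j beta1 j = 1).
Hypotheses (beta2_ge0 : forall j, 0 <= beta2 j) (sum_beta2 : \sum_j beta2 j = 1).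
Hypothesis theta1T : forall j k, `|theta1 j ord0 k| <= T.
Hypothesis theta2T : forall j k, `|theta2 j ord0 k| <= T.
Local Notation q1 := (mixture_cell_prob (K := K) sigma T beta1 theta1).
Local Notation q2 := (mixture_cell_prob (K := K) sigma T beta2 theta2).

Lemma ln_cell_ratio_le l :
  `|ln (q2 l) - ln (q1 l)| <= d%:R * (9 * T ^+ 2 / (2 * sigma ^+ 2)) + 2 * (d%:R * osc).
Proof.
have := ln_mixture_cell_prob_range sigma0 T0 K0 beta1_ge0 sum_beta1 theta1T l.
have := ln_mixture_cell_prob_range sigma0 T0 K0 beta2_ge0 sum_beta2 theta2T l.
by rewrite ler_norml; lra.
Qed.

(** The log-density at an observation and the log-probability of its cell differ by d ln [eta],
    common to both mixtures, up to an error d [osc]. The likelihood advantage of the second mixture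
    thus survives binning up to 2 d [osc]. *)
Lemma cell_loglik_ge (n : nat) (Y : 'I_n -> 'rV[R]_d)
    (ind : {ffun 'I_d -> 'I_K} -> 'I_n -> R) : (0 < n)%N ->
  (forall l i, 0 <= ind l i) -> (forall l i, ind l i != 0 -> in_cell T (Y i) l) ->
  (forall i, \sum_l ind l i = 1) ->
  \sum_i ln (\sum_j beta1 j * phi sigma (Y i - theta1 j)) <=
  \sum_i ln (\sum_j beta2 j * phi sigma (Y i - theta2 j)) ->
  - (2 * (d%:R * osc)) <=
  \sum_l (n%:R^-1 * \sum_i ind l i) * (ln (q2 l) - ln (q1 l)).
Proof.
move=> n0 ind0 indY ind1 lik.
set f1 := fun i => \sum_j beta1 j * phi sigma (Y i - theta1 j) in lik *.
set f2 := fun i => \sum_j beta2 j * phi sigma (Y i - theta2 j) in lik *.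
have n0' : 0 < n%:R :> R by rewrite ltr0n.
have -> : \sum_l (n%:R^-1 * \sum_i ind l i) * (ln (q2 l) - ln (q1 l)) =
    n%:R^-1 * \sum_i \sum_l ind l i * (ln (q2 l) - ln (q1 l)).
  rewrite exchange_big mulr_sumr /=; apply: eq_bigr => l _.
  by rewrite -mulrA mulr_suml.
rewrite ler_pdivlMl //.
apply: (@le_trans _ _ (\sum_i (ln (f2 i) - ln (f1 i) - 2 * (d%:R * osc)))).
  rewrite !sumrB sumr_const card_ord -mulr_natl mulrN.
  by move: lik; lra.
apply: ler_sum => i _.
have E c : c = \sum_l ind l i * c by rewrite -mulr_suml ind1 mul1r.
rewrite [leLHS]E; apply: ler_sum => l _.
have [->|/indY yl] := eqVneq (ind l i) 0; first by rewrite !mul0r.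
rewrite ler_wpM2l //.
have := ln_mixture_cell_prob sigma0 T0 K0 beta1_ge0 sum_beta1 theta1T yl.
have := ln_mixture_cell_prob sigma0 T0 K0 beta2_ge0 sum_beta2 theta2T yl.
by rewrite !ler_norml /f1 /f2 /=; lra.
Qed.

End two_mixtures.

Lemma prod_diff_le (R : realType) (I : finType) (a b : I -> R) (G e : R) :
  1 <= G -> (forall k, `|a k| <= G) -> (forall k, `|b k| <= G) ->
  (forall k, `|a k - b k| <= e) ->
  `|\prod_k a k - \prod_k b k| <= #|I|%:R * (G ^+ #|I| * e).
Proof.
move=> G1 aG bG abe.
(* A negative [e] is possible only when the index type is empty. *)
have [e0|e0] := leP 0 e; last first.
  have noI : forall k : I, False by move=> k; have := le_trans (normr_ge0 _) (abe k); lra.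
  have -> : #|I| = 0%N by apply: eq_card0 => k; case: (noI k).
  by rewrite !big1 ?subrr ?normr0 ?mul0r // => k; case: (noI k).
have G0 : 0 <= G by lra.
rewrite cardE -(size_map id) map_id -!big_enum /=.
elim: (enum I) => [|k s IH]; first by rewrite !big_nil subrr normr0 mul0r.
rewrite !big_cons /=.
have -> : a k * (\prod_(j <- s) a j) - b k * (\prod_(j <- s) b j) =
  a k * (\prod_(j <- s) a j - \prod_(j <- s) b j) + (a k - b k) * (\prod_(j <- s) b j) by ring.
apply: (le_trans (ler_normD _ _)); rewrite !normrM.
have bs : `|\prod_(j <- s) b j| <= G ^+ size s.
  elim: {IH} s => [|j s IH]; first by rewrite big_nil normr1.
  by rewrite big_cons normrM exprS ler_pM.
have h1 : `|a k| * `|\prod_(j <- s) a j - \prod_(j <- s) b j| <= G * ((size s)%:R * (G ^+ size s * e)).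
  by rewrite ler_pM.
have h2 : `|a k - b k| * `|\prod_(j <- s) b j| <= G * (G ^+ size s * e).
  have : `|a k - b k| * `|\prod_(j <- s) b j| <= e * G ^+ size s by rewrite ler_pM.
  have : 1 * (e * G ^+ size s) <= G * (e * G ^+ size s).
    by rewrite ler_wpM2r // mulr_ge0 ?exprn_ge0.
  by rewrite mul1r [G ^+ _ * e]mulrC; lra.
rewrite exprS -[(size s).+1]addn1 natrD mulrDl mul1r -mulrA.
apply: le_trans (lerD h1 h2) _.
by rewrite le_eqVlt; apply/orP; left; apply/eqP; ring.
Qed.

(** * Kernel means as functionals of the binned mixtures *)

Section kernel_means.
Variables (R : realType) (d : nat) (sigma T r : R) (K M : nat).
Hypotheses (sigma0 : 0 < sigma) (T0 : 0 < T) (K0 : (0 < K)%N) (M2 : (1 < M)%N) (r0 : 0 < r).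
Local Notation mu := (@lebesgue_measure R).
Local Notation g := (normal_pdf 0 sigma).
Local Notation w := (cell_prob sigma T K).
Local Notation eta := (cell_width T K).

Definition lattice_point (j : nat) : R := 2 * pi * j%:R / M.+1%:R.
Local Notation z := lattice_point.

(** Variance of the noise after division by [r]: Gaussian averaging multiplies frequency [m] by
    exp(- rho m^2 / 2). *)
Let rho : R := sigma ^+ 2 / r ^+ 2.
Let G : R := M%:R * expR (rho * M%:R ^+ 2 / 2).
Let tail : R := 2 * expR (- (3 * T ^+ 2 / (8 * sigma ^+ 2))).
Let err : R := G * (M%:R / r) * eta + G * tail.

Let rho0 : 0 <= rho. Proof. by rewrite divr_ge0 ?sqr_ge0. Qed.

Let F j (y : R) : R := trigker M rho (y / r - z j).

Let measurable_F j : measurable_fun setT (F j).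
Proof.
apply: measurable_funM => //; apply: measurable_sum => k; apply: measurable_sum => l.
apply: measurable_funM => //; apply: (measurableT_comp (f := @cos R)).
  by apply: continuous_measurable_fun; exact: continuous_cos.
apply: measurable_funM => //; apply: measurable_funB => //.
exact: measurable_funM.
Qed.

(** The amplification in [trigker M rho] cancels the damping of [gaussian_cos] frequency by
    frequency. The nonnegative kernel at an atom is thus the mean of a bounded function of the noisy
    observation: this is the deconvolution. *)
Lemma gaussian_trigker j theta :
  \int[mu]_x (F j (theta + x) * g x) = trigker M 0 (theta / r - z j).
Proof.
have icos (c a : R) : mu.-integrable setT (EFin \o (fun x => cos (c * x + a) * g x)).
  apply: (@integrable_mul_normal_pdf _ _ (fun x => cos (c * x + a)) 1); last by move=> x; exact: cos_max.
  apply: (measurableT_comp (f := @cos R)).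
    by apply: continuous_measurable_fun; exact: continuous_cos.
  by apply: measurable_funD => //; exact: measurable_funM.
pose h (kl : 'I_M * 'I_M) (x : R) : R := (fejer_mass R M)^-1 * (fejer_weight R M kl.1 * fejer_weight R M kl.2 *
   expR (rho * (kl.1%:R - kl.2%:R) ^+ 2 / 2)) *
   (cos ((kl.1%:R - kl.2%:R) / r * x + (kl.1%:R - kl.2%:R) * (theta / r - z j)) * g x).
have hE x : F j (theta + x) * g x = \sum_kl h kl x.
  rewrite /F /trigker pair_bigA /= -mulrA mulr_suml mulr_sumr; apply: eq_bigr => kl _.
  rewrite /h; rewrite [(kl.1%:R - kl.2%:R) * ((theta + x) / r - z j)](_ : _ =
    (kl.1%:R - kl.2%:R) / r * x + (kl.1%:R - kl.2%:R) * (theta / r - z j)); last first.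
    by field; rewrite gt_eqF.
  by set u := cos _; set v := expR _; ring.
have ih kl : mu.-integrable setT (EFin \o h kl).
  by have := integrableZl measurableT ((fejer_mass R M)^-1 * (fejer_weight R M kl.1 * fejer_weight R M kl.2 *
   expR (rho * (kl.1%:R - kl.2%:R) ^+ 2 / 2))) (icos ((kl.1%:R - kl.2%:R) / r) ((kl.1%:R - kl.2%:R) * (theta / r - z j))).
under eq_Rintegral do rewrite hE.
rewrite Rintegral_sum // trigker0E pair_bigA mulr_sumr /=; apply: eq_bigr => kl _.
rewrite RintegralZl // gaussian_cos //.
have : expR (rho * (kl.1%:R - kl.2%:R) ^+ 2 / 2) *
    expR (- (sigma ^+ 2 * ((kl.1%:R - kl.2%:R) / r) ^+ 2 / 2)) = 1.
  rewrite -expRD [X in expR X](_ : _ = 0) ?expR0 //.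
  by rewrite /rho exprMn; field; rewrite gt_eqF.
set e1 := expR _; set e2 := expR _; set u := cos _; set v := _^-1 => e12.
rewrite [LHS](_ : _ = v * (fejer_weight R M kl.1 * fejer_weight R M kl.2 * u) * (e1 * e2)); last by ring.
by rewrite e12 mulr1.
Qed.

Let G_ge0 : 0 <= G. Proof. by rewrite mulr_ge0 ?expR_ge0. Qed.

Let G_ge1 : 1 <= G.
Proof.
rewrite -[1]mulr1 ler_pM //; first by rewrite ler1n ltnW.
rewrite -[leLHS]expR0 ler_expR divr_ge0 // mulr_ge0 //.
Qed.

Let F_le j y : `|F j y| <= G.
Proof. by rewrite norm_trigker_le. Qed.

Let Q j theta := \sum_(l < K) F j (cell_bound T K l.+1) * w theta l.

Let Q_le j theta : `|Q j theta| <= G.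
Proof.
apply: (le_trans (ler_norm_sum _ _ _)).
apply: (@le_trans _ _ (\sum_(l < K) G * w theta l)).
  apply: ler_sum => l _; rewrite normrM (ger0_norm (cell_prob_ge0 _ _ _ _ _)).
  by rewrite ler_wpM2r ?cell_prob_ge0.
by rewrite -mulr_sumr -[leRHS]mulr1 ler_wpM2l // sum_cell_prob_le1.
Qed.

Let quadrature j (theta : R) : `|theta| <= T ->
  `|trigker M 0 (theta / r - z j) - Q j theta| <= err.
Proof.
move=> thT; rewrite -gaussian_trigker.
have FL x y : `|F j x - F j y| <= G * (M%:R / r) * `|x - y|.
  apply: (le_trans (trigker_lipschitz M2 _ _ rho0)).
  rewrite -/G [X in _ <= X](_ : _ = G * (M%:R * (`|x - y| / r))); last by ring.
  have -> : x / r - z j - (y / r - z j) = (x - y) / r by field; rewrite gt_eqF.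
  by rewrite normrM (ger0_norm (_ : 0 <= r^-1)) // invr_ge0 ltW.
have L0 : 0 <= G * (M%:R / r) by rewrite mulr_ge0 // divr_ge0 // ltW.
have H := gaussian_quadrature sigma T0 K0 theta (measurable_F j) (F_le j) FL L0.
apply: (le_trans H).
rewrite lerD2l ler_wpM2l //.
by have := sum_cell_prob_ge sigma0 T0 K0 thT; rewrite -/tail; lra.
Qed.

Definition kernel_prod (zz : {ffun 'I_d -> 'I_M.+1}) (x : 'rV[R]_d) : R :=
  \prod_k trigker M 0 (x ord0 k / r - z (zz k)).

Let test (zz : {ffun 'I_d -> 'I_M.+1}) (l : {ffun 'I_d -> 'I_K}) : R :=
  \prod_k F (zz k) (cell_bound T K (l k).+1).

Let kernel_prod_approx zz (x : 'rV[R]_d) : (forall k, `|x ord0 k| <= T) ->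
  `|kernel_prod zz x - \sum_l test zz l * \prod_k w (x ord0 k) (l k)| <= d%:R * (G ^+ d * err).
Proof.
move=> xT; have -> : \sum_l test zz l * \prod_k w (x ord0 k) (l k) = \prod_k Q (zz k) (x ord0 k).
  by rewrite bigA_distr_bigA; apply: eq_bigr => l _; rewrite -big_split.
have Gk k : `|trigker M 0 (x ord0 k / r - z (zz k))| <= G; first last.
  have := @prod_diff_le _ _ _ (fun k => Q (zz k) (x ord0 k)) G err G_ge1 Gk
    (fun k => Q_le _ _) (fun k => quadrature _ (xT k)).
  by rewrite card_ord.
apply: (le_trans (norm_trigker_le M2 _ (lexx 0))).
rewrite !mul0r expR0 mulr1 -[leLHS]mulr1 ler_wpM2l // -[leLHS]expR0 ler_expR.
by rewrite divr_ge0 // mulr_ge0.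
Qed.

(** Each mean is replaced by its quadrature, at the cost of one error term per mixture; the two
    quadratures integrate the same test function, bounded by [G ^+ d], against the two binned
    mixtures. *)
Lemma kernel_mean_diff (p1 p2 : nat) (beta1 : 'I_p1 -> R) (beta2 : 'I_p2 -> R)
    (theta1 : 'I_p1 -> 'rV[R]_d) (theta2 : 'I_p2 -> 'rV[R]_d) zz :
  (forall j, 0 <= beta1 j) -> \sum_j beta1 j = 1 ->
  (forall j, 0 <= beta2 j) -> \sum_j beta2 j = 1 ->
  (forall j k, `|theta1 j ord0 k| <= T) -> (forall j k, `|theta2 j ord0 k| <= T) ->
  `|\sum_j beta1 j * kernel_prod zz (theta1 j) - \sum_j beta2 j * kernel_prod zz (theta2 j)| <=
  2 * (d%:R * (G ^+ d * err)) + G ^+ d *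
    \sum_l `|mixture_cell_prob (K := K) sigma T beta1 theta1 l - mixture_cell_prob (K := K) sigma T beta2 theta2 l|.
Proof.
have approx (p : nat) (beta : 'I_p -> R) (theta : 'I_p -> 'rV[R]_d) :
    (forall j, 0 <= beta j) -> \sum_j beta j = 1 -> (forall j k, `|theta j ord0 k| <= T) ->
    `|\sum_j beta j * kernel_prod zz (theta j) - \sum_l test zz l * mixture_cell_prob (K := K) sigma T beta theta l| <=
    d%:R * (G ^+ d * err).
  move=> b0 b1 thT.
  have -> : \sum_l test zz l * mixture_cell_prob (K := K) sigma T beta theta l =
      \sum_j beta j * \sum_l test zz l * \prod_k w (theta j ord0 k) (l k).
    under eq_bigr do rewrite mulr_sumr.
    rewrite exchange_big /=; apply: eq_bigr => j _; rewrite mulr_sumr.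
    by apply: eq_bigr => l _; rewrite mulrCA.
  rewrite -sumrB; apply: (le_trans (ler_norm_sum _ _ _)).
  have E c : c = \sum_j beta j * c by rewrite -mulr_suml b1 mul1r.
  rewrite [leRHS]E; apply: ler_sum => j _.
  rewrite -mulrBr normrM (ger0_norm (b0 j)); apply: ler_wpM2l => //.
  by apply: kernel_prod_approx => k; exact: thT.
move=> b10 b11 b20 b21 t1 t2.
have := approx _ _ _ b10 b11 t1; have := approx _ _ _ b20 b21 t2.
set k1 := \sum_j _; set k2 := \sum_j beta1 j * _.
set s2 := \sum_l _; set s1 := \sum_l test zz l * mixture_cell_prob (K := K) sigma T beta1 theta1 l.
move=> H2 H1.
have H : `|s1 - s2| <= G ^+ d * \sum_l `|mixture_cell_prob (K := K) sigma T beta1 theta1 l - mixture_cell_prob (K := K) sigma T beta2 theta2 l|.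
  rewrite -sumrB mulr_sumr; apply: (le_trans (ler_norm_sum _ _ _)); apply: ler_sum => l _.
  rewrite -mulrBr normrM ler_wpM2r //.
  have -> : G ^+ d = \prod_(k < d) G by rewrite prodr_const card_ord.
  rewrite normr_prod; apply: ler_prod => k _.
  by rewrite normr_ge0 F_le.
have -> : k2 - k1 = (k2 - s1) + (s1 - s2) - (k1 - s2) by ring.
apply: (le_trans (ler_normB _ _)).
have := ler_normD (k2 - s1) (s1 - s2); lra.
Qed.

End kernel_means.

(** * Deconvolution *)

Section kernel_coupling.
Variables (R : realType) (d M : nat) (r : R).
Hypotheses (M2 : (1 < M)%N) (r0 : 0 < r).
Local Notation N := (M.+1%:R : R).
Local Notation kp := (kernel_prod r (M := M)).
Local Notation z j := (lattice_point R M j).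

Let N0 : N != 0. Proof. by rewrite pnatr_eq0. Qed.

Lemma sum_kernel_prod (x : 'rV[R]_d) : \sum_zz kp zz x = N ^+ d.
Proof.
rewrite /kernel_prod -(bigA_distr_bigA (fun k (j : 'I_M.+1) => trigker M 0 (x ord0 k / r - z j))).
rewrite (eq_bigr (fun=> N)) ?prodr_const ?card_ord // => k _.
exact: sum_trigker0.
Qed.

Lemma sum_kernel_prod_cos (x : 'rV[R]_d) (k0 : 'I_d) :
  \sum_zz kp zz x * (1 - cos (x ord0 k0 / r - z (zz k0))) = N ^+ d * (1 - cos (pi / M%:R)).
Proof.
pose h k (j : 'I_M.+1) := if k == k0 then 1 - cos (x ord0 k0 / r - z j) else 1.
pose t k (j : 'I_M.+1) := trigker M 0 (x ord0 k / r - z j).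
have -> : \sum_zz kp zz x * (1 - cos (x ord0 k0 / r - z (zz k0))) =
    \sum_(zz : {ffun 'I_d -> 'I_M.+1}) \prod_k (t k (zz k) * h k (zz k)).
  apply: eq_bigr => zz _; rewrite big_split /=; congr (_ * _).
  rewrite (bigD1 k0) //= /h eqxx big1 ?mulr1 // => k /negbTE kk0.
  by rewrite kk0.
rewrite -(bigA_distr_bigA (fun k j => t k j * h k j)) (bigD1 k0) //=.
rewrite [X in _ * X](eq_bigr (fun=> N)) => [|k /negbTE kk0]; last first.
  rewrite -[RHS](sum_trigker0 M2 (x ord0 k / r)); apply: eq_bigr => j _.
  by rewrite /h kk0 mulr1.
have -> : \sum_j t k0 j * h k0 j = N * (1 - cos (pi / M%:R)).
  by rewrite -(sum_trigker0_cos M2 (x ord0 k0 / r)); apply: eq_bigr => j _; rewrite /h eqxx.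
rewrite mulrAC; congr (_ * _).
transitivity (\prod_(k < d) N); first by rewrite [RHS](bigD1 k0).
by rewrite prodr_const card_ord.
Qed.

Lemma kernel_prod_ge0 zz (x : 'rV[R]_d) : 0 <= kp zz x.
Proof. by apply: prodr_ge0 => k _; exact: trigker0_ge0. Qed.

(** Both measures are moved to the lattice by the normalised kernel and coupled there by
    [coupling_of_kernels]. The cost is a sum of 1 - cos, comparable to the squared distance because
    differences divided by [r] are at most 1. *)
Lemma coupling_of_kernel_means (n p : nat) (alpha : 'I_p -> R) (x : 'I_n -> 'rV[R]_d)
    (theta : 'I_p -> 'rV[R]_d) (Delta : R) : (0 < n)%N ->
  (forall j, 0 <= alpha j) -> \sum_j alpha j = 1 ->
  (forall i j k, `|theta j ord0 k - x i ord0 k| <= r) ->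
  (forall zz, `|\sum_i n%:R^-1 * kp zz (x i) - \sum_j alpha j * kp zz (theta j)| <= Delta) ->
  exists2 H : 'M[R]_(n, p), is_coupling alpha H &
    \sum_i \sum_j H i j * sqnorm (theta j - x i) <=
    r ^+ 2 * (2 / cos 1 ^+ 2) * (32 * d%:R / M%:R ^+ 2 + 2 * d%:R * Delta).
Proof.
move=> n0 a0 a1 xr D.
have n0' : 0 < n%:R :> R by rewrite ltr0n.
have Nd : 0 < N ^+ d by rewrite exprn_gt0.
have kN zz (y : 'rV[R]_d) : 0 <= kp zz y / N ^+ d by apply: divr_ge0; [exact: kernel_prod_ge0|exact: ltW].
have skN (y : 'rV[R]_d) : \sum_zz kp zz y / N ^+ d = 1.
  by rewrite -mulr_suml sum_kernel_prod mulfV // gt_eqF.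
pose a i zz := n%:R^-1 * (kp zz (x i) / N ^+ d).
pose b j zz := alpha j * (kp zz (theta j) / N ^+ d).
pose c i j := \sum_k (1 - cos ((theta j ord0 k - x i ord0 k) / r)).
pose u (y : 'rV[R]_d) (zz : {ffun 'I_d -> 'I_M.+1}) := \sum_k 2 * (1 - cos (y ord0 k / r - z (zz k))).
have cos1 t : 0 <= 1 - cos t :> R by rewrite subr_ge0 cos_le1.
have u0 y zz : 0 <= u y zz by apply: sumr_ge0 => k _; rewrite mulr_ge0.
have cu i j zz : c i j <= u (x i) zz + u (theta j) zz.
  rewrite /u -big_split /=; apply: ler_sum => k _; rewrite addrC.
  have -> : (theta j ord0 k - x i ord0 k) / r =
    (theta j ord0 k / r - z (zz k)) - (x i ord0 k / r - z (zz k)) by ring.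
  exact: sub1cosB_le.
have c2 i j : c i j <= 2 * d%:R.
  have -> : 2 * d%:R = \sum_(k < d) 2 :> R by rewrite sumr_const card_ord mulr_natr.
  by apply: ler_sum => k _; have := cos_geN1 ((theta j ord0 k - x i ord0 k) / r); lra.
have sa i : \sum_zz a i zz = n%:R^-1 by rewrite -mulr_sumr skN mulr1.
have sb j : \sum_zz b j zz = alpha j by rewrite -mulr_sumr skN mulr1.
have a0' i zz : 0 <= a i zz by rewrite mulr_ge0 // invr_ge0 ltW.
have b0' j zz : 0 <= b j zz by rewrite mulr_ge0.
have d2 : 0 <= 2 * d%:R :> R by rewrite mulr_ge0.
have [H cH leH] := coupling_of_kernels n0 a1 a0' b0' sa sb (fun i zz => u0 (x i) zz)
  (fun j zz => u0 (theta j) zz) cu c2 d2.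
exists H => //.
have c1 : 0 < cos 1 ^+ 2 :> R by rewrite exprn_gt0 // cos1_gt0.
have sq i j : sqnorm (theta j - x i) <= r ^+ 2 * (2 / cos 1 ^+ 2) * c i j.
  rewrite /sqnorm /c mulr_sumr; apply: ler_sum => k _; rewrite !mxE.
  have := @sub1cos_ge _ ((theta j ord0 k - x i ord0 k) / r).
  rewrite normrM (ger0_norm (_ : 0 <= r^-1)) ?invr_ge0 ?(ltW r0) // ler_pdivrMr // mul1r => /(_ (xr i j k)) h.
  have -> : (theta j ord0 k - x i ord0 k) ^+ 2 = r ^+ 2 * (2 / cos 1 ^+ 2) *
      (cos 1 ^+ 2 / 2 * ((theta j ord0 k - x i ord0 k) / r) ^+ 2).
    by field; rewrite !gt_eqF ?cos1_gt0.
  by rewrite ler_wpM2l // mulr_ge0 ?sqr_ge0 // divr_ge0 // ltW.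
apply: (@le_trans _ _ (\sum_i \sum_j H i j * (r ^+ 2 * (2 / cos 1 ^+ 2) * c i j))).
  by apply: ler_sum => i _; apply: ler_sum => j _; rewrite ler_wpM2l //; case: cH.
have -> : \sum_i \sum_j H i j * (r ^+ 2 * (2 / cos 1 ^+ 2) * c i j) =
    r ^+ 2 * (2 / cos 1 ^+ 2) * \sum_i \sum_j H i j * c i j.
  rewrite mulr_sumr; apply: eq_bigr => i _; rewrite mulr_sumr; apply: eq_bigr => j _.
  by rewrite mulrCA.
apply: ler_wpM2l; first by rewrite mulr_ge0 ?sqr_ge0 // divr_ge0 // ltW.
apply: (le_trans leH).
have uE (y : 'rV[R]_d) : \sum_zz kp zz y / N ^+ d * u y zz = 2 * d%:R * (1 - cos (pi / M%:R)).
  transitivity (\sum_(k < d) 2 * (1 - cos (pi / M%:R)) : R); last first.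
    by rewrite sumr_const card_ord -mulr_natl; ring.
  rewrite /u; under eq_bigr do rewrite mulr_sumr.
  rewrite exchange_big /=; apply: eq_bigr => k _.
  rewrite [LHS](_ : _ = 2 / N ^+ d * \sum_zz kp zz y * (1 - cos (y ord0 k / r - z (zz k)))).
    by rewrite sum_kernel_prod_cos; field; rewrite gt_eqF.
  by rewrite mulr_sumr; apply: eq_bigr => zz _; ring.
(* From 1 - cos x <= x^2/2 and pi <= 4. Each of the two marginals pays this amount, whence the 32 of
   the statement. *)
have small : 2 * d%:R * (1 - cos (pi / M%:R)) <= 16 * d%:R / M%:R ^+ 2 :> R.
  have M0 : 0 < M%:R :> R by rewrite ltr0n ltnW.
  have : 1 - cos (pi / M%:R) <= 8 / M%:R ^+ 2 :> R.
    apply: (le_trans (sub1cos_le _)); rewrite exprMn exprVn mulrAC.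
    rewrite ler_pM2r ?invr_gt0 ?exprn_gt0 // ler_pdivrMr // -[8 * 2](_ : 4 ^+ 2 = _ :> R); last by ring.
    rewrite lerXn2r ?nnegrE ?pi_ge0 //.
    by have := @pihalf_lt2 R; lra.
  move=> h; have : 2 * d%:R * (1 - cos (pi / M%:R)) <= 2 * d%:R * (8 / M%:R ^+ 2) :> R by rewrite ler_wpM2l.
  by move/le_trans; apply; rewrite le_eqVlt; apply/orP; left; apply/eqP; ring.
have E1 : \sum_i \sum_zz a i zz * u (x i) zz = 2 * d%:R * (1 - cos (pi / M%:R)).
  transitivity (\sum_(i < n) n%:R^-1 * (2 * d%:R * (1 - cos (pi / M%:R))) : R).
    apply: eq_bigr => i _; rewrite -(uE (x i)) mulr_sumr; apply: eq_bigr => zz _.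
    by rewrite /a -mulrA.
  by rewrite -mulr_suml sumr_const card_ord -[_ *+ n]mulr_natl mulfV ?mul1r // gt_eqF.
have E2 : \sum_j \sum_zz b j zz * u (theta j) zz = 2 * d%:R * (1 - cos (pi / M%:R)).
  transitivity (\sum_j alpha j * (2 * d%:R * (1 - cos (pi / M%:R)))).
    apply: eq_bigr => j _; rewrite -(uE (theta j)) mulr_sumr; apply: eq_bigr => zz _.
    by rewrite /b -mulrA.
  by rewrite -mulr_suml a1 mul1r.
(* Each of the [N ^+ d] lattice points carries a discrepancy of at most [Delta] divided by
   [N ^+ d]. *)
have E3 : \sum_zz `|\sum_i a i zz - \sum_j b j zz| <= Delta.
  apply: (@le_trans _ _ (\sum_(zz : {ffun 'I_d -> 'I_M.+1}) Delta / N ^+ d)); last first.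
    rewrite sumr_const card_ffun !card_ord -[_ *+ (_ ^ _)]mulr_natr natrX.
    by rewrite divfK // gt_eqF.
  apply: ler_sum => zz _.
  have -> : \sum_i a i zz - \sum_j b j zz =
      (\sum_i n%:R^-1 * kp zz (x i) - \sum_j alpha j * kp zz (theta j)) / N ^+ d.
    rewrite mulrBl !mulr_suml; by congr (_ - _); apply: eq_bigr => i _; exact: mulrA.
  by rewrite normrM (ger0_norm (_ : 0 <= (N ^+ d)^-1)) ?ler_wpM2r ?invr_ge0 ?(ltW Nd).
rewrite E1 E2; apply: lerD; last by rewrite ler_wpM2l.
have -> : 32 * d%:R / M%:R ^+ 2 = 16 * d%:R / M%:R ^+ 2 + 16 * d%:R / M%:R ^+ 2 :> R by ring.
exact: lerD.
Qed.

End kernel_coupling.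

(** * Deterministic bound for a fixed sample *)

Section deterministic.
Variables (R : realType) (n d p : nat) (sigma T : R) (K M : nat).
Hypotheses (n0 : (0 < n)%N) (sigma0 : 0 < sigma) (T0 : 0 < T).
Hypotheses (K0 : (0 < K)%N) (M2 : (1 < M)%N).
Variables (c : 'I_n -> 'rV[R]_d) (Y : 'I_n -> 'rV[R]_d).
Variables (alpha : 'I_p -> R) (theta : 'I_p -> 'rV[R]_d).
Variable ind : {ffun 'I_d -> 'I_K} -> 'I_n -> R.
Variables t s : R.
Hypothesis mle : is_NPMLE sigma Y alpha theta.
Hypothesis cT : forall i k, `|c i ord0 k| <= T.
Hypothesis YT : forall i k, `|Y i ord0 k| <= T.
Hypothesis ind0 : forall l i, 0 <= ind l i.
Hypothesis ind_cell : forall l i, ind l i != 0 -> in_cell T (Y i) l.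
Hypothesis ind1 : forall i, \sum_l ind l i = 1.
Hypothesis freq : forall l,
  `|\sum_i ind l i - \sum_i \prod_k cell_prob sigma T K (c i ord0 k) (l k)| <= n%:R * t.
Local Notation osc := (cell_osc sigma T K).
Local Notation tail := (2 * expR (- (3 * T ^+ 2 / (8 * sigma ^+ 2)))).
Hypothesis s0 : 0 < s.
Hypothesis s_ge :
  2 * (d%:R * osc) + (d%:R * (9 * T ^+ 2 / (2 * sigma ^+ 2)) + 2 * (d%:R * osc)) * (K%:R ^+ d * t) +
  d%:R * tail <= s ^+ 2.
Let G : R := M%:R * expR (sigma ^+ 2 / (2 * T) ^+ 2 * M%:R ^+ 2 / 2).

(** The competitor in the likelihood is the true mixing measure, uniform on the [c i]. The radius is
    2T because centres and atoms both lie in the box of half-side [T]. *)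
Lemma deterministic_coupling :
  exists2 H : 'M[R]_(n, p), is_coupling alpha H &
    \sum_i \sum_j H i j * sqnorm (theta j - c i) <=
    (2 * T) ^+ 2 * (2 / cos 1 ^+ 2) * (32 * d%:R / M%:R ^+ 2 + 2 * d%:R *
      (2 * (d%:R * (G ^+ d * (G * (M%:R / (2 * T)) * cell_width T K + G * tail))) + G ^+ d * (2 * s))).
Proof.
have n0' : 0 < n%:R :> R by rewrite ltr0n.
have [a0 [a1 _]] := mle.
have a0' j : 0 <= alpha j by rewrite ltW.
have thT : forall j k, `|theta j ord0 k| <= T := NPMLE_atoms_in_box sigma0 mle n0 YT.
pose beta (i : 'I_n) : R := n%:R^-1.
have b0 i : 0 <= beta i by rewrite invr_ge0 ltW.
have b1 : \sum_i beta i = 1.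
  by rewrite sumr_const card_ord -[_ *+ n]mulr_natl mulfV // gt_eqF.
have r0 : 0 < 2 * T by rewrite mulr_gt0.
have osc0 : 0 <= d%:R * osc.
  by rewrite mulr_ge0 // divr_ge0 ?sqr_ge0 // mulr_ge0 ?(ltW (cell_width_gt0 T0 K0)) // mulr_ge0 // ltW.
pose q1 := mixture_cell_prob (K := K) sigma T beta c.
pose q2 := mixture_cell_prob (K := K) sigma T alpha theta.
have TV : \sum_l `|q1 l - q2 l| <= 2 * s.
  apply: (total_variation_le (pn := fun l => n%:R^-1 * \sum_i ind l i)
    (A := 2 * (d%:R * osc)) (Lam := d%:R * (9 * T ^+ 2 / (2 * sigma ^+ 2)) + 2 * (d%:R * osc))
    (delta := K%:R ^+ d * t) (tau := d%:R * tail)) => //.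
  - by move=> l; exact: mixture_cell_prob_gt0.
  - by move=> l; exact: mixture_cell_prob_gt0.
  - exact: sum_mixture_cell_prob_le1.
  - exact: sum_mixture_cell_prob_le1.
  - exact: sum_mixture_cell_prob_ge.
  - exact: (cell_loglik_ge sigma0 T0 K0 b0 b1 a0' a1 cT thT n0 ind0 ind_cell ind1
      (NPMLE_ge_atomic mle c b0 b1)).
  - by move=> l; exact: ln_cell_ratio_le.
  - by apply: addr_ge0; apply: mulr_ge0 => //; apply: divr_ge0; apply: mulr_ge0 => //; exact: sqr_ge0.
  - have -> : K%:R ^+ d * t = \sum_(l : {ffun 'I_d -> 'I_K}) t.
      by rewrite sumr_const card_ffun !card_ord -[_ *+ (_ ^ _)]mulr_natl natrX.
    apply: ler_sum => l _.
    rewrite /q1 /mixture_cell_prob /beta -mulr_sumr -mulrBr normrM ger0_norm ?invr_ge0 ?(ltW n0') //.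
    by rewrite ler_pdivrMl.
have r1 (i : 'I_n) (j : 'I_p) (k : 'I_d) : `|theta j ord0 k - c i ord0 k| <= 2 * T.
  by apply: (le_trans (ler_normB _ _)); have := thT j k; have := cT i k; lra.
apply: (coupling_of_kernel_means M2 r0 n0 a0' a1 r1) => zz.
apply: (le_trans (kernel_mean_diff sigma0 T0 K0 M2 r0 zz b0 b1 a0' a1 cT thT)).
rewrite -/G lerD2l ler_wpM2l // exprn_ge0 // mulr_ge0 ?expR_ge0 //.
Qed.

End deterministic.

(** * Choice of the parameters *)

Lemma expr_le_expR (R : realType) (a l : R) (k : nat) : 0 < a -> 0 <= l ->
  l ^+ k <= (k.+1`!%:R / a ^+ k) * expR (a * l).
Proof.
move=> a0 l0; have al0 : 0 <= a * l by rewrite mulr_ge0 // ltW.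
have f0 : 0 < k.+1`!%:R :> R by rewrite ltr0n fact_gt0.
have : (a * l) ^+ k <= k.+1`!%:R * expR (a * l).
  case: k f0 => [|k] f0; first by rewrite expr0 mul1r -[leLHS]expR0 ler_expR.
  have := expR_ge1Dxn k al0; set e := expR _ => H.
  have g0 : 0 < k.+1`!%:R :> R by rewrite ltr0n fact_gt0.
  have : (a * l) ^+ k.+1 / k.+1`!%:R <= e by lra.
  rewrite ler_pdivrMr // [e * _]mulrC => /le_trans; apply.
  by rewrite ler_wpM2r ?expR_ge0 // ler_nat [leqRHS]factS leq_pmull.
rewrite exprMn mulrAC ler_pdivlMr ?exprn_gt0 // mulrC.
by [].
Qed.

Section parameters.
Variables (R : realType) (d : nat) (sigma tau : R).
Hypotheses (d0 : (0 < d)%N) (sigma0 : 0 < sigma) (tau_ge : 3 * sigma <= tau).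
Local Notation D := (d%:R : R).

Let D1 : 1 <= D. Proof. by rewrite ler1n. Qed.
Let D0 : 0 < D. Proof. exact: lt_le_trans D1. Qed.
Let tau0 : 0 < tau. Proof. by have := sigma0; move: tau_ge; lra. Qed.

(** Here [l] stands for log n, so [K] is about n^(1/(8d)). With frequency tolerance t = K^(-2d), n
    t^2 is at least sqrt n, enough for the union bound over the cells. *)
Definition num_cells (l : R) : nat := Num.truncn (expR (l / (8 * D))).
(** At M = kap l and radius 2T the amplification exponent sigma^2 M^2 / (8 T^2) equals l / (512
    d^2), small against the gain l / (16 d) even after d + 1 factors. *)
Definition degree_rate : R := tau / (8 * sigma * D).
(** The shift by two gives both 1 < M and kap l <= M. *)
Definition num_freqs (l : R) : nat := (Num.truncn (degree_rate * l)).+2.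
Definition box_radius (l : R) : R := tau * Num.sqrt l.

Local Notation K := num_cells.
Local Notation M := num_freqs.
Local Notation T := box_radius.
Local Notation kap := degree_rate.

Let tail (l : R) : R := 2 * expR (- (3 * T l ^+ 2 / (8 * sigma ^+ 2))).

Variable l : R.
Hypothesis l1 : 1 <= l.
Let l0 : 0 < l. Proof. exact: lt_le_trans l1. Qed.

Lemma box_radius_gt0 : 0 < T l.
Proof. by rewrite mulr_gt0 // sqrtr_gt0. Qed.

Lemma sqr_box_radius : T l ^+ 2 = tau ^+ 2 * l.
Proof. by rewrite exprMn sqr_sqrtr // ltW. Qed.

(** n^(-1/(16d)): its square is 1/K up to a factor 2, and the total variation bound is of order l
    [h]. *)
Let h : R := expR (- (l / (16 * D))).

Let h_sqr : h ^+ 2 = expR (- (l / (8 * D))).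
Proof. by rewrite /h -expRM_natl; congr expR; field; rewrite gt_eqF. Qed.

Let h01 : 0 < h <= 1.
Proof. by rewrite expR_gt0 -[leRHS]expR0 ler_expR oppr_le0 divr_ge0 // ?mulr_ge0 // ltW. Qed.

Lemma num_cells_le : (K l)%:R <= expR (l / (8 * D)).
Proof. by rewrite truncn_le expR_ge0. Qed.

Lemma num_cells_gt0 : (0 < K l)%N.
Proof.
rewrite truncn_gt0 -[leLHS]expR0 ler_expR divr_ge0 // ?mulr_ge0 //; exact: ltW.
Qed.

Let K0 : 0 < (K l)%:R :> R. Proof. by rewrite ltr0n num_cells_gt0. Qed.

Let invK_le : (K l)%:R^-1 <= 2 * h ^+ 2.
Proof.
rewrite h_sqr expRN -[leLHS]mul1r ler_pdivrMr // mulrAC ler_pdivlMr ?expR_gt0 // mul1r.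
apply: (le_trans (ltW (truncnS_gt _))); rewrite -/(K l) -natr1.
have : 1 <= (K l)%:R :> R by rewrite ler1n num_cells_gt0.
lra.
Qed.

Let invK_ge : h ^+ 2 <= (K l)%:R^-1.
Proof. by rewrite h_sqr expRN lef_pV2 ?posrE ?expR_gt0 // num_cells_le. Qed.

Let invK1 : (K l)%:R^-1 <= 1 :> R.
Proof. by rewrite invf_le1 // ler1n num_cells_gt0. Qed.

Lemma num_cells_exp : (K l)%:R ^+ (8 * d) <= expR l.
Proof.
have -> : expR l = expR (l / (8 * D)) ^+ (8 * d).
  by rewrite -expRM_natl natrM; congr expR; field; rewrite gt_eqF.
by rewrite lerXn2r ?nnegrE ?expR_ge0 // num_cells_le.
Qed.

Lemma tail_le_exp : tail l <= 2 * expR (- (3 * l)).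
Proof.
rewrite ler_wpM2l // ler_expR lerN2 sqr_box_radius.
have s2 : 0 < sigma ^+ 2 by rewrite exprn_gt0.
rewrite ler_pdivlMr ?mulr_gt0 //.
have t2 : (3 * sigma) ^+ 2 <= tau ^+ 2.
  by rewrite lerXn2r ?nnegrE ?mulr_ge0 ?(ltW sigma0) ?(ltW tau0).
have : 9 * sigma ^+ 2 * l <= tau ^+ 2 * l.
  by rewrite ler_wpM2r ?(ltW l0) //; move: t2; rewrite exprMn; lra.
have : 0 <= sigma ^+ 2 * l by rewrite mulr_ge0 ?ltW.
lra.
Qed.

Let tail_le : tail l <= 2 * h ^+ 2.
Proof.
apply: (le_trans tail_le_exp); rewrite ler_wpM2l // h_sqr ler_expR lerN2.
rewrite ler_pdivrMr ?mulr_gt0 //.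
have : l * 1 <= l * D by rewrite ler_wpM2l // ltW.
by move: D1 l0; nra.
Qed.

(** The 48 is 24 + 24, from the two occurrences of the oscillation in [tv_bound_ge]; 9/2 comes from
    the range of the log-density and 2 from the Gaussian tail. *)
Definition tv_rate : R := D * (48 * (tau ^+ 2 / sigma ^+ 2) + 9 / 2 * (tau ^+ 2 / sigma ^+ 2) + 2).

Definition tv_bound : R := Num.sqrt (tv_rate * l / (K l)%:R).

Let ts0 : 0 < tau ^+ 2 / sigma ^+ 2. Proof. by rewrite divr_gt0 ?exprn_gt0. Qed.

Let tv_rate_gt0 : 0 < tv_rate.
Proof. by rewrite mulr_gt0 //; move: ts0; lra. Qed.

Lemma tv_bound_gt0 : 0 < tv_bound.
Proof. by rewrite sqrtr_gt0 divr_gt0 // mulr_gt0. Qed.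

Lemma tv_bound_ge (osc := cell_osc sigma (T l) (K l)) :
  2 * (D * osc) + (D * (9 * T l ^+ 2 / (2 * sigma ^+ 2)) + 2 * (D * osc)) *
    ((K l)%:R ^+ d * ((K l)%:R ^+ (2 * d))^-1) + D * tail l <= tv_bound ^+ 2.
Proof.
rewrite /tv_bound sqr_sqrtr; last by rewrite divr_ge0 // mulr_ge0 // ltW.
have [x xE x0] : exists2 x : R, x = tau ^+ 2 / sigma ^+ 2 & 0 < x by exists (tau ^+ 2 / sigma ^+ 2).
have [k kE k0] : exists2 k : R, k = (K l)%:R^-1 & 0 < k by exists (K l)%:R^-1; rewrite ?invr_gt0.
have k1 : k <= 1 by rewrite kE.
have kh : h ^+ 2 <= k by rewrite kE.
have oscE : osc = 12 * x * l * k.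
  rewrite /osc /cell_osc /cell_width mulrA [3 * T l * _](_ : _ = 12 * T l ^+ 2); last by ring.
  by rewrite sqr_box_radius xE kE; field; rewrite !gt_eqF.
have e9 : 9 * T l ^+ 2 / (2 * sigma ^+ 2) = 9 / 2 * x * l.
  by rewrite sqr_box_radius xE; field; rewrite !gt_eqF.
rewrite oscE e9.
(* Summing the tolerance K^(-2d) over K^d cells leaves K^(-d), at most 1/K. *)
have Kd : (K l)%:R ^+ d * ((K l)%:R ^+ (2 * d))^-1 <= k.
  have Kd0 : 0 < (K l)%:R ^+ d :> R by rewrite exprn_gt0.
  rewrite mulnC exprM [in X in X <= _]expr2 invfM mulrA mulfV ?mul1r ?gt_eqF //.
  rewrite kE.
  by rewrite lef_pV2 ?posrE // -[leLHS]expr1 ler_weXn2l // ler1n num_cells_gt0.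
set y := _ * _^-1 in Kd *.
have y0 : 0 <= y by rewrite mulr_ge0 ?invr_ge0 ?exprn_ge0 // ltW.
have A0 : 0 <= D * (9 / 2 * x * l) + 2 * (D * (12 * x * l * k)).
  by apply: addr_ge0; do !apply: mulr_ge0; rewrite ?invr_ge0 //; exact: ltW.
have h1 := ler_wpM2l A0 Kd.
have h2 : D * tail l <= D * (2 * k) * l.
  have : D * tail l <= D * (2 * k) by rewrite ler_wpM2l ?(ltW D0) // (le_trans tail_le) // ler_wpM2l.
  by move/le_trans; apply; rewrite -[leLHS]mulr1 ler_wpM2l // !mulr_ge0 ?(ltW D0) ?(ltW k0).
have h3 : D * (12 * x * l * k) * k <= D * (12 * x * l * k) * 1.
  by rewrite ler_wpM2l // !mulr_ge0 ?(ltW D0) ?(ltW x0) ?(ltW l0) ?(ltW k0).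
have -> : tv_rate * l / (K l)%:R = D * (48 * x + 9 / 2 * x + 2) * l * k by rewrite kE xE.
move: h1 h2 h3; lra.
Qed.

Let G : R := (M l)%:R * expR (sigma ^+ 2 / (2 * T l) ^+ 2 * (M l)%:R ^+ 2 / 2).
Let b : R := kap + 2.

Let kap0 : 0 < kap. Proof. by rewrite divr_gt0 // !mulr_gt0. Qed.

Let M_ge : kap * l <= (M l)%:R.
Proof.
apply: (le_trans (ltW (truncnS_gt _))); by rewrite ler_nat.
Qed.

Let M_le' : (M l)%:R <= kap * l + 2.
Proof.
rewrite /num_freqs -addn2 natrD lerD2r truncn_le mulr_ge0 // ltW //.
Qed.

Let M_le : (M l)%:R <= b * l.
Proof. by apply: (le_trans M_le'); rewrite /b mulrDl; move: l1; lra. Qed.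

(** Bound for [G] from M^2 <= 2 (kap l)^2 + 8: the doubling turns 512 into 256, and the remainder is
    covered by the 1 in the exponent. *)
Let Gam : R := b * l * expR (1 + l / (256 * D ^+ 2)).

Let G_le : G <= Gam.
Proof.
rewrite /G /Gam ler_pM ?expR_ge0 // ler_expR.
have -> : sigma ^+ 2 / (2 * T l) ^+ 2 * (M l)%:R ^+ 2 / 2 = sigma ^+ 2 / (8 * tau ^+ 2 * l) * (M l)%:R ^+ 2.
  by rewrite exprMn sqr_box_radius; field; rewrite !gt_eqF.
have M2 : (M l)%:R ^+ 2 <= 2 * (kap * l) ^+ 2 + 8.
  apply: (@le_trans _ _ ((kap * l + 2) ^+ 2)).
    by rewrite lerXn2r ?nnegrE // addr_ge0 // mulr_ge0 // ltW.
  by have := sqr_ge0 (kap * l - 2); rewrite sqrrB sqrrD; lra.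
have c0 : 0 <= sigma ^+ 2 / (8 * tau ^+ 2 * l) by rewrite divr_ge0 ?sqr_ge0 // !mulr_ge0 ?sqr_ge0 // ltW.
apply: (le_trans (ler_wpM2l c0 M2)).
have -> : sigma ^+ 2 / (8 * tau ^+ 2 * l) * (2 * (kap * l) ^+ 2 + 8) =
    l / (256 * D ^+ 2) + sigma ^+ 2 / (tau ^+ 2 * l).
  by rewrite /degree_rate; field; rewrite !gt_eqF.
rewrite addrC lerD2r ler_pdivrMr ?mulr_gt0 ?exprn_gt0 // mul1r -[leLHS]mulr1.
rewrite ler_pM ?sqr_ge0 // lerXn2r ?nnegrE ?(ltW sigma0) ?(ltW tau0) //.
by move: tau_ge sigma0; lra.
Qed.

Let G_ge0 : 0 <= G. Proof. by rewrite mulr_ge0 ?expR_ge0. Qed.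

Let Gam_ge1 : 1 <= Gam.
Proof.
have e1 : 1 <= expR (1 + l / (256 * D ^+ 2)).
  by rewrite -[leLHS]expR0 ler_expR addr_ge0 // divr_ge0 ?mulr_ge0 ?sqr_ge0 // ltW.
have bl : 1 <= b * l.
  have b1 : 1 <= b by rewrite /b; move: kap0; lra.
  by rewrite -[1]mulr1 ler_pM.
by rewrite -[1]mulr1 ler_pM.
Qed.

Let freq_const : R := 2 * D * (4 * b + 2) + 2 * (2 * tv_rate + 1).

Let tv_bound_le : tv_bound <= (2 * tv_rate + 1) * l * h.
Proof.
have /andP[h0 _] := h01.
have r0 : 0 <= (2 * tv_rate + 1) * l * h.
  by rewrite !mulr_ge0 ?(ltW l0) ?(ltW h0) //; move: tv_rate_gt0; lra.
rewrite -[leRHS]ger0_norm // -sqrtr_sqr ler_wsqrtr // !exprMn.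
apply: (@le_trans _ _ (tv_rate * l * (2 * h ^+ 2))).
  by rewrite ler_wpM2l // mulr_ge0 // ltW.
rewrite [X in X <= _](_ : _ = 2 * tv_rate * l * h ^+ 2); last by ring.
rewrite ler_wpM2r ?sqr_ge0 //.
have r1 := tv_rate_gt0.
apply: ler_pM; [by rewrite mulr_ge0 // ltW|exact: ltW|by nra|].
by have := ler_wpM2l (ltW l0) l1; rewrite mulr1 -expr2.
Qed.

Lemma kernel_error_le :
  2 * (D * (G ^+ d * (G * ((M l)%:R / (2 * T l)) * cell_width (T l) (K l) + G * tail l))) +
    G ^+ d * (2 * tv_bound) <= Gam ^+ d.+1 * (l * h * freq_const).
Proof.
have /andP[h0 h1] := h01.
have T0 := box_radius_gt0.
have -> : G * ((M l)%:R / (2 * T l)) * cell_width (T l) (K l) = G * (2 * (M l)%:R * (K l)%:R^-1).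
  by rewrite /cell_width; field; rewrite !gt_eqF.
have Gd : G ^+ d <= Gam ^+ d.+1.
  apply: (@le_trans _ _ (Gam ^+ d)); last by rewrite ler_weXn2l.
  by rewrite lerXn2r ?nnegrE // (le_trans _ Gam_ge1).
have Gd1 : G ^+ d * G <= Gam ^+ d.+1.
  by rewrite -exprSr lerXn2r ?nnegrE // (le_trans _ Gam_ge1).
have h2 : h ^+ 2 <= h by rewrite expr2 ler_piMl // ltW.
have hl : h <= l * h by rewrite ler_peMl // ltW.
have lh0 : 0 <= l * h by rewrite mulr_ge0 ?ltW.
have MK : 2 * (M l)%:R * (K l)%:R^-1 <= 4 * b * (l * h).
  apply: (@le_trans _ _ (2 * (b * l) * (2 * h ^+ 2))).
    by rewrite ler_pM ?mulr_ge0 ?invr_ge0 // ler_wpM2l.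
  rewrite [X in X <= _](_ : _ = 4 * b * (l * h ^+ 2)); last by ring.
  rewrite ler_wpM2l ?mulr_ge0 //; first by rewrite /b; move: kap0; lra.
  by rewrite ler_wpM2l // ltW.
have tl : tail l <= 2 * (l * h) by apply: (le_trans tail_le); lra.
have t0 : 0 <= tail l by rewrite mulr_ge0 ?expR_ge0.
have first : 2 * (D * (G ^+ d * (G * (2 * (M l)%:R * (K l)%:R^-1) + G * tail l))) <=
    Gam ^+ d.+1 * (2 * D * (4 * b + 2) * (l * h)).
  rewrite [X in X <= _](_ : _ = (G ^+ d * G) * (2 * D * (2 * (M l)%:R * (K l)%:R^-1 + tail l))); last by ring.
  have e0 : 0 <= 2 * (M l)%:R * (K l)%:R^-1 + tail l by rewrite addr_ge0 // !mulr_ge0 // invr_ge0 ltW.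
  apply: ler_pM => //.
  - by rewrite mulr_ge0 // exprn_ge0.
  - by rewrite !mulr_ge0 // ltW.
  - rewrite -mulrA [X in _ <= X](_ : _ = 2 * D * ((4 * b + 2) * (l * h))); last by ring.
    rewrite -mulrA -[X in _ <= X]mulrA ler_wpM2l // ler_wpM2l ?(ltW D0) //.
    by move: MK tl; lra.
have second : G ^+ d * (2 * tv_bound) <= Gam ^+ d.+1 * (2 * (2 * tv_rate + 1) * (l * h)).
  apply: ler_pM; rewrite ?exprn_ge0 // ?mulr_ge0 ?(ltW tv_bound_gt0) //.
  by have := tv_bound_le; lra.
rewrite [X in _ <= X](_ : _ = Gam ^+ d.+1 * (2 * D * (4 * b + 2) * (l * h)) +
   Gam ^+ d.+1 * (2 * (2 * tv_rate + 1) * (l * h))); last by rewrite /freq_const; ring.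
exact: lerD.
Qed.

(** Absorbs l^(d+4) into exp(l/(32 d)); the power collects l^2 from the target rate, l^(d+1) from
    [Gam] and l from the total variation bound. *)
Definition poly_const : R := (d + 4).+1`!%:R / (1 / (32 * D)) ^+ (d + 4).
Definition error_const : R := freq_const * (b * expR 1) ^+ d.+1 * poly_const.

(** The exponents (d+1)/(256 d^2), - 1/(16 d) and 1/(32 d) add up to (1 - 7d)/(256 d^2), which is
    negative. *)
Lemma Gam_error_le : l ^+ 2 * (Gam ^+ d.+1 * (l * h * freq_const)) <= error_const.
Proof.
have b0 : 0 < b by rewrite /b; move: kap0; lra.
have f0 : 0 <= freq_const.
  have r1 := tv_rate_gt0.
  have x1 : 0 <= 2 * D * (4 * b + 2) by apply: mulr_ge0; [rewrite mulr_ge0 // ltW|lra].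
  by rewrite /freq_const; lra.
have be0 : 0 <= (b * expR 1) ^+ d.+1 by rewrite exprn_ge0 // mulr_ge0 ?expR_ge0 // ltW.
have GE : Gam ^+ d.+1 = (b * expR 1) ^+ d.+1 * l ^+ d.+1 * expR (d.+1%:R * (l / (256 * D ^+ 2))).
  by rewrite /Gam expRD expRM_natl !exprMn; ring.
have p := @expr_le_expR R (1 / (32 * D)) l (d + 4) _ (ltW l0).
have {}p : l ^+ (d + 4) <= poly_const * expR (1 / (32 * D) * l).
  by apply: p; rewrite divr_gt0 // mulr_gt0.
have -> : l ^+ 2 * (Gam ^+ d.+1 * (l * h * freq_const)) = freq_const * (b * expR 1) ^+ d.+1 *
   (l ^+ (d + 4) * (expR (d.+1%:R * (l / (256 * D ^+ 2))) * h)).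
  by rewrite GE exprD !exprS expr0; ring.
rewrite /error_const ler_wpM2l ?mulr_ge0 //.
set e1 := expR (d.+1%:R * _).
have e0 : 0 <= e1 * h by rewrite mulr_ge0 ?expR_ge0.
apply: (le_trans (ler_wpM2r e0 p)).
rewrite -[X in X <= _]mulrA; apply: ler_piMr.
  by rewrite divr_ge0 // exprn_ge0 // divr_ge0 // mulr_ge0 // ltW.
rewrite /e1 /h -!expRD -[leRHS]expR0 ler_expR -natr1.
rewrite [X in X <= _](_ : _ = l / (256 * D ^+ 2) * (1 - 7 * D)); last by field; rewrite gt_eqF.
rewrite mulr_ge0_le0 //; first by rewrite divr_ge0 ?mulr_ge0 ?sqr_ge0 // ltW.
by move: D1; lra.
Qed.

Definition rate_const : R :=
  4 * tau ^+ 2 * (2 / cos 1 ^+ 2) * (32 * D / kap ^+ 2 + 2 * D * error_const).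

Lemma deterministic_rate :
  (2 * T l) ^+ 2 * (2 / cos 1 ^+ 2) * (32 * D / (M l)%:R ^+ 2 + 2 * D *
    (2 * (D * (G ^+ d * (G * ((M l)%:R / (2 * T l)) * cell_width (T l) (K l) + G * tail l))) +
     G ^+ d * (2 * tv_bound))) <= rate_const / l.
Proof.
have c0 : 0 < 2 / cos 1 ^+ 2 :> R by rewrite divr_gt0 // exprn_gt0 // cos1_gt0.
rewrite exprMn sqr_box_radius.
have l2 : 0 < l ^+ 2 by rewrite exprn_gt0.
have first : 32 * D / (M l)%:R ^+ 2 <= 32 * D / kap ^+ 2 / l ^+ 2.
  have -> : 32 * D / kap ^+ 2 / l ^+ 2 = 32 * D * ((kap * l) ^+ 2)^-1 by field; rewrite !gt_eqF.
  have kl0 : 0 < kap * l by exact: mulr_gt0 kap0 l0.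
  have kl2 : 0 < (kap * l) ^+ 2 by exact: exprn_gt0.
  have M2 : 0 < (M l)%:R ^+ 2 :> R by rewrite exprn_gt0 // ltr0n.
  apply: ler_wpM2l; first by rewrite mulr_ge0 // ltW.
  by rewrite lef_pV2 ?posrE // lerXn2r ?nnegrE // ltW.
have second := le_trans (ler_wpM2l (ltW l2) kernel_error_le) Gam_error_le.
move: second; set E := 2 * (D * _) + _; rewrite mulrC -ler_pdivlMr // => second.
have second' : 2 * D * E <= 2 * D * (error_const / l ^+ 2) by rewrite ler_wpM2l ?mulr_ge0 ?(ltW D0).
apply: (@le_trans _ _ (2 ^+ 2 * (tau ^+ 2 * l) * (2 / cos 1 ^+ 2) *
   (32 * D / kap ^+ 2 / l ^+ 2 + 2 * D * (error_const / l ^+ 2)))).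
  apply: ler_wpM2l; last exact: lerD.
  apply: mulr_ge0; last exact: ltW.
  by rewrite mulr_ge0 ?sqr_ge0 // mulr_ge0 ?sqr_ge0 // ltW.
have alg (c u v e : R) : 2 ^+ 2 * (tau ^+ 2 * l) * c * (u / l ^+ 2 + v * (e / l ^+ 2)) =
    4 * tau ^+ 2 * c * (u + v * e) / l by field; rewrite gt_eqF.
by rewrite alg.
Qed.

End parameters.

(** * The good event *)

Lemma expR1_le4 (R : realType) : expR 1 <= 4 :> R.
Proof.
have h : expR (1 / 2) <= 1 + 1 / 2 + 2 * (1 / 2) ^+ 2 :> R.
  by apply: expR_le_quadratic; rewrite ger0_norm.
have h2 : expR (1 / 2) <= 2 :> R by lra.
have -> : expR 1 = expR (1 / 2) ^+ 2 :> R by rewrite -expRM_natl; congr expR; field.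
apply: (@le_trans _ _ (2 ^+ 2)); first by rewrite lerXn2r ?nnegrE ?expR_ge0.
by rewrite expr2; lra.
Qed.

Lemma ln_ge1 (R : realType) (n : nat) : (4 <= n)%N -> 1 <= ln (n%:R : R).
Proof.
move=> n4; have n0 : 0 < n%:R :> R by rewrite ltr0n (leq_trans _ n4).
rewrite -ler_expR lnK ?posrE //; apply: (le_trans (expR1_le4 R)).
by rewrite (ler_nat _ 4).
Qed.

(** Makes the sixth-order term (y/8)^6 / 6! of the exponential exceed 2 x^2 once y^2 >= x. *)
Definition sample_threshold (R : realType) : R := 2 * (8 ^+ 6 * 6`!%:R).

Lemma sample_threshold_gt0 (R : realType) : 0 < sample_threshold R.
Proof. by apply: mulr_gt0 => //; apply: mulr_gt0; rewrite ?exprn_gt0 // ltr0n. Qed.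

Lemma concentration_exponent (R : realType) (x K : R) (d : nat) :
  sample_threshold R <= x -> 1 <= K -> K ^+ (8 * d) <= x ->
  K ^+ d * (2 * expR (- (x * (K ^+ (2 * d))^-1 ^+ 2 / 8))) <= x^-1.
Proof.
move=> xC K1 Kx.
have x0 : 0 < x := lt_le_trans (sample_threshold_gt0 R) xC.
have K0 : 0 < K by lra.
pose y := x * (K ^+ (2 * d))^-1 ^+ 2.
have y0 : 0 <= y by rewrite mulr_ge0 ?sqr_ge0 // ltW.
have y2 : x <= y ^+ 2.
  rewrite /y exprMn -exprM -exprVn -exprM [in X in _ <= X]exprVn.
  have -> : (2 * d * (2 * 2) = 8 * d)%N by rewrite mulnAC.
  by rewrite expr2 ler_pdivlMr ?exprn_gt0 // ler_wpM2l // ltW.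
have e6 : 2 * x ^+ 2 <= expR (y / 8).
  have y8 : 0 <= y / 8 by rewrite divr_ge0.
  have := expR_ge1Dxn 5 y8; set e := expR _ => He.
  apply: (@le_trans _ _ ((y / 8) ^+ 6 / 6`!%:R)); last by apply: le_trans He; rewrite lerDr.
  have y6 : x ^+ 3 <= y ^+ 6.
    by rewrite [y ^+ 6](exprM y 2 3) lerXn2r ?nnegrE ?sqr_ge0 // ltW.
  have x3 : sample_threshold R * x ^+ 2 <= x ^+ 3.
    by rewrite [x ^+ 3]exprS ler_wpM2r // sqr_ge0.
  have div6 (u v : R) : (y / u) ^+ 6 / v = y ^+ 6 / (u ^+ 6 * v).
    by rewrite expr_div_n [(_ * v)^-1]invfM mulrA.
  rewrite div6; move: x3; rewrite /sample_threshold.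
  have : 0 < 8 ^+ 6 * 6`!%:R :> R by rewrite mulr_gt0 ?exprn_gt0.
  move: (8 ^+ 6 * 6`!%:R) => v v0 x3.
  by rewrite ler_pdivlMr //; lra.
have Kd : K ^+ d <= x.
  by apply: le_trans Kx; rewrite ler_weXn2l // leq_pmull.
have x2 : 0 < 2 * x ^+ 2 by rewrite mulr_gt0 // exprn_gt0.
have en : expR (- (y / 8)) <= (2 * x ^+ 2)^-1.
  by rewrite expRN lef_pV2 ?posrE ?expR_gt0.
apply: (@le_trans _ _ (x * (2 * (2 * x ^+ 2)^-1))).
  rewrite ler_pM ?exprn_ge0 ?(ltW K0) ?mulr_ge0 ?expR_ge0 //.
  by rewrite ler_wpM2l.
by rewrite le_eqVlt; apply/orP; left; apply/eqP; field; rewrite gt_eqF.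
Qed.

Section application.
Context {R : realType} {dO : measure_display} {Om : measurableType dO}.
Variables (P : probability Om R) (n d : nat) (B sigma : R).
Variable eps : 'I_n -> 'I_d -> Om -> R.
Hypotheses (d0 : (0 < d)%N) (B0 : 0 < B) (sigma0 : 0 < sigma).
Hypothesis noise : iid_gaussian_noise P sigma eps.
Hypotheses (n4 : (4 <= n)%N) (nd : 2 * d%:R <= n%:R :> R).
Hypothesis nC : sample_threshold R <= n%:R.
Variable c : 'I_n -> 'rV[R]_d.
Hypothesis cB : forall i k, `|c i ord0 k| <= B.

Let l : R := ln n%:R.
Let l1 : 1 <= l. Proof. exact: ln_ge1. Qed.
Let n0 : 0 < n%:R :> R. Proof. by rewrite ltr0n (leq_trans _ n4). Qed.
Let tau : R := B + 3 * sigma.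
Let tau_ge : 3 * sigma <= tau. Proof. by rewrite lerDr ltW. Qed.
Local Notation T := (box_radius tau l).
Local Notation K := (num_cells d l).
Local Notation M := (num_freqs d sigma tau l).

Let Y w i : 'rV[R]_d := c i + \row_(k < d) eps i k w.

Let expl : expR l = n%:R. Proof. by rewrite lnK ?posrE. Qed.

Let sqrtl : 1 <= Num.sqrt l.
Proof. by rewrite -sqrtr1 ler_wsqrtr. Qed.

Lemma sum_indic_cell_event w i : (forall k, `|Y w i ord0 k| <= T) ->
  \sum_(b : {ffun 'I_d -> 'I_K}) \1_(cell_event eps T c b i) w = 1 :> R.
Proof.
move=> YT; have T0 := box_radius_gt0 sigma0 tau_ge l1.
have E (b : {ffun 'I_d -> 'I_K}) : \1_(cell_event eps T c b i) w =
    \prod_k \1_(shifted_cell T K (c i ord0 k) (b k)) (eps i k w) :> R.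
  apply: (big_ind2 (fun (A : set Om) (x : R) => \1_A w = x)) => //.
  - by rewrite indicT.
  - by move=> A x A' x' <- <-; rewrite indicI.
rewrite (eq_bigr _ (fun b _ => E b)).
rewrite -(bigA_distr_bigA (fun k (j : 'I_K) => \1_(shifted_cell T K (c i ord0 k) j) (eps i k w))).
apply: big1 => k _; rewrite sum_indic_cell ?num_cells_gt0 //.
suff -> : (- (2 * T) < c i ord0 k + eps i k w <= 2 * T)%R by [].
by have := YT k; rewrite !mxE ler_norml; lra.
Qed.

(** The noise maximum and the cell frequencies each fail with probability at most 1/n. Since the
    event is fixed before any NPMLE is mentioned, the conclusion is purely deterministic on it. *)
Lemma good_event : exists E : set Om,
  measurable E /\ ((1 - 5 / n%:R)%:E <= P E)%E /\
  forall w, E w -> forall (p : nat) (alpha : 'I_p -> R) (theta : 'I_p -> 'rV[R]_d),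
    is_NPMLE sigma (Y w) alpha theta ->
    exists2 H : 'M[R]_(n, p), is_coupling alpha H &
      \sum_i \sum_j H i j * sqnorm (theta j - c i) <= rate_const d sigma tau / l.
Proof.
have T0 := box_radius_gt0 sigma0 tau_ge l1.
have K0 := num_cells_gt0 d l1.
have KR1 : 1 <= K%:R :> R by rewrite ler1n.
pose U : R := 3 * sigma * Num.sqrt l.
have U0 : 0 <= U by rewrite !mulr_ge0 // ?sqrtr_ge0 // ltW.
have [E1 [mE1 [PE1 HE1]]] := noise_max_bound sigma0 noise U0.
pose t : R := (K%:R ^+ (2 * d))^-1.
have t0 : 0 < t <= 2.
  have K2 : 1 <= K%:R ^+ (2 * d) :> R by rewrite exprn_ege1.
  rewrite invr_gt0 (lt_le_trans ltr01 K2) /=.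
  by apply: (@le_trans _ _ 1); rewrite ?invf_le1 ?(lt_le_trans ltr01 K2) // ler1n.
have [E2 [mE2 [PE2 HE2]]] := cell_frequencies noise T K c t0.
have {}PE1 : (P E1 <= (n%:R^-1)%:E)%E.
  apply: (le_trans PE1); rewrite lee_fin.
  have := tail_le_exp sigma0 (lexx _) l1; rewrite -/U => tl.
  apply: (le_trans (ler_wpM2l (ler0n _ _) tl)).
  have -> : expR (- (3 * l)) = (n%:R ^+ 3)^-1 :> R.
    by rewrite -mulrN expRM_natl expRN expl exprVn.
  rewrite natrM -[leRHS]mulr1 [X in X <= _](_ : _ = n%:R^-1 * (2 * d%:R / n%:R)); last by field; rewrite gt_eqF.
  by rewrite ler_wpM2l ?invr_ge0 ?(ltW n0) // ler_pdivrMr // mul1r.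
have {}PE2 : (P E2 <= (n%:R^-1)%:E)%E.
  apply: (le_trans PE2); rewrite lee_fin natrX; apply: concentration_exponent => //.
  by rewrite -expl num_cells_exp.
have mE : measurable (E1 `|` E2) by exact: measurableU.
exists (~` (E1 `|` E2)); split; first exact: measurableC.
split.
  rewrite probability_setC //.
  have PU : (P (E1 `|` E2) <= (2 / n%:R)%:E)%E.
    apply: (le_trans (measureU2 _ mE1 mE2)).
    by rewrite mulr_natl mulr2n EFinD leeD.
  apply: (@le_trans _ _ (1 - (2 / n%:R)%:E)%E); last by rewrite leeB.
  rewrite -EFinB lee_fin lerD2l lerN2 ler_wpM2r ?invr_ge0 ?(ltW n0) //.
  by rewrite ler_nat.
move=> w /= /not_orP[/HE1 epsU /HE2 freq] p alpha theta mle.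
have cT i k : `|c i ord0 k| <= T.
  apply: (le_trans (cB i k)); rewrite /box_radius /tau mulrDl.
  apply: (@le_trans _ _ (B * Num.sqrt l)); first by rewrite ler_peMr // ltW.
  by rewrite lerDl.
have YT i k : `|Y w i ord0 k| <= T.
  rewrite !mxE /box_radius /tau mulrDl; apply: (le_trans (ler_normD _ _)); apply: lerD.
    by apply: (le_trans (cB i k)); rewrite ler_peMr // ltW.
  exact: epsU.
pose ind (b : {ffun 'I_d -> 'I_K}) i : R := \1_(cell_event eps T c b i) w.
have ind0 b i : 0 <= ind b i by [].
have ind_cell b i : ind b i != 0 -> in_cell T (Y w i) b.
  rewrite /ind indicE; case: (boolP (_ \in _)) => [/set_mem /noise_boxP H _ k|]; last by rewrite eqxx.
  have := H k; rewrite /shifted_cell /= in_itv /= !mxE; lra.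
have ind1 i : \sum_b ind b i = 1 by apply: sum_indic_cell_event => k; exact: YT.
have s0 := tv_bound_gt0 d0 sigma0 tau_ge l1.
have s_ge := tv_bound_ge d0 sigma0 tau_ge l1.
have n0' : (0 < n)%N by exact: leq_trans n4.
have [H cH leH] := deterministic_coupling n0' sigma0 T0 K0 (isT : (1 < M)%N)
  mle cT YT ind0 ind_cell ind1 freq s0 s_ge.
exists H => //; apply: (le_trans leH).
exact: (deterministic_rate d0 sigma0 tau_ge l1).
Qed.

End application.

(** Observation i is centred at f* of X at index pi(i), so couplings are first built for the
    permuted centres; all rows having mass 1/n, permuting them keeps a coupling. *)
Lemma coupling_perm (R : realType) (n p d : nat) (pi : {perm 'I_n}) (alpha : 'I_p -> R)
    (theta : 'I_p -> 'rV[R]_d) (x : 'I_n -> 'rV[R]_d) (H : 'M[R]_(n, p)) :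
  is_coupling alpha H ->
  exists2 H' : 'M[R]_(n, p), is_coupling alpha H' &
    \sum_i \sum_j H' i j * sqnorm (theta j - x i) =
    \sum_i \sum_j H i j * sqnorm (theta j - x (pi i)).
Proof.
move=> [H0 [Hc Hr]]; exists (row_perm pi^-1%g H).
  split; first by move=> i j; rewrite mxE.
  split=> [j|i]; last by under eq_bigr do rewrite mxE; rewrite Hr.
  rewrite (reindex_inj (@perm_inj _ pi)) -[RHS]Hc; apply: eq_bigr => i _.
  by rewrite mxE permK.
rewrite (reindex_inj (@perm_inj _ pi)); apply: eq_bigr => i _; apply: eq_bigr => j _.
by rewrite mxE permK.
Qed.

Unset Implicit Arguments.
Set Strict Implicit.
Set Printing Implicit Defensive.

Theorem theorem2 (R : realType) (d : nat) (B sigma : R) :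
  (1 <= d)%N -> 0 < B -> 0 < sigma ->
  exists C0 C : R, 0 < C0 /\ 0 < C /\
  forall (n : nat) (X : 'I_n -> 'rV[R]_d) (pistar : {perm 'I_n})
    (fstar : 'rV[R]_d -> 'rV[R]_d) (psi : 'rV[R]_d -> R^o) (lambda L : R)
    (dO : measure_display) (Om : measurableType dO) (P : probability Om R)
    (eps : 'I_n -> 'I_d -> Om -> R),
    iid_gaussian_noise P sigma eps ->
    is_gradient psi fstar ->
    0 < lambda -> 0 < L ->
    (forall x z, psi x + inner (fstar x) (z - x) + lambda / 2 * sqnorm (x - z) <= psi z) ->
    (forall x z, psi z <= psi x + inner (fstar x) (z - x) + L / 2 * sqnorm (x - z)) ->
    (forall i, Num.sqrt (sqnorm (fstar (X i))) <= B) ->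
    C0 * ln (n%:R) ^+ d.+1 <= n%:R ->
    let Y := fun (w : Om) (i : 'I_n) => fstar (X (pistar i)) + \row_(k < d) eps i k w in
    exists E : set Om, measurable E /\ ((1 - 5 / n%:R)%:E <= P E)%E /\
      forall w, E w ->
      forall (p : nat) (alpha : 'I_p -> R) (theta : 'I_p -> 'rV[R]_d),
        is_NPMLE sigma (Y w) alpha theta ->
      forall G : 'M[R]_(n, p), is_opt_coupling X alpha theta G ->
        n%:R^-1 * \sum_(i < n) sqnorm (barycentric theta G i - fstar (X i))
          <= C * (L / lambda) * (ln (n%:R))^-1.
Proof.
move=> d1 B0 sigma0.
pose tau := B + 3 * sigma.
have thr0 := sample_threshold_gt0 R.
(* The term 2d makes the union bound over the n d noise coordinates at most 1/n. The sample size
   dominates this constant because log n >= 1. *)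
exists (sample_threshold R + 2 * d%:R), (`|rate_const d sigma tau| + 1).
split; first by rewrite ltr_wpDr // mulr_ge0.
split; first by rewrite ltr_wpDl.
move=> n X pistar fstar psi lambda L dO Om P eps noise _ la0 L0 cvx smth fB nC Y.
(* For 1 <= n <= 5 the required probability is at most 0 and the empty event suffices. *)
have [n5|n6] := leqP n 5.
  have [n0|n0] := posnP n.
    (* With the convention 0^-1 = 0 the required probability at n = 0 is 1, so the full event is
       taken; both sides of the bound are then 0. *)
    have nR : n%:R = 0 :> R by rewrite n0.
    exists setT; split; first exact: measurableT.
    split; first by rewrite probability_setT nR invr0 mulr0 subr0.
    move=> w _ p alpha theta _ G _.
    by rewrite nR invr0 mul0r ln0 // invr0 mulr0.
  exists set0; split; first exact: measurable0.
  split=> //; rewrite measure0 lee_fin subr_le0 ler_pdivlMr ?ltr0n // mul1r.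
  by rewrite (ler_nat _ _ 5).
have n4 : (4 <= n)%N by exact: leq_trans n6.
have l1 := @ln_ge1 R n n4.
have C0n : sample_threshold R + 2 * d%:R <= n%:R.
  apply: le_trans nC; rewrite ler_peMr ?exprn_ege1 //.
  by rewrite addr_ge0 ?mulr_ge0 // ltW.
have nthr : sample_threshold R <= n%:R.
  by apply: le_trans C0n; rewrite lerDl mulr_ge0.
have nd : 2 * d%:R <= n%:R :> R by apply: le_trans C0n; rewrite lerDr ltW.
have cB i k : `|fstar (X (pistar i)) ord0 k| <= B.
  apply: le_trans (fB (pistar i)); rewrite -sqrtr_sqr ler_wsqrtr //.
  by rewrite /sqnorm (bigD1 k) //= lerDl sumr_ge0 // => j _; exact: sqr_ge0.
have [E [mE [PE HE]]] := good_event d1 B0 sigma0 noise n4 nd nthr cB.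
exists E; split=> //; split=> // w /HE {}HE p alpha theta /HE[H cH leH] G optG.
have [H' cH' eH'] := coupling_perm pistar theta (fun i => fstar (X i)) cH.
apply: (le_trans (opt_coupling_stable la0 L0 cvx smth optG cH')).
rewrite eH' [(_ + 1) * _]mulrC -[X in _ <= X]mulrA; apply: ler_wpM2l; first by rewrite divr_ge0 // ltW.
apply: (le_trans leH); rewrite ler_wpM2r //; first by rewrite invr_ge0 (le_trans _ l1).
by rewrite (le_trans (ler_norm _)) // lerDl.
Qed.
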